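(* Let $\alpha\ge 1$, and for $\nu>0$ consider on the torus $\mathbb{T}_\alpha=\{0<y<2\pi,\ 0<x<2\pi/\alpha\}$ (periodic boundary conditions) the linearized Navier–Stokes equation $$\partial_t\omega=\nu\Delta\omega-e^{-\nu t}\,\sin y\,\partial_x(1+\Delta^{-1})\omega .\qquad(\ast)$$ Let $X=\{\omega\in L^2(\mathbb{T}_\alpha):\ \omega=\sum_{0\ne k\in\mathbb{Z}}\omega_k(y)e^{ik\alpha x}\}$ be the non-shear vorticity space. (i) (Rectangular torus) Suppose $\alpha>1$. For any $\tau>0$ and $\delta>0$, if $\nu>0$ is small enough (depending on $\alpha,\tau,\delta$), then every solution $\omega(t)$ of $(\ast)$ with initial data $0\neq\omega(0)\in X$ satisfies $$\Big\|\omega\Big(\frac{\tau}{\nu}\Big)\Big\|_{L^2}<\delta\,\|\omega(0)\|_{L^2}.$$ (ii) (Square torus) Suppose $\alpha=1$. Let $P_1$ be the orthogonal projection from $X$ onto $W_1=\mathrm{span}\{\cos x,\sin x\}$. For any $\tau>0$ and $\delta>0$, if $\nu>0$ is small enough (depending on $\tau,\delta$), then every solution of $(\ast)$ with initial data $\omega(0)\in X$, $(I-P_1)\omega(0)\ne0$, satisfies $$\Big\|(I-P_1)\omega\Big(\frac{\tau}{\nu}\Big)\Big\|_{L^2}<\delta\,\|(I-P_1)\omega(0)\|_{L^2}.$$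
   Context: $\Delta^{-1}$ is the inverse Laplacian on mean-zero functions on the torus; elements of $X$ have zero mean (indeed zero $x$-average for each $y$). The equation $(\ast)$ is the linearization of the 2D Navier–Stokes vorticity equation with viscosity $\nu$ around the Kolmogorov (bar) flow with velocity $e^{-\nu t}(\sin y,0)$; $\omega$ is the vorticity perturbation. The space $X$ is invariant under $(\ast)$. *)

(* Defs.v *)
From HB Require Import structures.
From mathcomp Require Import all_boot all_order all_algebra.
From mathcomp Require Import all_classical all_reals all_analysis.
Set Implicit Arguments.
Unset Strict Implicit.
Unset Printing Implicit Defensive.
Import Order.TTheory GRing.Theory Num.Theory.
Import numFieldNormedType.Exports.
Local Open Scope classical_set_scope.
Local Open Scope ring_scope.

Section Torus.
Context {R : realType}.

Lemma lebesgue_itv_fin (l : R) :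
  (@lebesgue_measure R `]0%R, l[%classic < +oo)%E.
Proof.
rewrite lebesgue_measure_itv/=; case: ifP => _; last by rewrite ltry.
by rewrite -EFinB ltry.
Qed.

(* Lebesgue measure restricted to a period cell ]0, l[ of the circle R / l Z. *)
Definition circle (l : R) : {finite_measure set (measurableTypeR R) -> \bar R} :=
  @mfrestr _ (measurableTypeR R) R _ lebesgue_measure (measurable_itv `]0, l[) (lebesgue_itv_fin l).

(* A point z has z.1 = x, of period 2 pi / alpha, and z.2 = y, of period 2 pi. *)
Definition torus (alpha : R) :
    {measure set (measurableTypeR R * measurableTypeR R) -> \bar R} :=
  (circle (2 * pi / alpha) \x circle (2 * pi))%E.

(* Elements of L^2 are represented by real-valued measurable functions on the
   plane, whose values outside the period cell are irrelevant. *)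
Definition L2 (alpha : R) : set (R * R -> R) :=
  [set f | f \in Lfun (torus alpha) 2%:E].

Definition ip (alpha : R) (f g : R * R -> R) : R :=
  \int[torus alpha]_z (f z * g z).

Definition L2norm (alpha : R) (f : R * R -> R) : R :=
  fine ('N[torus alpha]_2%:E[EFin \o f]).

Definition is_zero (alpha : R) (f : R * R -> R) : Prop :=
  {ae torus alpha, forall z, f z = 0}.

(* C^oo: all iterated directional derivatives exist and are continuous. *)
Definition smooth (f : R * R -> R) : Prop :=
  forall s : seq (R * R),
    let g := foldr (fun v h => 'D_v h) f s in
    continuous g /\ forall z v, derivable g z v.

Definition periodic (alpha : R) (f : R * R -> R) : Prop :=
  forall x y, f (x + 2 * pi / alpha, y) = f (x, y) /\ f (x, y + 2 * pi) = f (x, y).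

Definition test_function (alpha : R) (f : R * R -> R) : Prop :=
  smooth f /\ periodic alpha f.

Definition dx (f : R * R -> R) : R * R -> R := 'D_((1, 0) : R * R) f.
Definition dy (f : R * R -> R) : R * R -> R := 'D_((0, 1) : R * R) f.
Definition laplacian (f : R * R -> R) : R * R -> R := dx (dx f) \+ dy (dy f).

(* psi = Delta^-1 f: psi is the mean-zero solution of Delta psi = f, in the
   sense of distributions on the torus.  Taking phi = 1 forces f to have mean
   zero. *)
Definition inv_laplacian (alpha : R) (f psi : R * R -> R) : Prop :=
  [/\ L2 alpha psi,
      \int[torus alpha]_z psi z = 0 &
      forall phi, test_function alpha phi ->
        ip alpha psi (laplacian phi) = ip alpha f phi].

(* Weak (equivalently, mild) solutions in C([0, +oo[; L^2).  The transport term
   is integrated by parts in x, hence the sign in front of expR. *)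
Definition solution (alpha nu : R) (omega : R -> R * R -> R) : Prop :=
  [/\ forall t : R, 0 <= t -> L2 alpha (omega t),
      forall t0 : R, 0 <= t0 ->
        L2norm alpha (omega t \- omega t0)
          @[t --> within [set t : R | 0 <= t] (nbhs t0)] --> (0 : R) &
      exists psi : R -> R * R -> R,
        (forall t : R, 0 <= t -> inv_laplacian alpha (omega t) (psi t)) /\
        forall phi, test_function alpha phi -> forall t : R, 0 < t ->
          is_derive t (1 : R) (fun s : R => ip alpha (omega s) phi)
            (nu * ip alpha (omega t) (laplacian phi) +
             expR (- (nu * t)) *
               ip alpha (omega t \+ psi t) (fun z => sin z.2 * dx phi z))].

(* Real form of the sum over k <> 0 of omega_k(y) e^(i k alpha x): the terms k
   and -k are grouped into a k y * cos (k alpha x) + b k y * sin (k alpha x).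
   The series converges in L^2. *)
Definition nonshear (alpha : R) (f : R * R -> R) : Prop :=
  L2 alpha f /\
  exists a b : nat -> R -> R,
    (forall k, a k \in Lfun (circle (2 * pi)) 2%:E /\
               b k \in Lfun (circle (2 * pi)) 2%:E) /\
    L2norm alpha (fun z => f z -
      \sum_(1 <= k < N.+1) (a k z.2 * cos (k%:R * alpha * z.1) +
                            b k z.2 * sin (k%:R * alpha * z.1)))
      @[N --> \oo] --> (0 : R).

Definition W1 : set (R * R -> R) :=
  [set f | exists a b : R, f = fun z => a * cos z.1 + b * sin z.1].

Definition is_orth_proj (alpha : R) (W : set (R * R -> R)) (f p : R * R -> R) :=
  W p /\ forall g, W g -> ip alpha (f \- p) g = 0.

Definition P1 (alpha : R) (f : R * R -> R) : R * R -> R :=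
  get (is_orth_proj alpha W1 f).

End Torus.

(* Main.v *)
Require Import Defs.
From mathcomp Require Import all_boot all_order all_algebra.
From mathcomp Require Import all_classical all_reals all_analysis.
From mathcomp Require Import measurable_realfun.
From mathcomp Require Import zify ring lra.
Set Implicit Arguments.
Unset Strict Implicit.
Unset Printing Implicit Defensive.
Import Order.TTheory GRing.Theory Num.Theory.
Import numFieldNormedType.Exports.
Local Open Scope classical_set_scope.
Local Open Scope ring_scope.

(** The equation decouples into the x-frequencies m = k alpha. On one of them, put
    d_j = m^2 + j^2 and lam_j = 1 - 1/d_j, the symbol of 1 + Laplacian^-1. The
    coefficients c_j of cos (m x + j y + s), for a fixed phase s, solve the real
    tridiagonal system
      c_j' = - nu d_j c_j + mu (v_(j+1) - v_(j-1)),   v_j = lam_j c_j,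
    with mu = e^(-nu t) m / 2. The energy E = sum lam_j c_j^2 is not changed by
    the transport term, which is antisymmetric in v, and viscosity dissipates it
    at the rate 2 nu d_j at site j. Over the time tau / nu this is only a fixed
    factor for small j, so one has to show that transport pushes the energy
    towards large |j|.

    This is done by the virial functional Q = sum W_j v_j v_(j+1), where W_j is
    - (j + 1/2) cut off at |j| = N. Along the transport, Q' is mu times
      sum j (lam_(j+1) - lam_(j-1)) v_j^2 + 1/2 sum lam_j (v_(j-1) + v_(j+1))^2
    up to errors living at |j| close to N. The first sum is positive because
    lam_j increases with |j|; it misses j = 0 only, and the second one recovers
    v_0 from v_2. The errors at |j| = N, as well as the viscous part of Q', are
    paid by the energy dissipation. Hence Phi = E - nu A Q satisfies
    Phi' <= - (nu K / 2) Phi with K as large as desired, A, N and then the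
    smallness of nu being chosen in this order (lyap_dissipation), and E is
    multiplied by at most a multiple of e^(-K tau / 2) on [0, tau / nu]
    (mode_decay). For large k viscosity alone is enough (mode_decay_large), so
    that a single bound on nu serves all k. To stay within finite sums, the
    energy is cut off by a tent of width L, at the price of a flux O(1/L).

    At time 0 the energies are bounded by the L^2 norm (modes_bessel). At time
    tau / nu the converse is needed (parseval), hence the completeness of the
    trigonometric system (trig_dense): the polynomials (1 - w^n)^(n 2^n) of a
    well-chosen trigonometric polynomial w converge to the indicator of a ray,
    and a Dynkin argument reaches all measurable sets. The modes k = 0 solve a
    heat equation with zero data (shear_mode_zero).

    If alpha > 1, lam_j is bounded below by 1 - alpha^-2 and E is equivalent to
    the squared norm. If alpha = 1, lam_j vanishes exactly at k = 1, j = 0, that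
    is on W_1. Since neighbouring sites only feel v_j = lam_j c_j, the removal
    of this mode by I - P_1 leaves a closed system, to which the same estimate
    applies. *)

(** * Sums over windows of integers *)

Section WindowSums.
Context {R : realType}.
Implicit Types (a b h : int -> R) (L : nat).

Definition sumZ L a : R := \sum_(i < L.*2.+1) a (i%:Z - L%:Z).

Lemma sumZ_tele L h :
  sumZ L (fun j => h (j + 1) - h j) = h (L%:Z + 1) - h (- L%:Z).
Proof.
rewrite /sumZ (eq_bigr (fun i : 'I_(L.*2.+1) =>
  (fun n : nat => h (n%:Z - L%:Z)) i.+1 - (fun n : nat => h (n%:Z - L%:Z)) i)).
  rewrite -(big_mkord xpredT (fun i => (fun n : nat => h (n%:Z - L%:Z)) i.+1
    - (fun n : nat => h (n%:Z - L%:Z)) i)) telescope_sumr //.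
  by congr (h _ - h _); lia.
by move=> i _ /=; congr (h _ - h _); lia.
Qed.

Lemma sumZD L a b : sumZ L (fun j => a j + b j) = sumZ L a + sumZ L b.
Proof. exact: big_split. Qed.

Lemma sumZZ L (r : R) a : sumZ L (fun j => r * a j) = r * sumZ L a.
Proof. by rewrite /sumZ mulr_sumr. Qed.

Lemma sumZ_le L a b : (forall j : int, `|j| <= L%:Z -> a j <= b j) ->
  sumZ L a <= sumZ L b.
Proof.
by move=> ab; apply: ler_sum => i _; apply: ab; have := ltn_ord i; lia.
Qed.

(** Inequalities between window sums are checked summand by summand, up to a
    telescoping term; all the summations by parts below take this form. *)
Lemma sumZ_le_tele L h a b :
  h (L%:Z + 1) = 0 -> h (- L%:Z) = 0 ->
  (forall j : int, `|j| <= L%:Z -> a j <= b j + (h (j + 1) - h j)) ->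
  sumZ L a <= sumZ L b.
Proof.
move=> h1 h2 ab; apply: (le_trans (sumZ_le ab)).
by rewrite sumZD sumZ_tele h1 h2 subrr addr0.
Qed.

Lemma sumZS L a : sumZ L.+1 a = sumZ L a + a (L.+1%:Z) + a (- L.+1%:Z).
Proof.
rewrite /sumZ doubleS big_ord_recl big_ord_recr /=.
rewrite [RHS]addrC; congr (_ + _); first by congr a; lia.
congr (_ + _); last by congr a; rewrite /bump /=; lia.
by apply: eq_bigr => i _; congr a; rewrite /bump /=; lia.
Qed.

Lemma sumZ_mono L1 L2 a : (forall j, 0 <= a j) -> (L1 <= L2)%N ->
  sumZ L1 a <= sumZ L2 a.
Proof.
move=> a0 /subnK <-; elim: (L2 - L1)%N => [//|n IH].
by rewrite addSn sumZS -addrA; apply: (le_trans IH); rewrite lerDl addr_ge0.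
Qed.

Lemma sumZ_ge0 L a : (forall j, 0 <= a j) -> 0 <= sumZ L a.
Proof. by move=> a0; apply: sumr_ge0. Qed.

Lemma sumZ_shift L a : (forall j, 0 <= a j) ->
  sumZ L (fun j => a (j + 1)) <= sumZ L.+1 a.
Proof.
move=> a0; have -> : sumZ L (fun j => a (j + 1)) =
    sumZ L a + sumZ L (fun j => a (j + 1) - a j).
  by rewrite -sumZD; apply: eq_bigr => i _; lra.
rewrite (sumZ_tele L a) sumZS.
have -> : L%:Z + 1 = L.+1%:Z by lia.
by have := a0 (- L%:Z); have := a0 (- L.+1%:Z); lra.
Qed.

End WindowSums.

(** * Symbols, weights and cutoffs *)

Section Weights.
Context {R : realType}.

(** Minus the symbol of the Laplacian on e^(i (m x + j y)). *)
Definition dsq (m : R) (j : int) : R := m ^+ 2 + j%:~R ^+ 2.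
(** The symbol of 1 + Laplacian^-1 on e^(i (m x + j y)). *)
Definition lam (m : R) (j : int) : R := 1 - (dsq m j)^-1.
(** The half-integer shift makes the weight odd under j |-> - 1 - j, the
    reflection of the links {j, j + 1}. *)
Definition wt (N : nat) (j : int) : R :=
  if (- N%:Z <= j) && (j < N%:Z) then - (j%:~R + 2^-1) else 0.
(** A tent: it varies by at most 1/L between neighbouring sites, which makes
    the energy flux through it small. *)
Definition chi (L : nat) (j : int) : R := Num.max 0 (1 - `|j|%:~R / L%:R).

Lemma intr_succ (j : int) : (j + 1)%:~R = j%:~R + 1 :> R.
Proof. by rewrite intrD. Qed.

Lemma intr_pred (j : int) : (j - 1)%:~R = j%:~R - 1 :> R.
Proof. by rewrite intrB. Qed.

Lemma dsq_ge1 m j : 1 <= m -> 1 <= dsq m j.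
Proof. by move=> m1; rewrite /dsq; have := sqr_ge0 (j%:~R : R); nra. Qed.

Lemma dsq_gt0 m j : 1 <= m -> 0 < dsq m j.
Proof. by move=> m1; apply: lt_le_trans (dsq_ge1 j m1). Qed.

Lemma dsq_ge0 m j : 1 <= m -> 0 <= dsq m j.
Proof. by move=> m1; exact: ltW (dsq_gt0 j m1). Qed.

Lemma dsq_ge_sqr m j : 1 <= m -> j%:~R ^+ 2 <= dsq m j.
Proof. by move=> m1; rewrite /dsq lerDr sqr_ge0. Qed.

Lemma dsq_succ_le m j : 1 <= m -> dsq m (j + 1) <= 4 * dsq m j.
Proof. by move=> m1; rewrite /dsq intr_succ; have := sqr_ge0 (j%:~R - 1 : R); nra. Qed.

Lemma dsq_le_succ m j : 1 <= m -> dsq m j <= 4 * dsq m (j + 1).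
Proof. by move=> m1; rewrite /dsq intr_succ; have := sqr_ge0 (j%:~R + 2 : R); nra. Qed.

Lemma lam_ge0 m j : 1 <= m -> 0 <= lam m j.
Proof. by move=> m1; rewrite /lam subr_ge0 invf_le1 ?dsq_ge1 ?dsq_gt0. Qed.

Lemma lam_le1 m j : 1 <= m -> lam m j <= 1.
Proof. by move=> m1; rewrite /lam gerBl invr_ge0 ltW ?dsq_gt0. Qed.

Lemma lam1_ge m : 1 <= m -> 2^-1 <= lam m 1.
Proof.
move=> m1; rewrite /lam /dsq mulr1z expr1n.
have : (m ^+ 2 + 1)^-1 <= (2:R)^-1 by rewrite lef_pV2 ?posrE //; nra.
lra.
Qed.

(** The right-hand side has the sign of j: this monotonicity of the symbol is
    what makes the virial functional coercive. *)
Lemma lam_diff m j : 1 <= m -> lam m (j + 1) - lam m (j - 1) =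
  4 * j%:~R / (dsq m (j - 1) * dsq m (j + 1)).
Proof.
move=> m1; rewrite /lam.
have a0 : dsq m (j + 1) != 0 by rewrite gt_eqF ?dsq_gt0.
have b0 : dsq m (j - 1) != 0 by rewrite gt_eqF ?dsq_gt0.
have <- : dsq m (j + 1) - dsq m (j - 1) = 4 * j%:~R.
  by rewrite /dsq intr_succ intr_pred; ring.
by field; rewrite a0 b0.
Qed.

Lemma chi_ge0 L j : 0 <= chi L j.
Proof. by rewrite /chi le_max lexx. Qed.

Lemma chi_le1 L j : chi L j <= 1.
Proof.
by rewrite /chi ge_max ler01 gerBl; apply: divr_ge0.
Qed.

Lemma chi_eq0 L j : (0 < L)%N -> L%:Z <= `|j| -> chi L j = 0.
Proof.
move=> L0 Lj; rewrite /chi; apply/max_idPl.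
rewrite subr_le0 ler_pdivlMr ?ltr0n // mul1r.
by rewrite -[L%:R]/(L%:Z%:~R) ler_int.
Qed.

Lemma chi_ge L j : (0 < L)%N -> 2 * `|j| <= L%:Z -> 2^-1 <= chi L j.
Proof.
move=> L0 Lj; rewrite /chi le_max; apply/orP; right.
suff : `|j|%:~R / L%:R <= 2^-1 :> R by lra.
rewrite ler_pdivrMr ?ltr0n // ler_pdivlMl // -[L%:R]/(L%:Z%:~R).
by rewrite -[2 : R]/(2%:Z%:~R) -intrM ler_int.
Qed.

Lemma chi_lip L j : (0 < L)%N -> `|chi L j - chi L (j + 1)| <= L%:R^-1.
Proof.
move=> L0; have L0' : 0 < L%:R^-1 :> R by rewrite invr_gt0 ltr0n.
have : `| `|j|%:~R - `|j + 1|%:~R | <= 1 :> R.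
  by rewrite -intrB -intr_norm -[1]/(1%:Z%:~R) ler_int; lia.
rewrite /chi; set a : R := `|j|%:~R; set b : R := `|j + 1|%:~R.
rewrite ler_norml => /andP[ab1 ab2].
have e1 : a / L%:R - b / L%:R <= L%:R^-1 by nra.
have e2 : b / L%:R - a / L%:R <= L%:R^-1 by nra.
rewrite ler_norml; case: (leP 0 (1 - a / L%:R)); case: (leP 0 (1 - b / L%:R)); lra.
Qed.

Lemma wt_bound N j : `|wt N j| <= N%:R.
Proof.
rewrite /wt; case: ifP => [/andP[h1 h2]|_]; last by rewrite normr0.
have : (- N%:Z)%:~R <= j%:~R :> R by rewrite ler_int.
have : (j + 1)%:~R <= N%:Z%:~R :> R by rewrite ler_int; lia.
rewrite intr_succ intrN ler_norml.
set a : R := N%:Z%:~R; rewrite -[N%:R]/a; lra.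
Qed.

Lemma wt_out N j : ~~ ((- N%:Z <= j) && (j < N%:Z)) -> wt N j = 0.
Proof. by rewrite /wt => /negbTE ->. Qed.

Lemma wt_in N j : - N%:Z <= j -> j < N%:Z -> wt N j = - (j%:~R + 2^-1).
Proof. by rewrite /wt => -> ->. Qed.

End Weights.

(** * The virial functional *)

Section Virial.
Context {R : realType} (m : R) (c : int -> R).
Local Notation lam := (lam m).
Local Notation dsq := (dsq m).
Local Notation v := (fun j => lam j * c j).
Local Notation wt := (@wt R).

Lemma young (a b : R) : `|a * b| <= 2^-1 * (a ^+ 2 + b ^+ 2).
Proof.
by rewrite ler_norml; have := sqr_ge0 (a + b); have := sqr_ge0 (a - b); nra.
Qed.

Lemma sumZ_eq_tele L (h a b : int -> R) :
  h (L%:Z + 1) = 0 -> h (- L%:Z) = 0 ->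
  (forall j : int, a j = b j + (h (j + 1) - h j)) ->
  sumZ L a = sumZ L b.
Proof.
move=> h1 h2 ab; rewrite (_ : a = fun j => b j + (h (j + 1) - h j)); last exact/funext.
by rewrite sumZD sumZ_tele h1 h2 subrr addr0.
Qed.

(** With a constant cutoff the left-hand side would telescope to 0; only the
    differences chi_j - chi_(j+1) survive. *)
Lemma energy_flux L mu : (0 < L)%N -> 0 <= mu ->
  sumZ L (fun j => 2 * mu * (chi L j * (v j * (v (j + 1) - v (j - 1))))) <=
  mu / L%:R * sumZ L (fun j => v j ^+ 2 + v (j + 1) ^+ 2).
Proof.
move=> L0 mu0; rewrite -sumZZ.
apply: (@sumZ_le_tele _ L (fun j => 2 * mu * chi L j * (v j * v (j - 1)))).
- by rewrite chi_eq0 ?mulr0 ?mul0r //; lia.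
- by rewrite chi_eq0 ?mulr0 ?mul0r //; lia.
move=> j _ /=; rewrite addrK.
have := chi_lip (R := R) j L0.
set a := lam j * c j; set b := lam (j + 1) * c (j + 1).
set x := chi L j; set y := chi L (j + 1); set e := L%:R^-1 => xy.
have : (x - y) * (a * b) <= e * (2^-1 * (a ^+ 2 + b ^+ 2)).
  apply: (le_trans (ler_norm _)); rewrite normrM ler_pM //.
  exact: young.
move=> /(ler_wpM2l (mulr_ge0 (ler0n R 2) mu0)); lra.
Qed.

(** The left-hand side is the derivative of sum W_j v_j v_(j+1) along
    v_j' = lam_j (v_(j+1) - v_(j-1)). It is resummed so that each square v_j^2 and
    each product v_(j-1) v_(j+1) occurs at one site only. *)
Lemma virial_identity L N : (N < L)%N ->
  sumZ L (fun j => wt N j * (lam j * (v (j + 1) - v (j - 1)) * v (j + 1) +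
     v j * (lam (j + 1) * (v (j + 2) - v j)))) =
  sumZ L (fun j => (wt N (j - 1) * lam (j - 1) - wt N j * lam (j + 1)) * v j ^+ 2
     + (wt N (j - 1) - wt N j) * lam j * (v (j - 1) * v (j + 1))).
Proof.
move=> NL; apply: (@sumZ_eq_tele L (fun j => wt N (j - 1) *
   (lam (j - 1) * v j ^+ 2 + lam j * (v (j - 1) * v (j + 1))))).
- by rewrite wt_out ?mul0r //; lia.
- by rewrite wt_out ?mul0r //; lia.
by move=> j /=; rewrite addrK -(addrA j 1 1); ring.
Qed.

(** What is left of the coefficient of v_j^2 when the products v_(j-1) v_(j+1)
    are bounded by squares. *)
Definition vcoef N j : R := wt N (j - 1) * lam (j - 1) - wt N j * lam (j + 1)
  - 2^-1 * `|wt N j - wt N (j + 1)| * lam (j + 1)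
  - 2^-1 * `|wt N (j - 2) - wt N (j - 1)| * lam (j - 1).

(** At j = 1 the product v_0 v_2 is completed to a square instead of being
    bounded: as vcoef vanishes at 0, this square is the only control on v_0. *)
Lemma virial_lower L N : 1 <= m -> (N.+1 < L)%N -> (1 < N)%N ->
  sumZ L (fun j => vcoef N j * v j ^+ 2
     + (j == 1)%:R * (2^-1 * lam 1 * (v 0 + v 2) ^+ 2)) <=
  sumZ L (fun j => (wt N (j - 1) * lam (j - 1) - wt N j * lam (j + 1)) * v j ^+ 2
     + (wt N (j - 1) - wt N j) * lam j * (v (j - 1) * v (j + 1))).
Proof.
move=> m1 NL N1.
pose k j : R := 2^-1 * `|wt N (j - 1) - wt N j| * lam j * v (j - 1) ^+ 2.
pose l j : R := 2^-1 * `|wt N (j - 2) - wt N (j - 1)| * lam (j - 1) * v j ^+ 2.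
apply: (@sumZ_le_tele _ L (fun j => l j - k j)).
- by rewrite /k /l !wt_out ?subrr ?normr0 ?mulr0 ?mul0r ?subrr //; lia.
- by rewrite /k /l !wt_out ?subrr ?normr0 ?mulr0 ?mul0r ?subrr //; lia.
move=> j _; rewrite /k /l /vcoef.
have -> : j + 1 - 2 = j - 1 by lia.
rewrite addrK.
case: eqP => [->|_].
  have -> : 1 - 1 = 0 :> int by []. 
  have -> : 1 - 2 = -1 :> int by [].
  have -> : 1 + 1 = 2 :> int by [].
  rewrite (@wt_in _ N 0) ?(@wt_in _ N 1) ?(@wt_in _ N (-1)); try lia.
  rewrite !mulr0z mulr1z mulrN1z.
  have -> : `|- (0 + 2^-1) - - (1 + 2^-1)| = 1 :> R by rewrite gtr0_norm; lra.
  by rewrite /=; lra.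
set a := lam (j - 1) * c (j - 1); set b := lam (j + 1) * c (j + 1).
set g := wt N (j - 1) - wt N j.
have : - (`|g| * lam j * (2^-1 * (a ^+ 2 + b ^+ 2))) <= g * lam j * (a * b).
  have l0 := lam_ge0 j m1.
  suff : `|g * lam j * (a * b)| <= `|g| * lam j * (2^-1 * (a ^+ 2 + b ^+ 2)).
    by rewrite ler_norml => /andP[].
  rewrite normrM (normrM g) (ger0_norm l0) ler_wpM2l ?young //.
  by rewrite mulr_ge0.
by rewrite /=; lra.
Qed.

(** Where the weight is linear, the bounds on the products cancel the diagonal
    terms, up to the variation of the symbol. *)
Lemma vcoef_in N (j : int) : `|j| + 2 <= N%:Z ->
  vcoef N j = j%:~R * (lam (j + 1) - lam (j - 1)).
Proof.
move=> jN; rewrite /vcoef !wt_in; try lia.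
rewrite !intr_succ !intr_pred intrB; set x : R := j%:~R.
have -> : `|- (x + 2^-1) - - (x + 1 + 2^-1)| = 1 by rewrite gtr0_norm; lra.
have -> : `|- (x - 2%:~R + 2^-1) - - (x - 1 + 2^-1)| = 1.
  by rewrite gtr0_norm -[2%:~R]/(2:R); lra.
lra.
Qed.

Lemma vcoef_out N (j : int) : N%:Z + 2 <= `|j| -> vcoef N j = 0.
Proof.
move=> jN; rewrite /vcoef !wt_out; try lia.
by rewrite subrr normr0 !mulr0 !mul0r !subr0.
Qed.

Lemma vcoef_ge N j : 1 <= m -> - (4 * N%:R) <= vcoef N j.
Proof.
move=> m1; rewrite /vcoef.
have := wt_bound (R := R) N (j - 1); have := wt_bound (R := R) N j.
have := wt_bound (R := R) N (j + 1); have := wt_bound (R := R) N (j - 2).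
move=> b1 b2 b3 b4.
have k1 := lam_ge0 (j + 1) m1; have k2 := lam_ge0 (j - 1) m1.
have k3 := lam_le1 (j + 1) m1; have k4 := lam_le1 (j - 1) m1.
have f (x y B : R) : 0 <= y -> y <= 1 -> `|x| <= B -> x * y <= B.
  move=> y0 y1 xB; apply: (le_trans (ler_norm _)); rewrite normrM (ger0_norm y0).
  by have := normr_ge0 x; nra.
have n0 : 0 <= N%:R :> R by [].
have e1 := f (- wt N (j - 1)) _ N%:R k2 k4.
have e2 := f (wt N j) _ N%:R k1 k3.
have h (x y : R) : `|x| <= N%:R -> `|y| <= N%:R -> `|2^-1 * `|x - y| | <= N%:R :> R.
  move=> xN yN; rewrite normrM normr_id gtr0_norm ?invr_gt0 //.
  by have := ler_normB x y; lra.
have e3 := f _ _ _ k1 k3 (h _ _ b3 b2).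
have e4 := f _ _ _ k2 k4 (h _ _ b1 b4).
by rewrite normrN in e1; have := e1 b4; have := e2 b3; lra.
Qed.

(** Three zones. For |j| <= J the weight is linear and the symbol increases
    with |j|. Beyond the support of the weight all terms vanish. Near |j| = N the
    loss is at most 4 N v_j^2, where d_j is of order N^2. *)
Lemma virial_coercive_term (N J L : nat) (j : int) : 1 <= m ->
  (J.+2 <= N)%N -> (1 < N)%N -> (2 * N.+1 <= L)%N ->
  ((1 <= `|j|) && (`|j| <= J%:Z))%:R * (4 / (m ^+ 2 + J.+1%:R ^+ 2) ^+ 2) * v j ^+ 2
   - 32 / N%:R * (chi L j * dsq j * v j ^+ 2) <= vcoef N j * v j ^+ 2.
Proof.
move=> m1 JN N1 NL.
have N0 : 0 < N%:R :> R by rewrite ltr0n; lia.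
have p0 := sqr_ge0 (v j); set p := v j ^+ 2 in p0 *.
have d1 := dsq_ge1 j m1; have c0 := @chi_ge0 R L j.
have q0 : 0 <= 32 / N%:R * (chi L j * dsq j * p).
  have d0 := le_trans ler01 d1.
  by apply: mulr_ge0; [rewrite divr_ge0 // ltW|apply: mulr_ge0 => //; apply: mulr_ge0].
have [jN|jN] := lerP (`|j| + 2) N%:Z.
  rewrite vcoef_in // lam_diff //.
  have E : j%:~R * (4 * j%:~R / (dsq (j - 1) * dsq (j + 1))) =
     4 * j%:~R ^+ 2 / (dsq (j - 1) * dsq (j + 1)) :> R by ring.
  rewrite E.
  have dm := dsq_gt0 (j - 1) m1; have dp := dsq_gt0 (j + 1) m1.
  case: (boolP (_ && _)) => [/andP[j1 jJ]|_] /=; last first.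
    rewrite !mul0r sub0r (le_trans (y := 0)) ?oppr_le0 //.
    apply: mulr_ge0 => //; apply: divr_ge0; first by rewrite mulr_ge0 ?sqr_ge0.
    by rewrite ltW // mulr_gt0.
  rewrite mul1r lerBlDr; apply: ler_wpDr => //; apply: ler_wpM2r => //.
  have M0 : 0 < m ^+ 2 + J.+1%:R ^+ 2 by rewrite ltr_pwDl ?sqr_ge0 // exprn_gt0 // (lt_le_trans ltr01).
  have jj : 1 <= j%:~R ^+ 2 :> R.
    by rewrite expr2 -intrM -[1]/(1%:Z%:~R) ler_int; clear -j1; nia.
  have dmb : dsq (j - 1) <= m ^+ 2 + J.+1%:R ^+ 2.
    rewrite /dsq lerD2l -[J.+1%:R]/(J.+1%:Z%:~R) !expr2 -!intrM ler_int.
    by clear -jJ; nia.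
  have dpb : dsq (j + 1) <= m ^+ 2 + J.+1%:R ^+ 2.
    rewrite /dsq lerD2l -[J.+1%:R]/(J.+1%:Z%:~R) !expr2 -!intrM ler_int.
    by clear -jJ; nia.
  apply: ler_pM; rewrite ?invr_ge0 ?sqr_ge0 //; first by lra.
  rewrite lef_pV2 ?posrE ?exprn_gt0 ?mulr_gt0 // expr2.
  by apply: ler_pM => //; exact: ltW.
have -> : ((1 <= `|j|) && (`|j| <= J%:Z)) = false by lia.
rewrite !mul0r sub0r.
have [jN2|jN2] := lerP (N%:Z + 2) `|j|.
  by rewrite vcoef_out // mul0r oppr_le0.
have hv := vcoef_ge N j m1.
apply: (le_trans (y := - (4 * N%:R) * p)); last exact: ler_wpM2r.
rewrite mulNr lerN2.
have ch : 2^-1 <= chi L j :> R by apply: chi_ge; lia.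
have dN : N%:R ^+ 2 / 4 <= dsq j.
  apply: le_trans (dsq_ge_sqr j m1); rewrite ler_pdivrMr //.
  rewrite -[N%:R]/(N%:Z%:~R) -[4 : R]/(4%:Z%:~R) !expr2 -!intrM ler_int.
  by clear -jN N1; nia.
suff : 4 * N%:R <= 32 / N%:R * (chi L j * dsq j).
  by move=> /(ler_wpM2r p0); rewrite -!mulrA.
have : 32 / N%:R * (2^-1 * (N%:R ^+ 2 / 4)) = 4 * N%:R :> R by field; lra.
move=> <-; apply: ler_wpM2l; first by rewrite divr_ge0 // ltW.
by apply: ler_pM => //; nra.
Qed.

(** Since d_j and d_(j+1) are comparable, each link is paid by the dissipation
    at its two ends, times the size N of the weight. *)
Lemma viscous_term N L : 1 <= m -> (2 * N.+1 <= L)%N ->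
  sumZ L (fun j => wt N j * (dsq j + dsq (j + 1)) * (v j * v (j + 1))) <=
  sumZ L (fun j => 10 * N%:R * (chi L j * dsq j * v j ^+ 2)).
Proof.
move=> m1 NL; pose q j : R := ((`|j| <= N%:Z)%R : bool)%:R * (dsq j * v j ^+ 2).
have q0 j : 0 <= q j.
  by apply: mulr_ge0 => //; rewrite mulr_ge0 ?sqr_ge0 // ltW ?dsq_gt0.
apply: (le_trans (y := sumZ L (fun j => 5 * N%:R * q j))); last first.
  apply: sumZ_le => j _; rewrite /q; case: (boolP (`|j| <= N%:Z)) => jN /=.
    have ch : 2^-1 <= chi L j :> R by apply: chi_ge; lia.
    have : 0 <= dsq j * v j ^+ 2 by rewrite mulr_ge0 ?sqr_ge0 // ltW // dsq_gt0.
    have : 0 <= N%:R :> R by [].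
    rewrite mul1r; set a := N%:R; set b := dsq j * _; rewrite -(mulrA (chi L j)) -/b.
    by move=> a0 b0; have := mulr_ge0 a0 b0; nra.
  rewrite mul0r mulr0; apply: mulr_ge0; first exact: mulr_ge0.
  by rewrite mulr_ge0 ?sqr_ge0 ?mulr_ge0 ?chi_ge0 // ltW ?dsq_gt0.
apply: (@sumZ_le_tele _ L (fun j => 5 / 2 * N%:R * q j)).
- by rewrite /q (_ : (_ <= _) = false) ?mul0r ?mulr0 //; lia.
- by rewrite /q (_ : (_ <= _) = false) ?mul0r ?mulr0 //; lia.
move=> j _; suff : wt N j * (dsq j + dsq (j + 1)) * (v j * v (j + 1)) <=
   5 / 2 * N%:R * (q j + q (j + 1)) by lra.
have n0 : 0 <= N%:R :> R by [].
case: (boolP ((- N%:Z <= j) && (j < N%:Z))) => [jN|/(@wt_out R) ->]; last first.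
  by rewrite !mul0r mulr_ge0 ?addr_ge0 // mulr_ge0.
have -> : q j = dsq j * v j ^+ 2 by rewrite /q (_ : `|j| <= _) ?mul1r //; lia.
have -> : q (j + 1) = dsq (j + 1) * v (j + 1) ^+ 2.
  by rewrite /q (_ : `|j + 1| <= _) ?mul1r //; lia.
rewrite -[leLHS]mulrA [leRHS]mulrAC [leRHS]mulrC.
apply: (le_trans (ler_norm _)); rewrite normrM.
apply: ler_pM; rewrite // ?wt_bound //.
have e1 := dsq_succ_le j m1; have e2 := dsq_le_succ j m1.
have f1 := dsq_gt0 j m1; have f2 := dsq_gt0 (j + 1) m1.
rewrite normrM gtr0_norm; last lra.
set a := v j; set b := v (j + 1).
have := young a b; have := sqr_ge0 a; have := sqr_ge0 b.
set A := a ^+ 2; set B := b ^+ 2; set C := `|a * b| => B0 A0 AB.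
set D := dsq j in e1 e2 f1 *; set E := dsq (j + 1) in e1 e2 f2 *.
have : (D + E) * C <= (D + E) * (2^-1 * (A + B)) by rewrite ler_wpM2l // addr_ge0 ?ltW.
have : 0 <= (4 * D - E) * A by rewrite mulr_ge0 // subr_ge0.
have : 0 <= (4 * E - D) * B by rewrite mulr_ge0 // subr_ge0.
by move=> *; lra.
Qed.

End Virial.

(** * Dissipation of the Lyapunov functional *)

Section Lyapunov.
Context {R : realType} (m : R) (m1 : 1 <= m).
Local Notation lam := (lam m).
Local Notation dsq := (dsq m).
Local Notation wt := (@wt R).

Definition mode_rhs (nu mu : R) (c : int -> R) (j : int) : R :=
  - (nu * dsq j * c j) +
  mu * (lam (j + 1) * c (j + 1) - lam (j - 1) * c (j - 1)).

Definition energy (L : nat) (c : int -> R) : R :=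
  sumZ L (fun j => chi L j * (lam j * c j ^+ 2)).

Definition lyap (L N : nat) (kappa : R) (c : int -> R) : R :=
  sumZ L (fun j => chi L j * (lam j * c j ^+ 2)
     - kappa * (wt N j * (lam j * c j * (lam (j + 1) * c (j + 1))))).

Definition dlyap (L N : nat) (kappa : R) (c c' : int -> R) : R :=
  sumZ L (fun j => chi L j * (lam j * (2 * c j * c' j))
     - kappa * (wt N j * (lam j * c' j * (lam (j + 1) * c (j + 1)) +
                          lam j * c j * (lam (j + 1) * c' (j + 1))))).

Lemma lam_sqr_le (x : R) j : (lam j * x) ^+ 2 <= lam j * x ^+ 2.
Proof.
have := lam_ge0 j m1; have := lam_le1 j m1; set l := lam j => l1 l0.
by rewrite exprMn expr2 -mulrA ler_piMl // mulr_ge0 // sqr_ge0.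
Qed.

Lemma lyap_split L N kappa nu mu c :
  dlyap L N kappa c (mode_rhs nu mu c) =
  sumZ L (fun j => - (2 * nu) * (chi L j * dsq j * (lam j * c j ^+ 2)))
  + sumZ L (fun j => 2 * mu * (chi L j * (lam j * c j *
       (lam (j + 1) * c (j + 1) - lam (j - 1) * c (j - 1)))))
  + kappa * nu * sumZ L (fun j => wt N j * (dsq j + dsq (j + 1)) *
       (lam j * c j * (lam (j + 1) * c (j + 1))))
  - kappa * mu * sumZ L (fun j => wt N j *
       (lam j * (lam (j + 1) * c (j + 1) - lam (j - 1) * c (j - 1)) *
          (lam (j + 1) * c (j + 1)) +
        lam j * c j * (lam (j + 1) *
          (lam (j + 2) * c (j + 2) - lam j * c j)))).
Proof.
rewrite -[- (kappa * mu * _)]mulNr -!sumZZ -!sumZD /dlyap /sumZ; apply: eq_bigr => i _.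
rewrite /mode_rhs.
by set j : int := _ - _; rewrite -(addrA j 1 1) (addrK 1 j); ring.
Qed.

(** The rate K is arbitrary: sites |j| > J dissipate at the rate d_j >= K
    already, and for 1 <= |j| <= J the virial term does so when kappa mu is large
    compared with nu K. At j = 0 one uses
    v_0^2 <= 2 (v_0 + v_2)^2 + 2 v_2^2. The errors of the virial functional take
    at most half of the viscous dissipation in all. *)
Lemma lyap_dissipation (lmin K kappa nu mu : R) (J N L : nat) (c : int -> R) :
  0 < lmin -> (forall j, lam j = 0 \/ lmin <= lam j) ->
  0 <= K -> K <= J.+1%:R ^+ 2 -> (1 < J)%N ->
  (J.+2 <= N)%N -> (1 < N)%N -> (2 * N.+1 <= L)%N ->
  0 <= nu -> 0 <= mu -> 0 <= kappa ->
  kappa * mu * (32 / N%:R) <= nu / 2 -> 20 * kappa * N%:R <= 1 ->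
  8 * nu * K / lmin <= kappa * mu * (4 / (m ^+ 2 + J.+1%:R ^+ 2) ^+ 2) ->
  dlyap L N kappa c (mode_rhs nu mu c) <=
  - (nu * K) * energy L c + mu / L%:R *
     sumZ L (fun j => (lam j * c j) ^+ 2 + (lam (j + 1) * c (j + 1)) ^+ 2).
Proof.
move=> lmin0 lamP K0 KJ J0 JN N1 NL nu0 mu0 ka0 h1 h2 h3.
have [L0 [NL1 NL2]] : (0 < L)%N /\ (N < L)%N /\ (N.+1 < L)%N by clear -NL; lia.
rewrite lyap_split.
set v := fun j => lam j * c j.
have A1 := energy_flux m c L0 mu0.
have A2 : kappa * nu * sumZ L (fun j => wt N j * (dsq j + dsq (j + 1)) *
     (v j * v (j + 1))) <=
   kappa * nu * sumZ L (fun j => 10 * N%:R * (chi L j * dsq j * v j ^+ 2)).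
  by rewrite ler_wpM2l ?mulr_ge0 // viscous_term.
have A3 : kappa * mu * sumZ L (fun j =>
     ((1 <= `|j|) && (`|j| <= J%:Z))%:R *
        (4 / (m ^+ 2 + J.+1%:R ^+ 2) ^+ 2) * v j ^+ 2
     - 32 / N%:R * (chi L j * dsq j * v j ^+ 2)
     + (j == 1)%:R * (2^-1 * lam 1 * (v 0 + v 2) ^+ 2)) <=
   kappa * mu * sumZ L (fun j => wt N j *
     (lam j * (v (j + 1) - v (j - 1)) * v (j + 1) +
      v j * (lam (j + 1) * (v (j + 2) - v j)))).
  rewrite ler_wpM2l ?mulr_ge0 //.
  rewrite virial_identity //.
  apply: (le_trans _ (virial_lower c m1 NL2 N1)).
  by apply: sumZ_le => j _; rewrite lerD2r virial_coercive_term.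
suff A4 : sumZ L (fun j => - (2 * nu) * (chi L j * dsq j * (lam j * c j ^+ 2)))
  + kappa * nu * sumZ L (fun j => 10 * N%:R * (chi L j * dsq j * v j ^+ 2))
  - kappa * mu * sumZ L (fun j =>
     ((1 <= `|j|) && (`|j| <= J%:Z))%:R *
        (4 / (m ^+ 2 + J.+1%:R ^+ 2) ^+ 2) * v j ^+ 2
     - 32 / N%:R * (chi L j * dsq j * v j ^+ 2)
     + (j == 1)%:R * (2^-1 * lam 1 * (v 0 + v 2) ^+ 2))
  <= - (nu * K) * energy L c.
  by move: A1 A2 A3 A4; rewrite /v; lra.
rewrite -[- (kappa * mu * _)]mulNr /energy -!sumZZ -!sumZD.
set eps := 4 / _ in h3 *.
have eps1 : eps <= 1.
  rewrite /eps ler_pdivrMr; last first.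
    by rewrite exprn_gt0 // ltr_pwDr ?sqr_ge0 // exprn_gt0.
  have J2 : 2 <= J.+1%:R :> R by rewrite ler_nat ltnW.
  have : 2 <= m ^+ 2 + J.+1%:R ^+ 2 by nra.
  by set a := _ + _; nra.
have lamc j : lam j * c j ^+ 2 <= v j ^+ 2 / lmin.
  rewrite ler_pdivlMr // /v; case: (lamP j) => [->|ll].
    by rewrite !mul0r expr0n.
  have l0 := lam_ge0 j m1.
  have : 0 <= (lam j - lmin) * (lam j * c j ^+ 2).
    by rewrite mulr_ge0 ?subr_ge0 // mulr_ge0 // sqr_ge0.
  lra.
have step j : - (2 * nu) * (chi L j * dsq j * (lam j * c j ^+ 2)) +
    kappa * nu * (10 * N%:R * (chi L j * dsq j * v j ^+ 2)) +
    kappa * mu * (32 / N%:R * (chi L j * dsq j * v j ^+ 2)) <=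
    - (nu * (chi L j * dsq j * (lam j * c j ^+ 2))).
  have X0 : 0 <= chi L j * dsq j by rewrite mulr_ge0 ?chi_ge0 ?dsq_ge0.
  have := ler_wpM2l X0 (lam_sqr_le (c j) j); rewrite -/(v j).
  have := mulr_ge0 X0 (sqr_ge0 (v j)).
  set x := chi L j * dsq j * (v j ^+ 2).
  set y := chi L j * dsq j * (lam j * c j ^+ 2) => x0 xy.
  have : nu * x <= nu * y by rewrite ler_wpM2l.
  have : 0 <= (nu * x) * (1 - 20 * kappa * N%:R).
    by apply: mulr_ge0; [exact: mulr_ge0|rewrite subr_ge0].
  have : 0 <= x * (nu / 2 - kappa * mu * (32 / N%:R)).
    by rewrite mulr_ge0 ?subr_ge0.
  by move=> *; lra.
(* Z is the square at j = 1 and P the surplus at j = 2: the telescoping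
   function below carries both to j = 0, where they pay for v_0. *)
pose Z := kappa * mu * (2^-1 * lam 1 * (v 0 + v 2) ^+ 2).
pose P := 2 * nu * K * (v 2 ^+ 2 / lmin).
have l1 := lam1_ge m1.
have P0 : 0 <= P.
  by apply: mulr_ge0; [rewrite !mulr_ge0|rewrite divr_ge0 ?sqr_ge0 // ltW].
apply: (@sumZ_le_tele _ L (fun j => (j == 1)%:R * (Z + P) + (j == 2)%:R * P)).
- have -> : (L%:Z + 1 == 1) = false by clear -L0; lia.
  have -> : (L%:Z + 1 == 2) = false by clear -NL2; lia.
  by rewrite /= !mul0r addr0.
- have -> : (- L%:Z == 1) = false by clear; lia.
  have -> : (- L%:Z == 2) = false by clear; lia.
  by rewrite /= !mul0r addr0.
move=> j _.
have kmu0 : 0 <= kappa * mu by rewrite mulr_ge0.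
have nuK0 : 0 <= nu * K by rewrite mulr_ge0.
have c1 := @chi_le1 R L j; have c0 := @chi_ge0 R L j.
have lc0 : 0 <= lam j * c j ^+ 2 by rewrite mulr_ge0 ?sqr_ge0 ?lam_ge0.
have main : (j == 0) ||
    (nu * K * (chi L j * (lam j * c j ^+ 2)) + (j == 2)%:R * P <=
     nu * (chi L j * dsq j * (lam j * c j ^+ 2)) +
     kappa * mu * (((1 <= `|j|) && (`|j| <= J%:Z))%:R * eps * v j ^+ 2)).
  have [->//|j0] := eqVneq j 0.
  rewrite /=; have [jJ|jJ] := lerP `|j| J%:Z; last first.
    have -> : (j == 2) = false by clear -jJ J0; lia.
    rewrite andbF /= !mul0r mulr0 !addr0 -mulrA ler_wpM2l //.
    rewrite mulrCA -(mulrA (chi L j)) ler_wpM2l // ler_wpM2r //.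
    apply: (le_trans KJ); apply: le_trans (dsq_ge_sqr j m1).
    rewrite -[J.+1%:R]/(J.+1%:Z%:~R) !expr2 -!intrM ler_int; clear -jJ.
    have [h|h] : J.+1%:Z <= j \/ j <= - J.+1%:Z by lia.
      by nia.
    by nia.
  have -> : (1 <= `|j|) by clear -j0; lia.
  rewrite /= mul1r; apply: ler_wpDl.
    by do ![apply: mulr_ge0 => //]; rewrite dsq_ge0.
  have q0 : 0 <= v j ^+ 2 / lmin by rewrite divr_ge0 ?sqr_ge0 // ltW.
  have B1 : nu * K * (chi L j * (lam j * c j ^+ 2)) <= nu * K * (v j ^+ 2 / lmin).
    rewrite ler_wpM2l //; apply: le_trans (lamc j).
    by rewrite ler_piMl.
  have B2 : (j == 2)%:R * P <= 2 * (nu * K * (v j ^+ 2 / lmin)).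
    case: eqP => [->|_] /=; first by rewrite /P mul1r; lra.
    by rewrite mul0r; apply: mulr_ge0 => //; apply: mulr_ge0.
  have B3 := ler_wpM2r (sqr_ge0 (v j)) h3.
  have B4 : 8 * nu * K / lmin * v j ^+ 2 = 8 * (nu * K * (v j ^+ 2 / lmin)) by ring.
  have B5 := mulr_ge0 nuK0 q0.
  by lra.
have := step j; move: main.
have [->|j0] := eqVneq j 0.
  move=> _ /= st0.
  rewrite ?mulr0n ?mulr1n !mul0r !mul1r !addr0 add0r ?subr0 ?oppr0 ?addr0.
  have Y0 : nu * K * (chi L 0 * (lam 0 * c 0 ^+ 2)) <= Z + P.
    apply: (le_trans (y := nu * K * (v 0 ^+ 2 / lmin))).
      rewrite ler_wpM2l //; apply: le_trans (lamc 0).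
      by rewrite ler_piMl ?chi_le1 // mulr_ge0 ?sqr_ge0 ?lam_ge0.
    have C1 : v 0 ^+ 2 <= 2 * (v 0 + v 2) ^+ 2 + 2 * v 2 ^+ 2.
      by have := sqr_ge0 (v 0 + 2 * v 2); nra.
    have C2 : nu * K * (v 0 ^+ 2 / lmin) <=
      2 * (nu * K / lmin) * (v 0 + v 2) ^+ 2 + P.
      have i0 : 0 <= nu * K / lmin by rewrite divr_ge0 // ltW.
      by have := ler_wpM2l i0 C1; rewrite /P; lra.
    apply: (le_trans C2); rewrite lerD2r /Z [leRHS]mulrA; apply: ler_wpM2r; first exact: sqr_ge0.
    have : kappa * mu * eps <= kappa * mu by rewrite ler_piMr.
    have : 0 <= kappa * mu * (lam 1 - 2^-1) by rewrite mulr_ge0 ?subr_ge0.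
    by lra.
  have N0 : 0 <= nu * (chi L 0 * dsq 0 * (lam 0 * c 0 ^+ 2)).
    apply: mulr_ge0 => //; apply: mulr_ge0; first by rewrite mulr_ge0 ?chi_ge0 ?dsq_ge0.
    by rewrite mulr_ge0 ?lam_ge0 ?sqr_ge0.
  by move: st0 Y0 N0; rewrite /v; lra.
rewrite /= => main st.
have -> : (j + 1 == 1) = false by clear -j0; lia.
have -> : (j + 1 == 2) = (j == 1) by clear; lia.
rewrite mul0r add0r.
by case: (j == 1) main st; rewrite /Z /v /=; lra.
Qed.

End Lyapunov.

(** * Gronwall estimate *)

Section Gronwall.
Context {R : realType}.

(** The function e^(a t) f t - b t e^(a T) is nonincreasing. *)
Lemma gronwall (f df : R -> R) (a b T : R) : 0 < T -> 0 <= a -> 0 <= b ->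
  {within `[0, T], continuous f} ->
  (forall t, 0 < t < T -> is_derive t (1 : R) f (df t)) ->
  (forall t, 0 < t < T -> df t <= - a * f t + b) ->
  f T <= expR (- (a * T)) * f 0 + b * T.
Proof.
move=> T0 a0 b0 cf dfE dfle.
pose E : R -> R := expR \o ( *%R a).
pose g : R -> R := E * f - (b * expR (a * T)) \*: id.
have dE t : is_derive t (1 : R) E (a * E t).
  have h : is_derive t (1 : R) ( *%R a) a.
    have := is_deriveZ a (is_derive_id t (1 : R)).
    by rewrite /GRing.scale /= mulr1.
  by rewrite /E mulrC; apply: is_derive1_comp.
have dg t : t \in `]0, T[ ->
    is_derive t (1 : R) g (E t * df t + f t * (a * E t) - b * expR (a * T)).
  rewrite in_itv /= => tT; have d1 := dfE t tT; have d2 := dE t.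
  have := is_deriveB (is_deriveM d2 d1)
    (is_deriveZ (b * expR (a * T)) (is_derive_id t (1 : R))).
  by rewrite -/g /GRing.scale /= mulr1.
have cg : {within `[0, T], continuous g}.
  have cE : {within `[0, T], continuous E}.
    by apply: derivable_within_continuous => x _; exact: ex_derive.
  have cI : {within `[0, T], continuous ((b * expR (a * T)) \*: (id : R -> R))}.
    by apply: derivable_within_continuous => x _; exact: ex_derive.
  by move=> x; exact: cvgB (cvgM (cE x) (cf x)) (cI x).
have [t tT gE] := MVT T0 dg cg.
move: (tT); rewrite in_itv /= => tT'.
have Et : 0 <= E t by rewrite expR_ge0.
have E1 : 1 <= E t.
  by rewrite /E /=; apply: le_trans (expR_ge1Dx _); rewrite lerDl mulr_ge0 // ltW //; case/andP: tT'.
have E2 : E t <= expR (a * T).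
  by rewrite /E /= ler_expR ler_wpM2l // ltW //; case/andP: tT'.
have : g T - g 0 <= 0.
  rewrite gE; apply: mulr_le0_ge0; last by rewrite subr0 ltW.
  have := ler_wpM2l Et (dfle t tT').
  have : 0 <= b * (expR (a * T) - E t) by rewrite mulr_ge0 // subr_ge0.
  lra.
have -> : g T = expR (a * T) * f T - b * expR (a * T) * T by [].
have -> : g 0 = expR (a * 0) * f 0 - b * expR (a * T) * 0 by [].
rewrite mulr0 expR0 mul1r mulr0 subr0 => h.
rewrite expRN; set e := expR (a * T) in h *.
have e0 : 0 < e by rewrite expR_gt0.
have -> : f T = e^-1 * (e * f T) by rewrite mulrA mulVf ?mul1r ?gt_eqF.
have -> : e^-1 * f 0 + b * T = e^-1 * (f 0 + b * e * T).
  by field; rewrite gt_eqF.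
by rewrite ler_wpM2l ?invr_ge0 ?(ltW e0) //; lra.
Qed.

Lemma is_derive_sumZ L (f : int -> R -> R) (df : int -> R) t :
  (forall j, is_derive t (1 : R) (f j) (df j)) ->
  is_derive t (1 : R) (fun s => sumZ L (fun j => f j s)) (sumZ L df).
Proof.
move=> fd.
have -> : (fun s => sumZ L (fun j => f j s)) =
    \sum_(i < L.*2.+1) f (i%:Z - L%:Z).
  by apply/funext => s; rewrite fct_sumE.
exact: is_derive_sum.
Qed.

Lemma continuous_sumZ L (f : int -> R -> R) (A : set R) :
  (forall j, {within A, continuous (f j)}) ->
  {within A, continuous (fun s => sumZ L (fun j => f j s))}.
Proof.
move=> cf x; apply: cvg_big => [|i _]; last exact: cf.
exact: add_continuous.
Qed.

End Gronwall.

(** * Decay of one x-frequency *)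

Section ModeDecay.
Context {R : realType}.
Local Notation wt := (@wt R).

Lemma expRN_le_inv (x : R) : 0 < x -> expR (- x) <= x^-1.
Proof.
move=> x0; rewrite expRN lef_pV2 ?posrE ?expR_gt0 //.
by apply: le_trans (expR_ge1Dx x); rewrite lerDr.
Qed.

Lemma energy_ge0 m L c : 1 <= m -> 0 <= @energy R m L c.
Proof.
move=> m1; apply: sumZ_ge0 => j.
by rewrite mulr_ge0 ?chi_ge0 // mulr_ge0 ?lam_ge0 ?sqr_ge0.
Qed.

Lemma energy_le m L c : 1 <= m ->
  @energy R m L c <= sumZ L (fun j => lam m j * c j ^+ 2).
Proof.
move=> m1; apply: sumZ_le => j _.
by rewrite ler_piMl ?chi_le1 // mulr_ge0 ?lam_ge0 ?sqr_ge0.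
Qed.

Lemma energy_ge m n L c : 1 <= m -> (0 < L)%N -> (2 * n <= L)%N ->
  sumZ n (fun j => lam m j * c j ^+ 2) <= 2 * @energy R m L c.
Proof.
move=> m1 L0 nL; rewrite /energy -sumZZ.
have t0 (j : int) : 0 <= 2 * (chi L j * (lam m j * c j ^+ 2)) :> R.
  apply: mulr_ge0 => //.
  by rewrite mulr_ge0 ?chi_ge0 // mulr_ge0 ?lam_ge0 ?sqr_ge0.
apply: le_trans (sumZ_mono t0 (_ : (n <= L)%N)); last by clear -nL; lia.
apply: sumZ_le => j jn.
have ch : 2^-1 <= chi L j :> R by apply: chi_ge => //; clear -jn nL; lia.
have : 0 <= lam m j * c j ^+ 2 by rewrite mulr_ge0 ?lam_ge0 ?sqr_ge0.
by set x := lam m j * _; nra.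
Qed.

(** The virial functional is bounded by the energy, as its weight is at most N
    and supported where chi >= 1/2. *)
Lemma cross_bound m N L c : 1 <= m -> (2 * N.+1 <= L)%N ->
  `|sumZ L (fun j => wt N j * (lam m j * c j * (lam m (j + 1) * c (j + 1))))|
    <= 2 * N%:R * energy m L c.
Proof.
move=> m1 NL.
apply: le_trans (ler_norm_sum _ _ _) _.
pose q j : R := ((`|j| <= N%:Z)%R : bool)%:R * (lam m j * c j) ^+ 2.
have q0 j : 0 <= q j by apply: mulr_ge0 => //; exact: sqr_ge0.
apply: (le_trans (y := sumZ L (fun j => N%:R * q j))); last first.
  rewrite /energy -sumZZ; apply: sumZ_le => j _; rewrite /q -mulrA [leRHS]mulrCA.
  apply: ler_wpM2l => //.
  have lc0 : 0 <= lam m j * c j ^+ 2 by rewrite mulr_ge0 ?lam_ge0 ?sqr_ge0.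
  case: (boolP (`|j| <= N%:Z)) => jN /=.
    have ch : 2^-1 <= chi L j :> R.
      by apply: chi_ge; clear -jN NL; lia.
    have := lam_sqr_le m1 (c j) j; rewrite mul1r.
    by set x := (_ * _) ^+ 2; set y := lam m j * _ in lc0 *; nra.
  by rewrite mul0r mulr_ge0 // mulr_ge0 ?chi_ge0.
apply: (@sumZ_le_tele _ L (fun j => 2^-1 * N%:R * q j)
   (fun j => `|wt N j * (lam m j * c j * (lam m (j + 1) * c (j + 1)))|)).
- rewrite /q (_ : (_ <= _) = false) ?mul0r ?mulr0 //.
  by clear -NL; lia.
- rewrite /q (_ : (_ <= _) = false) ?mul0r ?mulr0 //.
  by clear -NL; lia.
move=> j _.
suff : `|wt N j * (lam m j * c j * (lam m (j + 1) * c (j + 1)))| <=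
   N%:R * (2^-1 * (q j + q (j + 1))) by lra.
case: (boolP ((- N%:Z <= j) && (j < N%:Z))) => [jN|/(@wt_out R) ->]; last first.
  by rewrite mul0r normr0 mulr_ge0 // mulr_ge0 // addr_ge0.
rewrite normrM; apply: ler_pM => //; first exact: wt_bound.
have -> : q j = (lam m j * c j) ^+ 2.
  by rewrite /q (_ : `|j| <= _) ?mul1r //; clear -jN; lia.
have -> : q (j + 1) = (lam m (j + 1) * c (j + 1)) ^+ 2.
  by rewrite /q (_ : `|j + 1| <= _) ?mul1r //; clear -jN; lia.
exact: young.
Qed.

Lemma is_derive_lyap m L N kappa (c : R -> int -> R) (c' : int -> R) t :
  (forall j, is_derive t (1 : R) (fun s => c s j) (c' j)) ->
  is_derive t (1 : R) (fun s => lyap m L N kappa (c s))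
    (dlyap m L N kappa (c t) c').
Proof.
move=> dc; apply: is_derive_sumZ => j.
pose u : R -> R := fun s => c s j; pose w : R -> R := fun s => c s (j + 1).
have du : is_derive t (1 : R) u (c' j) := dc j.
have dw : is_derive t (1 : R) w (c' (j + 1)) := dc (j + 1).
have -> : (fun s => chi L j * (lam m j * c s j ^+ 2) - kappa *
     (wt N j * (lam m j * c s j * (lam m (j + 1) * c s (j + 1))))) =
    (chi L j * lam m j) \*: (u * u) -
      (kappa * (wt N j * (lam m j * lam m (j + 1)))) \*: (u * w).
  by apply/funext => s; rewrite !fctE /= /u /w /GRing.scale /=; ring.
by apply: is_derive_eq; rewrite /u /w /GRing.scale /=; ring.
Qed.

Lemma continuous_lyap m L N kappa (c : R -> int -> R) (A : set R) :
  (forall j, {within A, continuous (fun s => c s j)}) ->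
  {within A, continuous (fun s => lyap m L N kappa (c s))}.
Proof.
move=> cc; apply: continuous_sumZ => j x.
have h1 := cc j x; have h2 := cc (j + 1) x.
apply: cvgB.
  apply: cvgM; first exact: cvg_cst.
  by apply: cvgM; [exact: cvg_cst|rewrite expr2; exact: (cvgM h1 h1)].
apply: cvgM; first exact: cvg_cst.
apply: cvgM; first exact: cvg_cst.
by apply: cvgM; apply: cvgM => //; exact: cvg_cst.
Qed.

(** The uniform bound on the sums of squares is what makes the flux through
    chi vanish as L tends to infinity. *)
Definition mode_solution (m nu T B : R) (c : R -> int -> R) : Prop :=
  [/\ forall j, {within `[0, T], continuous (fun s => c s j)},
      forall t j, 0 < t < T -> is_derive t (1 : R) (fun s => c s j)
        (mode_rhs m nu (expR (- (nu * t)) * (m / 2)) (c t) j) &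
      forall t L, 0 <= t <= T -> sumZ L (fun j => c t j ^+ 2) <= B].

Lemma flux_bound m mu B L (c : int -> R) : 1 <= m -> 0 <= mu -> mu <= m ->
  (forall L, sumZ L (fun j => c j ^+ 2) <= B) -> (0 < L)%N ->
  mu / L%:R * sumZ L (fun j => (lam m j * c j) ^+ 2 +
     (lam m (j + 1) * c (j + 1)) ^+ 2) <= 2 * m * B / L%:R.
Proof.
move=> m1 mu0 mum cB L0.
have i0 : 0 <= L%:R^-1 :> R by rewrite invr_ge0.
have vc j : (lam m j * c j) ^+ 2 <= c j ^+ 2.
  apply: (le_trans (lam_sqr_le m1 _ _)).
  by rewrite ler_piMl ?lam_le1 ?sqr_ge0.
have S0 (a : int -> R) : 0 <= sumZ L (fun j => a j ^+ 2).
  by apply: sumZ_ge0 => j; exact: sqr_ge0.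
have : sumZ L (fun j => (lam m j * c j) ^+ 2 +
     (lam m (j + 1) * c (j + 1)) ^+ 2) <= 2 * B.
  rewrite sumZD mulrDl mul1r; apply: lerD.
    by apply: le_trans (cB L); apply: sumZ_le => j _.
  apply: le_trans (cB L.+1).
  apply: le_trans (sumZ_shift L (a := fun j => c j ^+ 2) _); last first.
    by move=> j; exact: sqr_ge0.
  by apply: sumZ_le => j _.
set S := sumZ _ _ => SB.
have S1 : 0 <= S by apply: sumZ_ge0 => j; rewrite addr_ge0 ?sqr_ge0.
rewrite mulrAC ler_wpM2r // (le_trans (y := m * S)) ?ler_wpM2r //.
rewrite (mulrC 2) -mulrA ler_wpM2l //.
exact: le_trans m1.
Qed.

Lemma ex_natge (x : R) : exists n : nat, x <= n%:R.
Proof.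
exists (Num.bound `|x|); apply: (le_trans (ler_norm x)).
by apply: ltW; apply: archi_boundP.
Qed.

Lemma flux_small (m B T eps : R) : 1 <= m -> 0 <= B -> 0 < T -> 0 < eps ->
  exists L0, forall L, (L0 <= L)%N -> 2 * m * B / L%:R * T <= eps.
Proof.
move=> m1 B0 T0 eps0; have [L1 hL] := ex_natge (2 * m * B * T / eps).
exists L1.+1 => L LL.
have L0 : 0 < L%:R :> R by rewrite ltr0n (leq_trans _ LL).
rewrite mulrAC ler_pdivrMr // -ler_pdivrMl // mulrC.
by apply: (le_trans hL); rewrite ler_nat (leq_trans _ LL).
Qed.

Lemma mode_rate_bounds (m nu tau t : R) : 1 <= m -> 0 < nu ->
  0 < t < tau / nu ->
  expR (- tau) * (m / 2) <= expR (- (nu * t)) * (m / 2) <= m / 2.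
Proof.
move=> m1 nu0 /andP[t0 tT].
have m0 : 0 <= m / 2 by rewrite divr_ge0 // (le_trans _ m1).
have nt : nu * t <= tau by rewrite mulrC -ler_pdivlMr // ltW.
apply/andP; split.
  by rewrite ler_wpM2r // ler_expR lerN2.
by rewrite ler_piMl // -[leRHS]expR0 ler_expR oppr_le0 mulr_ge0 // ltW.
Qed.

(** Here viscosity suffices: d_j >= m^2 for all j, and m^2 tau is large. *)
Lemma mode_decay_large (m nu tau delta B : R) (c : R -> int -> R) :
  1 <= m -> 0 < nu -> 0 < tau -> 0 < delta -> 1 <= m ^+ 2 * tau * delta ->
  mode_solution m nu (tau / nu) B c ->
  forall n eps, 0 < eps -> exists L0, forall L, (L0 <= L)%N ->
  sumZ n (fun j => lam m j * c (tau / nu) j ^+ 2) <=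
   delta * sumZ L (fun j => lam m j * c 0 j ^+ 2) + eps.
Proof.
move=> m1 nu0 tau0 de0 hm [cc dc cB] n eps eps0.
set T := tau / nu in cc dc cB *.
have T0 : 0 < T by rewrite divr_gt0.
have nT : nu * T = tau by rewrite /T mulrC divfK // gt_eqF.
have B0 : 0 <= B.
  apply: le_trans (cB 0 0%N _); last by rewrite lexx ltW.
  by apply: sumZ_ge0 => j; exact: sqr_ge0.
have eps2 : 0 < eps / 2 by rewrite divr_gt0.
have [L1 hL1] := flux_small m1 B0 T0 eps2.
exists (maxn 1 (maxn (2 * n) L1)) => L; rewrite !geq_max => /and3P[L0 nL LL].
have i0 : 0 <= 2 * m * B / L%:R.
  by rewrite divr_ge0 // mulr_ge0 // mulr_ge0 // (le_trans _ m1).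
have lyE (x : int -> R) : lyap m L 0 0 x = energy m L x.
  by apply: eq_bigr => i _; rewrite mul0r subr0.
have a0 : 0 <= 2 * nu * m ^+ 2.
  by apply: mulr_ge0; [rewrite mulr_ge0 // ltW|exact: sqr_ge0].
have dis t : 0 < t < T ->
    dlyap m L 0 0 (c t) (mode_rhs m nu (expR (- (nu * t)) * (m / 2)) (c t)) <=
    - (2 * nu * m ^+ 2) * lyap m L 0 0 (c t) + 2 * m * B / L%:R.
  move=> tT; rewrite lyE lyap_split !mul0r addr0 subr0.
  have /andP[_ mu1] := mode_rate_bounds m1 nu0 tT.
  have m2 : m / 2 <= m by lra.
  set mu := expR _ * _ in mu1 *.
  have mu0 : 0 <= mu.
    by rewrite /mu mulr_ge0 ?expR_ge0 // divr_ge0 // (le_trans _ m1).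
  apply: lerD.
    rewrite /energy -sumZZ; apply: sumZ_le => j _.
    have : 0 <= nu * (chi L j * (lam m j * c t j ^+ 2)) * (dsq m j - m ^+ 2).
      apply: mulr_ge0; last by rewrite /dsq addrAC subrr add0r sqr_ge0.
      rewrite mulr_ge0 // ?(ltW nu0) // mulr_ge0 ?chi_ge0 //.
      by rewrite mulr_ge0 ?lam_ge0 ?sqr_ge0.
    by lra.
  apply: (le_trans (energy_flux _ _ L0 mu0)).
  apply: flux_bound => //; first exact: le_trans mu1 m2.
  move=> L'; apply: cB.
  by case/andP: tT => t0 tT; rewrite !ltW.
have := gronwall T0 a0 i0 (@continuous_lyap m L 0%N 0 c _ cc)
  (fun t tT => @is_derive_lyap m L 0%N 0 c _ t (fun j => dc t j tT)) dis.
rewrite !lyE.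
have e1 : expR (- (2 * nu * m ^+ 2 * T)) <= delta / 2.
  have -> : 2 * nu * m ^+ 2 * T = 2 * m ^+ 2 * tau by rewrite -nT; ring.
  have p0 : 0 < m ^+ 2 * tau by rewrite mulr_gt0 // exprn_gt0 // (lt_le_trans _ m1).
  apply: (le_trans (expRN_le_inv _)); first by rewrite -mulrA mulr_gt0.
  by rewrite -[leLHS]mul1r ler_pdivrMr -?mulrA ?mulr_gt0 //; lra.
have := hL1 L LL; have := energy_ge (c T) m1 L0 nL.
have := energy_le L (c 0) m1; have E0 := energy_ge0 L (c 0) m1.
have := ler_wpM2r E0 e1.
set S := sumZ L _; set E := energy m L (c 0) in E0 *.
set e := expR _ => h1 h2 h3 h4 h5.
have : delta * E <= delta * S by rewrite ler_wpM2l // ltW.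
by lra.
Qed.

(** K is chosen so that 8 e^(- K tau / 2) <= delta, then the size J of the zone
    where the virial term must act, the ratio A = kappa / nu, the cutoff N of the
    weight, and at last nu0; L is sent to infinity with all of these fixed. *)
Lemma mode_decay (m lmin tau delta : R) :
  1 <= m -> 0 < lmin -> (forall j, lam m j = 0 \/ lmin <= lam m j) ->
  0 < tau -> 0 < delta ->
  exists2 nu0, 0 < nu0 & forall nu, 0 < nu < nu0 ->
  forall (c : R -> int -> R) B, mode_solution m nu (tau / nu) B c ->
  forall n eps, 0 < eps -> exists L0, forall L, (L0 <= L)%N ->
  sumZ n (fun j => lam m j * c (tau / nu) j ^+ 2) <=
   delta * sumZ L (fun j => lam m j * c 0 j ^+ 2) + eps.
Proof.
move=> m1 lmin0 lamP tau0 de0.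
have m0 : 0 < m by apply: lt_le_trans m1.
pose K := 16 / (delta * tau).
have K0 : 0 < K by rewrite divr_gt0 // mulr_gt0.
have [J' hJ'] := ex_natge K; pose J := J'.+2.
have KJ : K <= J.+1%:R ^+ 2.
  apply: (le_trans hJ'); rewrite -natrX ler_nat /J; clear; nia.
pose theta := 4 / (m ^+ 2 + J.+1%:R ^+ 2) ^+ 2.
have theta0 : 0 < theta.
  by rewrite divr_gt0 // exprn_gt0 // ltr_pwDl ?sqr_ge0 // exprn_gt0.
(* A = kappa / nu, for the weakest transport e^(-tau) m / 2 on [0, tau / nu]. *)
pose A := 8 * K / lmin / (expR (- tau) * (m / 2) * theta).
have d0 : 0 < expR (- tau) * (m / 2) * theta.
  by rewrite mulr_gt0 // mulr_gt0 ?expR_gt0 // divr_gt0.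
have A0 : 0 < A by rewrite divr_gt0 // divr_gt0 // mulr_gt0.
have [N' hN'] := ex_natge (32 * A * m); pose N := (N' + J.+2)%N.
have NA : 32 * A * m <= N%:R by apply: (le_trans hN'); rewrite ler_nat leq_addr.
have N0 : 0 < N%:R :> R by rewrite ltr0n /N addnS.
exists (20 * A * N%:R)^-1; first by rewrite invr_gt0 mulr_gt0 // mulr_gt0.
move=> nu /andP[nu0 nu1] c B [cc dc cB] n eps eps0.
set T := tau / nu in cc dc cB *.
have T0 : 0 < T by rewrite divr_gt0.
have nT : nu * T = tau by rewrite /T mulrC divfK // gt_eqF.
have B0 : 0 <= B.
  apply: le_trans (cB 0 0%N _); last by rewrite lexx ltW.
  by apply: sumZ_ge0 => j; exact: sqr_ge0.
have eps2 : 0 < eps / 4 by rewrite divr_gt0.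
have [L1 hL1] := flux_small m1 B0 T0 eps2.
exists (maxn (2 * N.+1) (maxn (2 * n) L1)) => L; rewrite !geq_max.
move=> /and3P[NL nL LL].
have L0 : (0 < L)%N by clear -NL; lia.
have i0 : 0 <= 2 * m * B / L%:R.
  by rewrite divr_ge0 // mulr_ge0 // mulr_ge0 // ltW.
pose kappa := nu * A.
have ka0 : 0 <= kappa by rewrite mulr_ge0 // ltW.
have kN : 20 * kappa * N%:R <= 1.
  move: nu1; rewrite -(ltr_pM2r (_ : 0 < 20 * A * N%:R)); last first.
    by rewrite mulr_gt0 // mulr_gt0.
  rewrite mulVf; last by rewrite gt_eqF // mulr_gt0 // mulr_gt0.
  by rewrite /kappa => h; apply: ltW; lra.
have lyE (x : int -> R) : energy m L x / 2 <= lyap m L N kappa x <= 2 * energy m L x.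
  have E0 := energy_ge0 L x m1.
  have := cross_bound x m1 NL; rewrite ler_norml.
  rewrite /lyap; set E := energy m L x in E0 *; set S := sumZ L _ => /andP[s1 s2].
  rewrite (_ : sumZ L _ = E - kappa * S); last first.
    by rewrite /E /energy -mulNr -sumZZ -sumZD; apply: eq_bigr => i _; rewrite mulNr.
  have k1 := ler_wpM2l ka0 s1; have k2 := ler_wpM2l ka0 s2.
  have k3 : 0 <= (1 - 20 * kappa * N%:R) * E by rewrite mulr_ge0 // subr_ge0.
  by apply/andP; split; lra.
have a0 : 0 <= nu * K / 2 by rewrite divr_ge0 // mulr_ge0 // ltW.
have dis t : 0 < t < T ->
    dlyap m L N kappa (c t) (mode_rhs m nu (expR (- (nu * t)) * (m / 2)) (c t)) <=
    - (nu * K / 2) * lyap m L N kappa (c t) + 2 * m * B / L%:R.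
  move=> tT.
  have /andP[mu1 mu2] := mode_rate_bounds m1 nu0 tT.
  set mu := expR (- (nu * t)) * _ in mu1 mu2 *.
  have mu0 : 0 <= mu.
    by rewrite /mu mulr_ge0 ?expR_ge0 // divr_ge0 // ltW.
  have tT' : 0 <= t <= T by case/andP: tT => t0 tT; rewrite !ltW.
  have m2 : m / 2 <= m by lra.
  have F := flux_bound m1 mu0 (le_trans mu2 m2) (fun L' => cB t L' tT') L0.
  have JN : (J.+2 <= N)%N by rewrite /N leq_addl.
  have N1 : (1 < N)%N by rewrite (leq_trans _ JN).
  have H1 : kappa * mu * (32 / N%:R) <= nu / 2.
    have h : A * mu <= A * (m / 2) by rewrite ler_wpM2l // ltW.
    have q : A * (m / 2) * (32 / N%:R) <= 1 / 2.
      by rewrite mulrA ler_pdivrMr //; lra.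
    have i32 : 0 <= 32 / N%:R :> R by rewrite divr_ge0 // ltW.
    have := ler_wpM2l (ltW nu0) (le_trans (ler_wpM2r i32 h) q).
    by rewrite /kappa; lra.
  have H2 : 8 * nu * K / lmin <= kappa * mu * theta.
    have -> : 8 * nu * K / lmin = kappa * (expR (- tau) * (m / 2)) * theta.
      by rewrite /kappa /A; field; rewrite !gt_eqF ?expR_gt0.
    by rewrite ler_wpM2r ?(ltW theta0) // ler_wpM2l.
  have D := lyap_dissipation m1 (c t) lmin0 lamP (ltW K0) KJ isT JN N1 NL
    (ltW nu0) mu0 ka0 H1 kN H2.
  have /andP[_ l2] := lyE (c t).
  have nK0 : 0 <= nu * K by rewrite mulr_ge0 // ltW.
  have := ler_wpM2l nK0 l2.
  by lra.
have := gronwall T0 a0 i0 (@continuous_lyap m L N kappa c _ cc)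
  (fun t tT => @is_derive_lyap m L N kappa c _ t (fun j => dc t j tT)) dis.
have e1 : expR (- (nu * K / 2 * T)) <= delta / 8.
  have -> : nu * K / 2 * T = 8 / delta.
    by rewrite /K -nT; field; rewrite !gt_eqF.
  apply: (le_trans (expRN_le_inv _)); first by rewrite divr_gt0.
  by rewrite invf_div.
have := hL1 L LL; have := energy_ge (c T) m1 L0 nL.
have := energy_le L (c 0) m1; have E0 := energy_ge0 L (c 0) m1.
have /andP[l1 _] := lyE (c T); have /andP[_ l2] := lyE (c 0).
have P0 := expR_ge0 (- (nu * K / 2 * T)).
have := ler_wpM2l P0 l2.
have := ler_wpM2r E0 e1.
set S := sumZ L _; set E := energy m L (c 0) in E0 l2 *.
set e := expR _ in e1 P0 * => h1 h2 h3 h4 h5 h6.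
have : delta * E <= delta * S by rewrite ler_wpM2l // ltW.
by lra.
Qed.

End ModeDecay.

(** * Square-integrable functions *)

Section SquareIntegrable.
Context d (T : measurableType d) (R : realType) (mu : {measure set T -> \bar R}).
Implicit Types f g h : T -> R.

(** On the torus dot, nrm and sqint are convertible to ip, L2norm and L2. *)
Definition dot f g : R := \int[mu]_z (f z * g z).
Definition nrm f : R := fine ('N[mu]_2%:E[EFin \o f]).
Definition sqint f : Prop := f \in Lfun mu 2%:E.

Lemma sqint_measurable f : sqint f -> measurable_fun setT f.
Proof. by move=> /sub_Lfun_mfun; rewrite inE. Qed.

Lemma sqint_integrable f g : sqint f -> sqint g ->
  mu.-integrable setT (EFin \o (fun z => f z * g z)).
Proof. by move=> f2 g2; apply/Lfun1_integrable/Lfun2_mul_Lfun1. Qed.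

Lemma sqintP f : measurable_fun setT f ->
  (\int[mu]_z (f z ^+ 2)%:E < +oo)%E -> sqint f.
Proof.
move=> mf fi; rewrite /sqint inE; apply/andP; split; first by rewrite inE.
rewrite inE /= /finite_norm unlock /=; apply: poweR_lty.
apply: le_lt_trans fi; apply: ge0_le_integral => //.
- apply/measurable_EFinP.
  apply/(@measurableT_comp _ _ _ _ _ _ (fun x : R => x `^ 2)) => //.
  exact/measurableT_comp.
- by apply/measurable_EFinP; exact: measurable_funX.
- by move=> x _; rewrite lee_fin powR_mulrn // real_normK ?num_real.
Qed.

Lemma sqintD f g : sqint f -> sqint g -> sqint (fun z => f z + g z).
Proof.
by move=> f2 g2; have [_ +] := Lfun_addr_closed mu (lee1n 2); apply.
Qed.

Lemma sqintN f : sqint f -> sqint (fun z => - f z).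
Proof. by move=> f2; apply: (@Lfun_oppr_closed _ _ _ mu 2%:E). Qed.

Lemma sqintB f g : sqint f -> sqint g -> sqint (fun z => f z - g z).
Proof. by move=> f2 g2; apply: sqintD => //; exact: sqintN. Qed.

Lemma sqintZ (a : R) f : sqint f -> sqint (fun z => a * f z).
Proof.
move=> f2; have := @Lfun_scale _ _ _ mu f a 2 (ler1n _ 2) f2.
by rewrite /sqint (_ : (a \o* f) = (fun z => a * f z)) //; apply/funext => z /=; rewrite mulrC.
Qed.

Lemma sqint0 : sqint (fun=> 0).
Proof. by have [+ _] := Lfun_addr_closed mu (lee1n 2). Qed.

Lemma sqint_sum (I : Type) (r : seq I) (F : I -> T -> R) :
  (forall i, sqint (F i)) -> sqint (fun z => \sum_(i <- r) F i z).
Proof.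
move=> F2; elim: r => [|i r IH].
  by rewrite (_ : (fun z => _) = fun=> 0); [exact: sqint0|apply/funext => z; rewrite big_nil].
rewrite (_ : (fun z => _) = fun z => F i z + \sum_(i <- r) F i z).
  exact: sqintD.
by apply/funext => z; rewrite big_cons.
Qed.

Lemma dotC f g : dot f g = dot g f.
Proof. by apply: eq_Rintegral => z _; rewrite mulrC. Qed.

Lemma dotDl f g h : sqint f -> sqint g -> sqint h ->
  dot (fun z => f z + g z) h = dot f h + dot g h.
Proof.
move=> f2 g2 h2; rewrite /dot -RintegralD //; try exact: sqint_integrable.
by apply: eq_Rintegral => z _; rewrite mulrDl.
Qed.

Lemma dotZl (a : R) f h : sqint f -> sqint h ->
  dot (fun z => a * f z) h = a * dot f h.
Proof.
move=> f2 h2; rewrite /dot -RintegralZl //; last exact: sqint_integrable.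
by apply: eq_Rintegral => z _; rewrite mulrA.
Qed.

Lemma dotNl f h : sqint f -> sqint h -> dot (fun z => - f z) h = - dot f h.
Proof.
move=> f2 h2; rewrite -[RHS]mulN1r -dotZl //; congr dot.
by apply/funext => z; rewrite mulN1r.
Qed.

Lemma dotBl f g h : sqint f -> sqint g -> sqint h ->
  dot (fun z => f z - g z) h = dot f h - dot g h.
Proof. by move=> f2 g2 h2; rewrite dotDl ?dotNl //; exact: sqintN. Qed.

Lemma dotDr f g h : sqint f -> sqint g -> sqint h ->
  dot h (fun z => f z + g z) = dot h f + dot h g.
Proof. by move=> f2 g2 h2; rewrite !(dotC h) dotDl. Qed.

Lemma dotZr (a : R) f h : sqint f -> sqint h ->
  dot h (fun z => a * f z) = a * dot h f.
Proof. by move=> f2 h2; rewrite !(dotC h) dotZl. Qed.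

Lemma dotBr f g h : sqint f -> sqint g -> sqint h ->
  dot h (fun z => f z - g z) = dot h f - dot h g.
Proof. by move=> f2 g2 h2; rewrite !(dotC h) dotBl. Qed.

Lemma dot0l h : dot (fun=> 0) h = 0.
Proof.
rewrite /dot (_ : (fun z => _) = fun=> 0); last by apply/funext => z; rewrite mul0r.
by rewrite Rintegral_cst // mul0r.
Qed.

Lemma dot_suml (I : Type) (r : seq I) (F : I -> T -> R) h :
  (forall i, sqint (F i)) -> sqint h ->
  dot (fun z => \sum_(i <- r) F i z) h = \sum_(i <- r) dot (F i) h.
Proof.
move=> F2 h2; elim: r => [|i r IH].
  rewrite big_nil -[RHS](dot0l h); congr dot.
  by apply/funext => z; rewrite big_nil.
rewrite big_cons -IH -dotDl //; last exact: sqint_sum.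
by congr dot; apply/funext => z; rewrite big_cons.
Qed.

Lemma dot_ge0 f : 0 <= dot f f.
Proof. by apply: Rintegral_ge0 => z _; rewrite -expr2 sqr_ge0. Qed.

Lemma nrm_ge0 f : 0 <= nrm f.
Proof. by rewrite fine_ge0 // Lnorm_ge0. Qed.

Lemma nrm_sqr f : sqint f -> nrm f ^+ 2 = dot f f.
Proof.
move=> f2; have fin : ('N[mu]_2%:E[EFin \o f] < +oo)%E.
  by have /sub_Lfun_finLfun := f2; rewrite inE.
have E := @powR_Lnorm _ _ _ mu (EFin \o f) 2.
have /E : (2 : R) != 0 by [].
rewrite (_ : \int[mu]_x _ = \int[mu]_x (f x * f x)%:E)%E; last first.
  apply: eq_integral => x _ /=.
  by rewrite powR_mulrn // real_normK ?num_real // expr2.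
rewrite /dot /Rintegral => <-.
have fin' : ('N[mu]_2%:E[EFin \o f] \is a fin_num)%E.
  by rewrite ge0_fin_numE ?Lnorm_ge0.
by rewrite /nrm -[in RHS](fineK fin') poweR_EFin /= powR_mulrn // fine_ge0 // Lnorm_ge0.
Qed.

Lemma nrmE f : sqint f -> nrm f = Num.sqrt (dot f f).
Proof. by move=> f2; rewrite -nrm_sqr // sqrtr_sqr ger0_norm // nrm_ge0. Qed.

Lemma cauchy_schwarz f g : sqint f -> sqint g -> `|dot f g| <= nrm f * nrm g.
Proof.
move=> f2 g2.
have E (a b : R) : 0 <= a ^+ 2 * dot f f + 2 * a * b * dot f g + b ^+ 2 * dot g g.
  have := dot_ge0 (fun z => a * f z + b * g z).
  have sa := sqintZ a f2; have sb := sqintZ b g2; have sab := sqintD sa sb.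
  rewrite dotDl // !dotDr // !dotZl // !dotZr // (dotC g f).
  by move=> h; lra.
have f0 := nrm_ge0 f; have g0 := nrm_ge0 g.
rewrite -(@ler_pXn2r _ 2) ?nnegrE ?mulr_ge0 // exprMn !nrm_sqr //.
rewrite real_normK ?num_real //.
have F0 := dot_ge0 f; have G0 := dot_ge0 g.
set F := dot f f in E F0 *; set G := dot g g in E G0 *; set D := dot f g in E *.
have [F1|F1] := ltrP 0 F.
  by rewrite -(ler_pM2l F1); have := E D (- F); lra.
have F00 : F = 0 by apply/eqP; rewrite eq_le F1.
have [->|D0] := eqVneq D 0; first by rewrite expr0n /= mulr_ge0.
have := E (- (G + 1) / (2 * D)) 1; rewrite F00 mulr0 add0r expr1n mul1r mulr1.
have -> : 2 * (- (G + 1) / (2 * D)) * D = - (G + 1) by field.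
by lra.
Qed.

Lemma nrm_triangle f g : sqint f -> sqint g ->
  nrm (fun z => f z + g z) <= nrm f + nrm g.
Proof.
move=> f2 g2; rewrite -(@ler_pXn2r _ 2) ?nnegrE ?addr_ge0 ?nrm_ge0 //.
rewrite nrm_sqr; last exact: sqintD.
rewrite dotDl ?dotDr ?(dotC g f) // ?sqintD //; try exact: sqintD.
rewrite sqrrD !nrm_sqr //.
have := cauchy_schwarz f2 g2; rewrite ler_norml => /andP[_ h].
by rewrite mulr2n; lra.
Qed.

Lemma nrmN f : sqint f -> nrm (fun z => - f z) = nrm f.
Proof.
move=> f2; rewrite (nrmE (sqintN f2)) (nrmE f2); congr (Num.sqrt _); rewrite /dot.
by apply: eq_Rintegral => z _; rewrite mulrNN.
Qed.

Lemma nrm_eq0 f : sqint f -> nrm f = 0 -> {ae mu, forall z, f z = 0}.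
Proof.
move=> f2 f0.
have := @fine_Lnormr_eq0 _ _ _ mu 2%:E (lee1n 2) (Lfun_Sub (lee1n 2) f2) f0.
by apply: filterS => z /(_ I).
Qed.

Lemma ae_eq_nrm0 f : sqint f -> {ae mu, forall z, f z = 0} -> nrm f = 0.
Proof.
move=> f2 f0; rewrite nrmE // /dot /Rintegral.
rewrite (ae_eq_integral (fun=> 0%E)) //=.
- by rewrite integral0 sqrtr0.
- by case/integrableP: (sqint_integrable f2 f2).
- by apply: filterS f0 => z z0 _; rewrite z0 mulr0.
Qed.

Lemma nrm_le_sub f g : sqint f -> sqint g ->
  nrm f <= nrm g + nrm (fun z => f z - g z).
Proof.
move=> f2 g2; have := nrm_triangle g2 (sqintB f2 g2).
by rewrite (_ : (fun z => _) = f) //; apply/funext => z; rewrite addrC subrK.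
Qed.

Lemma sqint_bounded f (M : R) : (mu setT < +oo)%E -> measurable_fun setT f ->
  (forall z, `|f z| <= M) -> sqint f.
Proof.
move=> muT mf fM; apply: sqintP => //.
apply: (@le_lt_trans _ _ (\int[mu]_z (M ^+ 2)%:E)%E).
  apply: ge0_le_integral => //.
  - by move=> z _; rewrite lee_fin sqr_ge0.
  - by apply/measurable_EFinP; exact: measurable_funX.
  - move=> z _; rewrite lee_fin -(real_normK (num_real (f z))).
    by rewrite ler_pXn2r ?nnegrE // (le_trans _ (fM z)).
by rewrite integral_cst // lte_mul_pinfty // lee_fin sqr_ge0.
Qed.

End SquareIntegrable.

Section SquareIntegrableLimits.
Context d (T : measurableType d) (R : realType) (mu : {measure set T -> \bar R}).
Implicit Types f g h : T -> R.

Lemma ae_mono (P Q : T -> Prop) : (forall z, P z -> Q z) ->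
  {ae mu, forall z, P z} -> {ae mu, forall z, Q z}.
Proof. by move=> PQ; apply: filterS. Qed.

Lemma nrm_sub_ae f g : sqint mu f -> sqint mu g ->
  {ae mu, forall z, f z = g z} -> nrm mu (fun z => f z - g z) = 0.
Proof.
move=> f2 g2 fg; apply: ae_eq_nrm0; first exact: sqintB.
by apply: filterS fg => z ->; rewrite subrr.
Qed.

Lemma nrmZ (a : R) f : sqint mu f ->
  nrm mu (fun z => a * f z) = `|a| * nrm mu f.
Proof.
move=> f2; rewrite (nrmE (sqintZ a f2)) (nrmE f2).
rewrite dotZl ?dotZr //; last exact: sqintZ.
by rewrite mulrA -expr2 sqrtrM ?sqr_ge0 // sqrtr_sqr.
Qed.

(** Dominated convergence for the squares (f - F n)^2. *)
Lemma nrm_dominated (F : nat -> T -> R) f h :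
  (forall n, sqint mu (F n)) -> sqint mu f ->
  (forall z, F n z @[n --> \oo] --> f z) ->
  mu.-integrable setT (EFin \o h) ->
  (forall n z, (f z - F n z) ^+ 2 <= h z) ->
  forall e, 0 < e -> exists n, nrm mu (fun z => f z - F n z) <= e.
Proof.
move=> F2 f2 Ff hi Fh e e0.
pose D n z : \bar R := ((f z - F n z) ^+ 2)%:E.
have B2 n : sqint mu (fun z => f z - F n z) by exact: sqintB.
have mD n : measurable_fun setT (D n).
  apply/measurable_EFinP; apply: measurable_funX.
  exact: sqint_measurable (B2 n).
have D0 z : D ^~ z @ \oo --> 0%E.
  have : (f z - F n z) ^+ 2 @[n --> \oo] --> (0 : R).
    rewrite (_ : 0 = (f z - f z) * (f z - f z)); last by rewrite subrr mul0r.
    have h1 : f z - F n z @[n --> \oo] --> f z - f z.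
      by apply: cvgB => //; exact: cvg_cst.
    by under eq_fun do rewrite expr2; exact: (cvgM h1 h1).
  by move=> h1; apply: cvg_EFin => //; exact: nearW.
have Dh z n : setT z -> (`|D n z| <= (EFin \o h) z)%E.
  by move=> _; rewrite /D /= lee_fin ger0_norm ?sqr_ge0.
have [_ _] := @dominated_convergence _ T R mu setT measurableT D (fun=> 0%E)
  (EFin \o h) mD (measurable_cst _) (aeW _ (fun z _ => D0 z)) hi
  (aeW _ Dh).
rewrite integral0 => lim0.
have e20 : 0 < e ^+ 2 by rewrite exprn_gt0.
have /fine_cvgP [_] := lim0.
move=> /cvgrPdist_lt /(_ _ e20) [N _ /(_ N (leqnn N))] /=.
rewrite sub0r normrN => lt; exists N.
rewrite -(@ler_pXn2r _ 2) ?nnegrE ?nrm_ge0 ?(ltW e0) // nrm_sqr //.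
apply: ltW; apply: le_lt_trans lt; apply: le_trans (ler_norm _).
by rewrite /dot /Rintegral.
Qed.

Import HBNNSimple.

Lemma nrm_approx_ex f : sqint mu f -> (forall z, 0 <= f z) ->
  forall e, 0 < e -> exists2 g : {nnsfun T >-> R}, sqint mu (g : T -> R) &
    nrm mu (fun z => f z - g z) <= e.
Proof.
move=> f2 f0 e e0.
have mf : measurable_fun setT (EFin \o f).
  by apply/measurable_EFinP; exact: sqint_measurable f2.
pose g := nnsfun_approx measurableT mf.
have f0' z : setT z -> (0 <= (EFin \o f) z)%E by rewrite lee_fin.
have gc z : g n z @[n --> \oo] --> f z.
  have := cvg_nnsfun_approx measurableT mf f0' (I : setT z).
  by move=> /fine_cvgP[].
have gle n z : g n z <= f z.
  have nd : nondecreasing_seq (g ^~ z).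
    by move=> a b ab; have /lefP := nd_nnsfun_approx measurableT mf ab; exact.
  have gcv : cvgn (g ^~ z : R^nat) by apply: cvgP (gc z).
  by have := nondecreasing_cvgn_le nd gcv n; rewrite (cvg_lim _ (gc z)).
have g0 n z : 0 <= g n z by [].
have g2 n : sqint mu (g n).
  apply: sqintP => //.
  have /integrableP[_ +] := Lfun2_integrable_sqr f2.
  apply: le_lt_trans; apply: ge0_le_integral => //.
  - by move=> z _; rewrite lee_fin sqr_ge0.
  - by apply/measurable_EFinP; exact: measurable_funX.
  - apply: measurableT_comp => //; apply/measurable_EFinP.
    by apply: measurable_funX; exact: sqint_measurable f2.
  - move=> z _ /=; rewrite lee_fin ger0_norm ?sqr_ge0 //.
    by rewrite ler_pXn2r ?nnegrE // f0.
have gd n z : (f z - g n z) ^+ 2 <= f z ^+ 2.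
  by rewrite ler_pXn2r ?nnegrE ?subr_ge0 ?f0 // gerBl.
have [n gn] := nrm_dominated g2 f2 gc (Lfun2_integrable_sqr f2) gd e0.
by exists (g n).
Qed.

End SquareIntegrableLimits.

(** * Plane waves *)

Section Waves.
Context {R : realType}.

Definition wave (a b s : R) (z : R * R) : R := cos (a * z.1 + b * z.2 + s).

Lemma cosDpihalf (x : R) : cos (x + pi / 2) = - sin x.
Proof. by rewrite cosD cos_pihalf sin_pihalf mulr0 mulr1 sub0r. Qed.

Lemma wave_shift a b s z : wave a b (s + pi / 2) z = - sin (a * z.1 + b * z.2 + s).
Proof. by rewrite /wave addrA cosDpihalf. Qed.

Lemma is_derive_wave (c a b s : R) (z v : R * R) :
  is_derive z v (fun z => c * wave a b s z)
    (c * (a * v.1 + b * v.2) * wave a b (s + pi / 2) z).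
Proof.
pose g (h : R) := c * cos ((a * v.1 + b * v.2) * h + (a * z.1 + b * z.2 + s)).
have dg : is_derive (0 : R) (1 : R) g
    (c * (a * v.1 + b * v.2) * wave a b (s + pi / 2) z).
  pose k (h : R) := (a * v.1 + b * v.2) * h + (a * z.1 + b * z.2 + s).
  have dk : is_derive (0 : R) (1 : R) k (a * v.1 + b * v.2).
    have := is_deriveD (is_deriveZ (a * v.1 + b * v.2) (is_derive_id (0 : R) (1 : R)))
      (is_derive_cst (a * z.1 + b * z.2 + s) (0 : R) (1 : R)).
    by rewrite /GRing.scale /= mulr1 addr0.
  rewrite (_ : _ * wave _ _ _ _ = c *: (- sin (k 0) * (a * v.1 + b * v.2))).
    exact: (is_deriveZ c (is_derive1_comp (is_derive_cos (k 0)) dk)).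
  by rewrite wave_shift /k mulr0 add0r /GRing.scale /=; ring.
have gE : g = (fun h : R => (fun z => c * wave a b s z) (h *: v + z)).
  apply/funext => h; rewrite /g /wave /=; congr (_ * cos _).
  by rewrite /GRing.scale /=; ring.
have dw : derivable (fun z => c * wave a b s z) z v.
  by apply/derivable1P; rewrite -gE; exact: ex_derive.
apply: (DeriveDef dw).
rewrite -(derive_val (is_derive := dg)) gE /derive.
apply: (congr1 (fun F : R -> R => lim (F @ (0 : R)^'))); apply/funext => h /=.
by rewrite scale0r add0r addr0 [_ *: 1]mulr1.
Qed.

Lemma wave_continuous c a b s : continuous (fun z : R * R => c * wave a b s z).
Proof.
move=> z; apply: cvgM; first exact: cvg_cst.
apply: (continuous_comp (f := fun z : R * R => a * z.1 + b * z.2 + s) (g := @cos R)); last first.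
  exact: continuous_cos.
apply: cvgD; last exact: cvg_cst.
apply: cvgD; (apply: cvgM; first exact: cvg_cst).
  exact: cvg_fst.
exact: cvg_snd.
Qed.

Lemma derive_wave c a b s (v : R * R) :
  'D_v (fun z => c * wave a b s z) =
  fun z => c * (a * v.1 + b * v.2) * wave a b (s + pi / 2) z.
Proof. by apply/funext => z; rewrite (derive_val (is_derive := is_derive_wave c a b s z v)). Qed.

(** A directional derivative only changes the amplitude and shifts the phase by
    pi / 2. *)
Lemma wave_smooth c a b s : smooth (fun z => c * wave a b s z).
Proof.
move=> l /=.
suff [c' [s' ->]] : exists c' s', foldr (fun v h => 'D_v h)
    (fun z => c * wave a b s z) l = (fun z => c' * wave a b s' z).
  split; first exact: wave_continuous.
  by move=> z v; have := is_derive_wave c' a b s' z v => ?; exact: ex_derive.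
elim: l => [|v l [c' [s' IH]]] /=; first by exists c, s.
by rewrite IH derive_wave; eexists; eexists; reflexivity.
Qed.

Lemma waveM a b s a' b' s' z : wave a b s z * wave a' b' s' z =
  2^-1 * wave (a - a') (b - b') (s - s') z
  + 2^-1 * wave (a + a') (b + b') (s + s') z.
Proof.
rewrite /wave.
have -> : (a - a') * z.1 + (b - b') * z.2 + (s - s') =
  (a * z.1 + b * z.2 + s) - (a' * z.1 + b' * z.2 + s') by ring.
have -> : (a + a') * z.1 + (b + b') * z.2 + (s + s') =
  (a * z.1 + b * z.2 + s) + (a' * z.1 + b' * z.2 + s') by ring.
suff key A B : cos A * cos B = 2^-1 * cos (A - B) + 2^-1 * cos (A + B) :> R by [].
by rewrite cosB cosD; lra.
Qed.

Lemma wave_phase a b s z :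
  wave a b s z = cos s * wave a b 0 z + sin s * wave a b (pi / 2) z.
Proof.
rewrite -[pi / 2](add0r) wave_shift /wave !addr0 cosD.
by ring.
Qed.

Lemma waveN a b s z : wave (- a) (- b) (- s) z = wave a b s z.
Proof. by rewrite /wave -[in RHS]cosN; congr cos; ring. Qed.

Lemma wave_le1 a b s z : `|wave a b s z| <= 1.
Proof. by rewrite /wave ler_norml cos_geN1 cos_le1. Qed.

Lemma wave_measurable a b s :
  measurable_fun setT (wave a b s : measurableTypeR R * measurableTypeR R -> R).
Proof.
apply: (measurableT_comp (f := @cos R)).
  by apply: continuous_measurable_fun; exact: continuous_cos.
apply: measurable_funD; last exact: measurable_cst.
apply: measurable_funD; apply: measurable_funM; try exact: measurable_cst.
  exact: measurable_fst.
exact: measurable_snd.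
Qed.

End Waves.

(** * Integration over the torus *)

Section TorusMeasure.
Context {R : realType}.

Lemma circle_setT (l : R) : 0 < l -> circle l setT = l%:E.
Proof.
move=> l0; rewrite /circle /= /mfrestr /mrestr setTI lebesgue_measure_itv /=.
by rewrite lte_fin l0 -EFinB subr0.
Qed.

Lemma circle_setC (l : R) : circle l (~` `]0, l[) = 0%E.
Proof. by rewrite /circle /= /mfrestr /mrestr setICl measure0. Qed.

Lemma integral_circle (l : R) (f : R -> R) : measurable_fun setT f ->
  (forall x, `|f x| <= 1) ->
  (\int[circle l]_x (f x)%:E = \int[lebesgue_measure]_(x in `]0%R, l[) (f x)%:E)%E.
Proof.
move=> mf f1.
have fi : (circle l).-integrable setT (EFin \o f).
  apply: (le_integrable measurableT _ _ (finite_measure_integrable_cst (circle l) 1 measurableT)).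
    exact/measurable_EFinP.
  by move=> x _ /=; rewrite lee_fin normr1.
rewrite (@negligible_integral _ _ _ (circle l) setT (~` `]0, l[)) //=.
- rewrite setDE setTI setCK; apply: eq_measure_integral => A mA Al.
  by rewrite /circle /= /mfrestr /mrestr setIidl.
- by apply: measurableC; exact: measurable_itv.
- exact: circle_setC.
Qed.

Lemma continuous_cos_affine (a s : R) : continuous (fun x : R => cos (a * x + s)).
Proof.
move=> x; apply: (continuous_comp (f := fun x : R => a * x + s) (g := @cos R));
  last exact: continuous_cos.
by apply: cvgD; [apply: cvgM; [exact: cvg_cst|exact: cvg_id]|exact: cvg_cst].
Qed.

(** The primitive a^-1 sin (a x + s) takes the same value at 0 and l. *)
Lemma circle_cos (l a s : R) : 0 < l -> a != 0 -> sin (a * l + s) = sin s ->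
  (\int[circle l]_x (cos (a * x + s))%:E = 0)%E.
Proof.
move=> l0 a0 al.
have ccos : continuous (fun x : R => cos (a * x + s)).
  exact: continuous_cos_affine.
rewrite integral_circle; last 2 first.
- exact: continuous_measurable_fun.
- by move=> x; rewrite ler_norml cos_geN1 cos_le1.
pose F (x : R) := a^-1 * sin (a * x + s).
have dF x : is_derive x (1 : R) F (cos (a * x + s)).
  pose k (h : R) := a * h + s.
  have dk : is_derive x (1 : R) k a.
    have := is_deriveD (is_deriveZ a (is_derive_id x (1 : R)))
      (is_derive_cst s x (1 : R)).
    by rewrite /GRing.scale /= mulr1 addr0.
  rewrite (_ : cos _ = a^-1 *: (cos (k x) * a)).
    exact: (is_deriveZ a^-1 (is_derive1_comp (is_derive_sin (k x)) dk)).
  by rewrite /GRing.scale /= mulrCA mulVf ?mulr1.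
have cF : continuous F.
  move=> x; apply: differentiable_continuous; apply/derivable1_diffP.
  exact: ex_derive.
rewrite integral_itv_bndo_bndc; last first.
  apply: measurable_funTS; apply/measurable_EFinP.
  exact: continuous_measurable_fun.
rewrite integral_itv_obnd_cbnd; last first.
  apply: measurable_funTS; apply/measurable_EFinP.
  exact: continuous_measurable_fun.
rewrite (@continuous_FTC2 _ _ F) //.
- by rewrite /F al mulr0 add0r -EFinB subrr.
- exact: continuous_subspaceT.
- split.
  + by move=> x _; exact: ex_derive.
  + by apply: cvg_at_right_filter; exact: cF.
  + by apply: cvg_at_left_filter; exact: cF.
- by move=> x _; rewrite derive1E (derive_val (is_derive := dF x)).
Qed.

Lemma torus_setT (alpha : R) : 0 < alpha ->
  torus alpha setT = (2 * pi / alpha * (2 * pi))%:E.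
Proof.
move=> a0; have p0 : 0 < 2 * pi :> R by rewrite mulr_gt0 ?pi_gt0.
rewrite /torus -setXTT /= product_measure1E //= !circle_setT //.
by rewrite divr_gt0.
Qed.

Definition area (alpha : R) : R := 2 * pi / alpha * (2 * pi).

Lemma area_gt0 (alpha : R) : 0 < alpha -> 0 < area alpha.
Proof.
move=> a0; have p0 : 0 < 2 * pi :> R by rewrite mulr_gt0 ?pi_gt0.
by rewrite mulr_gt0 // divr_gt0.
Qed.

Lemma torus_finite (alpha : R) : 0 < alpha -> (torus alpha setT < +oo)%E.
Proof. by move=> a0; rewrite torus_setT // ltry. Qed.

Lemma wave_sqint (alpha a b s : R) : 0 < alpha ->
  sqint (torus alpha) (wave a b s).
Proof.
move=> a0; apply: (sqint_bounded (M := 1 : R)).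
- exact: torus_finite.
- exact: wave_measurable.
- exact: wave_le1.
Qed.

Lemma wave_integrable (alpha a b s : R) : 0 < alpha ->
  (torus alpha).-integrable setT (EFin \o wave a b s).
Proof.
move=> a0; apply/Lfun1_integrable.
apply: (Lfun_subset12 _ (wave_sqint a b s a0)).
by rewrite ge0_fin_numE // torus_finite.
Qed.

Lemma sin_period_int (k : int) (x : R) : sin (x + k%:~R * (2 * pi)) = sin x.
Proof.
have sn (n : nat) y : sin (y + n%:R * (2 * pi)) = sin y :> R.
  elim: n y => [|n IH] y; first by rewrite mul0r addr0.
  by rewrite -natr1 mulrDl mul1r addrA [X in sin (_ + X)]mulr_natl sinD2pi IH.
case: k => n; first exact: sn.
rewrite NegzE mulrNz -(sn n.+1 (x + _)); congr sin.
by rewrite mulNr -addrA (addrC (- _)) subrr addr0.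
Qed.

Definition tmode (alpha : R) (k j : int) (s : R) : R * R -> R :=
  wave (k%:~R * alpha) j%:~R s.

Lemma tmode_integral0 (alpha : R) k j (s : R) : 0 < alpha -> (k != 0) || (j != 0) ->
  \int[torus alpha]_z tmode alpha k j s z = 0.
Proof.
move=> a0 kj; rewrite /Rintegral.
suff -> : (\int[torus alpha]_z (tmode alpha k j s z)%:E = 0)%E by [].
(* If j <> 0 the inner integral in y vanishes; otherwise the integrand depends
   on x only. *)
have p0 : 0 < 2 * pi :> R by rewrite mulr_gt0 ?pi_gt0.
have l0 : 0 < 2 * pi / alpha by rewrite divr_gt0.
have := @integral12_prod_meas1 _ _ _ _ R (circle (2 * pi / alpha)) (circle (2 * pi)) _
  (wave_integrable (k%:~R * alpha) j%:~R s a0).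
rewrite /torus => <-; rewrite /fubini_F /= /wave /=.
have [j0|j0] := eqVneq j 0; last first.
  rewrite (eq_integral (fun=> 0%E)) ?integral0 // => x _.
  rewrite -[RHS](@circle_cos (2 * pi) j%:~R (k%:~R * alpha * x + s)) //.
  - by apply: eq_integral => y _; congr (cos _)%:E; ring.
  - by rewrite intr_eq0.
  - by rewrite addrC sin_period_int.
have k0 : k != 0 by move: kj; rewrite j0 eqxx orbF.
transitivity (\int[circle (2 * pi / alpha)]_x
    ((2 * pi)%:E * (cos (k%:~R * alpha * x + s))%:E))%E.
  apply: eq_integral => x _; rewrite j0.
  under eq_integral do rewrite mul0r addr0.
  by rewrite integral_cst //= circle_setT // muleC.
rewrite integralZl //.
  rewrite (circle_cos l0) ?mule0 //.
    by rewrite mulf_neq0 ?intr_eq0 // gt_eqF.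
  rewrite addrC (_ : k%:~R * alpha * (2 * pi / alpha) = k%:~R * (2 * pi)).
    exact: sin_period_int.
  by field; rewrite gt_eqF.
apply: (le_integrable measurableT _ _ (finite_measure_integrable_cst _ 1 measurableT)).
  apply/measurable_EFinP; apply: continuous_measurable_fun.
  exact: continuous_cos_affine.
by move=> x _ /=; rewrite lee_fin normr1 ler_norml cos_geN1 cos_le1.
Qed.

End TorusMeasure.

(** * Completeness of the trigonometric system *)

Section Completeness.
Context {R : realType} (alpha : R) (alpha0 : 0 < alpha).
Local Notation mu := (torus alpha).
Local Notation T2 := (measurableTypeR R * measurableTypeR R)%type.
Implicit Types f g p q : R * R -> R.

(** Thanks to the phase, one constructor covers sines and cosines, and products
    of generators are sums of two generators. *)
Inductive trig : (R * R -> R) -> Prop :=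
| trig_mode a k j s : trig (fun z => a * tmode alpha k j s z)
| trigD p q : trig p -> trig q -> trig (fun z => p z + q z).

Lemma trig_ext p q : (forall z, p z = q z) -> trig p -> trig q.
Proof. by move=> /funext ->. Qed.

Lemma trig_cst a : trig (fun=> a).
Proof.
apply: (trig_ext _ (trig_mode a 0 0 0)) => z.
by rewrite /tmode /wave !mul0r !addr0 cos0 mulr1.
Qed.

Lemma trigZ a p : trig p -> trig (fun z => a * p z).
Proof.
elim=> [b k j s|f g _ IHf _ IHg].
  by apply: (trig_ext _ (trig_mode (a * b) k j s)) => z; rewrite mulrA.
by apply: (trig_ext _ (trigD IHf IHg)) => z; rewrite mulrDr.
Qed.

Lemma trigM p q : trig p -> trig q -> trig (fun z => p z * q z).
Proof.
move=> tp; elim=> [b k j s|f g _ IHf _ IHg]; last first.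
  by apply: (trig_ext _ (trigD IHf IHg)) => z; rewrite mulrDr.
elim: tp => [a k' j' s'|f g _ IHf _ IHg]; last first.
  by apply: (trig_ext _ (trigD IHf IHg)) => z; rewrite mulrDl.
apply: (trig_ext _ (trigD (trig_mode (a * b * 2^-1) (k' - k) (j' - j) (s' - s))
                         (trig_mode (a * b * 2^-1) (k' + k) (j' + j) (s' + s)))).
move=> z; rewrite mulrACA /tmode waveM !intrD !intrN !mulrBl !mulrDl.
by rewrite mulrDr !mulrA.
Qed.

Lemma trigX p n : trig p -> trig (fun z => p z ^+ n).
Proof.
move=> tp; elim: n => [|n IH]; first exact: (trig_ext _ (trig_cst 1)).
by apply: (trig_ext _ (trigM tp IH)) => z; rewrite exprS.
Qed.

Lemma trigB p q : trig p -> trig q -> trig (fun z => p z - q z).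
Proof.
move=> tp tq; apply: (trig_ext _ (trigD tp (trigZ (-1) tq))) => z.
by rewrite mulN1r.
Qed.

Lemma trig_sqint p : trig p -> sqint mu p.
Proof.
elim=> [a k j s|f g _ IHf _ IHg]; last exact: sqintD.
by apply: sqintZ; exact: wave_sqint.
Qed.

(** The closure of the trigonometric polynomials in L^2. *)
Definition trig_limit f : Prop := sqint mu f /\
  forall e, 0 < e -> exists2 p, trig p & nrm mu (fun z => f z - p z) <= e.

Lemma trig_limit_trig p : trig p -> trig_limit p.
Proof.
move=> tp; split; first exact: trig_sqint.
move=> e e0; exists p => //; rewrite (_ : (fun z => _) = fun=> 0).
  by rewrite ae_eq_nrm0 ?ltW //; [exact: sqint0|exact: aeW].
by apply/funext => z; rewrite subrr.
Qed.

Lemma trig_limitD f g : trig_limit f -> trig_limit g -> trig_limit (fun z => f z + g z).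
Proof.
move=> [f2 fA] [g2 gA]; split; first exact: sqintD.
move=> e e0; have e20 : 0 < e / 2 by rewrite divr_gt0.
have [p tp pf] := fA _ e20; have [q tq qg] := gA _ e20.
exists (fun z => p z + q z); first exact: trigD.
have := nrm_triangle (sqintB f2 (trig_sqint tp)) (sqintB g2 (trig_sqint tq)).
rewrite (_ : (fun z => f z - p z + (g z - q z)) = (fun z => f z + g z - (p z + q z))).
  by move=> h; apply: (le_trans h); lra.
by apply/funext => z; ring.
Qed.

Lemma trig_limitZ a f : trig_limit f -> trig_limit (fun z => a * f z).
Proof.
move=> [f2 fA]; split; first exact: sqintZ.
move=> e e0; have a0 : 0 < `|a| + 1 by rewrite ltr_wpDl.
have [p tp pf] := fA (e / (`|a| + 1)) (divr_gt0 e0 a0).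
exists (fun z => a * p z); first exact: trigZ.
rewrite (_ : (fun z => _) = fun z => a * (f z - p z)); last first.
  by apply/funext => z; rewrite mulrBr.
rewrite nrmZ; last by apply: sqintB => //; exact: trig_sqint.
move: pf; rewrite ler_pdivlMr // => pf; apply: le_trans pf.
by rewrite mulrC ler_wpM2l ?nrm_ge0 // lerDl.
Qed.

Lemma trig_limitB f g : trig_limit f -> trig_limit g -> trig_limit (fun z => f z - g z).
Proof.
move=> fA gA; have := trig_limitD fA (trig_limitZ (-1) gA).
by under eq_fun do rewrite mulN1r.
Qed.

Lemma trig_limit_sum n (F : 'I_n -> R * R -> R) : (forall i, trig_limit (F i)) ->
  trig_limit (fun z => \sum_(i < n) F i z).
Proof.
elim: n F => [|n IH] F FA.
  rewrite (_ : (fun z => _) = fun=> 0); last by apply/funext => z; rewrite big_ord0.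
  exact: trig_limit_trig (trig_cst 0).
rewrite (_ : (fun z => _) = fun z => \sum_(i < n) F (widen_ord (leqnSn n) i) z
   + F ord_max z); last by apply/funext => z; rewrite big_ord_recr.
by apply: trig_limitD => //; exact: IH.
Qed.

Lemma trig_limit_closed f : sqint mu f ->
  (forall e, 0 < e -> exists2 g, trig_limit g & nrm mu (fun z => f z - g z) <= e) ->
  trig_limit f.
Proof.
move=> f2 fl; split => // e e0; have e20 : 0 < e / 2 by rewrite divr_gt0.
have [g [g2 gA] fg] := fl _ e20; have [p tp pg] := gA _ e20.
exists p => //; have := nrm_triangle (sqintB f2 g2) (sqintB g2 (trig_sqint tp)).
rewrite (_ : (fun z => f z - g z + (g z - p z)) = fun z => f z - p z).
  by move=> h; apply: (le_trans h); lra.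
by apply/funext => z; ring.
Qed.

Lemma trig_limit_ae f g : sqint mu f -> trig_limit g ->
  {ae mu, forall z, f z = g z} -> trig_limit f.
Proof.
move=> f2 gA fg; have [g2 _] := gA.
apply: trig_limit_closed => // e e0; exists g => //.
by rewrite nrm_sub_ae ?ltW.
Qed.

Lemma trig_limit_dominated (F : nat -> R * R -> R) f (h : R * R -> R) :
  (forall n, trig_limit (F n)) -> sqint mu f ->
  (forall z, F n z @[n --> \oo] --> f z) ->
  mu.-integrable setT (EFin \o h) ->
  (forall n z, (f z - F n z) ^+ 2 <= h z) -> trig_limit f.
Proof.
move=> FA f2 Ff hi Fh; apply: trig_limit_closed => // e e0.
have [n fn] := nrm_dominated (fun n => proj1 (FA n)) f2 Ff hi Fh e0.
by exists (F n).
Qed.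

Lemma cst_integrable (a : R) : mu.-integrable setT (EFin \o (fun=> a)).
Proof.
have h := sqint_integrable (trig_sqint (trig_cst a)) (trig_sqint (trig_cst 1)).
by apply: eq_integrable h => // z _ /=; rewrite mulr1.
Qed.

Lemma trig_limit_bounded (F : nat -> R * R -> R) f :
  (forall n, trig_limit (F n)) -> measurable_fun setT (f : T2 -> R) ->
  (forall z, F n z @[n --> \oo] --> f z) ->
  (forall n z, 0 <= F n z <= 1) -> (forall z, 0 <= f z <= 1) -> trig_limit f.
Proof.
move=> FA mf Ff F1 f1.
apply: (trig_limit_dominated FA _ Ff (cst_integrable 1)).
  apply: (sqint_bounded (M := 1)) => //; first exact: torus_finite.
  by move=> z; rewrite ger0_norm; case/andP: (f1 z).
move=> n z; have /andP[a b] := F1 n z; have /andP[c d] := f1 z.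
by nra.
Qed.

(** Tends to 1 for x < 1/2 and to 0 for x >= 1/2. The factor n in the exponent is
    there for x = 1/2, where (1 - x^n)^(2^n) would tend to 1 / e. *)
Definition step_poly (n : nat) (x : R) : R := (1 - x ^+ n) ^+ (n * 2 ^ n).

Lemma bernoulli_ineq (a : R) n : -1 <= a -> 1 + n%:R * a <= (1 + a) ^+ n.
Proof.
move=> a1; elim: n => [|n IH]; first by rewrite mul0r addr0 expr0.
rewrite exprS -natr1; have h : 0 <= 1 + a by lra.
have := ler_wpM2l h IH; apply: le_trans.
have : 0 <= n%:R * a ^+ 2 by rewrite mulr_ge0 // sqr_ge0.
lra.
Qed.

Lemma step_poly_ge (x : R) n : 0 <= x <= 1 ->
  1 - n%:R * (2 * x) ^+ n <= step_poly n x.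
Proof.
move=> /andP[x0 x1]; rewrite /step_poly.
have xn : x ^+ n <= 1 by rewrite exprn_ile1.
apply: le_trans (bernoulli_ineq (n * 2 ^ n) (_ : -1 <= - x ^+ n)); last lra.
by rewrite natrM natrX exprMn mulrN mulrA.
Qed.

(** With a = 2^-n, (1 - a)^M (1 + a)^M <= 1 and (1 + a)^M >= 1 + M a = 1 + n for
    M = n 2^n. *)
Lemma step_poly_le (x : R) n : 2^-1 <= x <= 1 -> step_poly n x <= (1 + n%:R)^-1.
Proof.
move=> /andP[x0 x1]; rewrite /step_poly.
have xx : 0 <= x by apply: le_trans x0.
have xn : x ^+ n <= 1 by rewrite exprn_ile1.
(* For x >= 1/2 it suffices to bound the value at 1/2. *)
have xn2 : 2^-1 ^+ n <= x ^+ n by apply: lerXn2r; rewrite ?nnegrE ?invr_ge0.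
set a : R := 2^-1 ^+ n in xn2 *.
have a0 : 0 < a by rewrite exprn_gt0.
have a1 : a <= 1 by apply: le_trans xn.
apply: (le_trans (y := (1 - a) ^+ (n * 2 ^ n))).
  by apply: lerXn2r; rewrite ?nnegrE; lra.
have h : (1 - a) ^+ (n * 2 ^ n) * (1 + a) ^+ (n * 2 ^ n) <= 1.
  rewrite -exprMn; apply: exprn_ile1; first by apply: mulr_ge0; lra.
  by have := sqr_ge0 a; lra.
have := bernoulli_ineq (n * 2 ^ n) (_ : -1 <= a).
have -> : (n * 2 ^ n)%:R * a = n%:R.
  by rewrite natrM natrX /a -mulrA -exprMn divff ?expr1n ?mulr1.
move=> /(_ ltac:(lra)) hb.
have n0 : 0 < 1 + n%:R :> R by rewrite ltr_wpDr.
rewrite -[leRHS]mul1r ler_pdivlMr //; apply: le_trans h.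
by apply: ler_wpM2l hb; apply: exprn_ge0; lra.
Qed.

Lemma step_poly01 (x : R) n : 0 <= x <= 1 -> 0 <= step_poly n x <= 1.
Proof.
move=> /andP[x0 x1]; have xn : x ^+ n <= 1 by rewrite exprn_ile1.
have xn0 : 0 <= x ^+ n by rewrite exprn_ge0.
by rewrite /step_poly exprn_ge0 ?exprn_ile1 //; lra.
Qed.

(** With s = sqrt r, the Bernoulli inequality bounds n s^n by 1 / (1 - s). *)
Lemma cvg_natmul_expr (r : R) : 0 <= r < 1 -> n%:R * r ^+ n @[n --> \oo] --> (0 : R).
Proof.
move=> /andP[r0 r1].
have [->|rn0] := eqVneq r 0.
  apply: cvg_near_cst; exists 1%N => // n /= n1.
  by rewrite expr0n gtn_eqF // mulr0.
have rp : 0 < r by rewrite lt_def rn0.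
pose s := Num.sqrt r.
have s0 : 0 < s by rewrite sqrtr_gt0.
have s1 : s < 1 by rewrite -sqrtr1 ltr_sqrt.
have ss : s ^+ 2 = r by rewrite sqr_sqrtr.
have cs : (1 - s)^-1 * s ^+ n @[n --> \oo] --> (0 : R).
  by apply: cvg_geometric; rewrite ger0_norm // ltW.
apply: (squeeze_cvgr _ (cvg_cst (0 : R)) cs); apply: nearW => n.
apply/andP; split; first by rewrite mulr_ge0 // exprn_ge0.
rewrite -ss -exprM mulnC exprM expr2 mulrA.
apply: ler_wpM2r; first by rewrite exprn_ge0 // ltW.
have sp : 0 < s ^+ n by rewrite exprn_gt0.
have d0 : 0 < 1 - s by lra.
rewrite -[leRHS]mul1r ler_pdivlMr //.
have [->|n0] := posnP n; first by rewrite !mul0r.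
have h := bernoulli_ineq n (_ : -1 <= s^-1 - 1).
have si : 0 < s^-1 by rewrite invr_gt0.
have := h ltac:(lra); rewrite [1 + (s^-1 - 1)]addrC subrK exprVn.
move=> hb; have := ler_wpM2l (ltW sp) hb; rewrite mulfV ?gt_eqF // => hc.
have : n%:R * (s ^+ n) * (1 - s) <= n%:R * s ^+ n * (s^-1 - 1).
  apply: ler_wpM2l; first by rewrite mulr_ge0 // ltW.
  have : s * s^-1 = 1 by rewrite mulfV // gt_eqF.
  by nra.
by lra.
Qed.

Definition half_step (x : R) : R := if x < 2^-1 then 1 else 0.

Lemma cvg_step_poly (x : R) : 0 <= x <= 1 ->
  step_poly n x @[n --> \oo] --> half_step x.
Proof.
move=> x01; have /andP[x0 x1] := x01.
rewrite /half_step; have [xh|xh] := ltrP x 2^-1.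
  have r01 : 0 <= 2 * x < 1 by apply/andP; split; lra.
  have h1 : 1 - n%:R * (2 * x) ^+ n @[n --> \oo] --> (1 : R).
    rewrite -[X in _ --> X]subr0; apply: cvgB; first exact: cvg_cst.
    exact: cvg_natmul_expr.
  apply: (squeeze_cvgr _ h1 (cvg_cst (1 : R))); apply: nearW => n.
  by rewrite step_poly_ge //=; case/andP: (step_poly01 n x01).
have h1 : (1 + n%:R)^-1 @[n --> \oo] --> (0 : R).
  under eq_fun do rewrite addrC natr1; exact: cvg_harmonic.
apply: (squeeze_cvgr _ (cvg_cst (0 : R)) h1); apply: nearW => n.
by rewrite step_poly_le ?xh //= andbT; case/andP: (step_poly01 n x01).
Qed.

Lemma trig_step p n : trig p -> trig (fun z => step_poly n (p z)).
Proof.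
move=> tp; apply: trigX; apply: trigB; first exact: trig_cst.
exact: trigX.
Qed.

Lemma trig_measurable p : trig p -> measurable_fun setT (p : T2 -> R).
Proof. by move=> /trig_sqint /sqint_measurable. Qed.

Lemma trig_limit_step2 p q : trig p -> trig q ->
  (forall z, 0 <= p z <= 1) -> (forall z, 0 <= q z <= 1) ->
  trig_limit (fun z => half_step (p z) * half_step (q z)).
Proof.
move=> tp tq p01 q01.
have ms r : trig r -> measurable_fun setT (fun z : T2 => half_step (r z)).
  move=> tr; rewrite /half_step; apply: measurable_fun_ifT.
  - by apply: measurable_fun_ltr; [exact: trig_measurable|exact: measurable_cst].
  - exact: measurable_cst.
  - exact: measurable_cst.
apply: (trig_limit_bounded (F := fun n z => step_poly n (p z) * step_poly n (q z))).
- by move=> n; apply: trig_limit_trig; apply: trigM; exact: trig_step.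
- by apply: measurable_funM; exact: ms.
- by move=> z; apply: cvgM; exact: cvg_step_poly.
- move=> n z; have /andP[a b] := step_poly01 n (p01 z).
  have /andP[c d] := step_poly01 n (q01 z).
  by rewrite mulr_ge0 //= mulr_ile1.
- by move=> z; rewrite /half_step; case: ifP; case: ifP; rewrite ?mulr0 ?mulr1 ?lexx ?ler01.
Qed.

(** If 0 < u < 2 pi / kap, put beta = kap u / 2. Then cos (kap x - beta) - cos beta
    equals 2 sin (kap x / 2) sin (kap (u - x) / 2), where the first sine is positive
    on a period and the second one has the sign of u - x. The other values of u
    only need constants. *)
Lemma ray_threshold (kap u : R) : 0 < kap -> exists a b c : R,
  (forall x, 0 <= a + b * cos (kap * x + c) <= 1) /\
  (forall x, 0 < x < 2 * pi / kap ->
     (a + b * cos (kap * x + c) < 2^-1) = (x < u)).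
Proof.
move=> k0; have pp := pi_gt0 R.
have [u0|u0] := lerP u 0.
  exists 1, 0, 0; split=> x; rewrite !mul0r addr0; first by rewrite ler01 lexx.
  move=> /andP[x0 _]; rewrite [RHS]ltNge (le_trans u0 (ltW x0)) /=.
  by apply/negbTE; rewrite -leNgt invf_le1 // ler1n.
have [ul|ul] := lerP (2 * pi / kap) u.
  exists 0, 0, 0; split=> x; rewrite !mul0r addr0; first by rewrite lexx ler01.
  by move=> /andP[_ xl]; rewrite (lt_le_trans xl ul) invr_gt0 ltr0n.
pose beta := kap * u / 2.
exists (2^-1 + cos beta / 4), (- 4^-1), (- beta); split => x.
  have := cos_le1 beta; have := cos_geN1 beta.
  have := cos_le1 (kap * x + - beta); have := cos_geN1 (kap * x + - beta).
  set X := cos (kap * x + - beta); set Y := cos beta => *.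
  by apply/andP; split; lra.
move=> /andP[x0 xl].
have -> : (2^-1 + cos beta / 4 + - 4^-1 * cos (kap * x + - beta) < 2^-1) =
    (0 < cos (kap * x + - beta) - cos beta).
  by apply/idP/idP => h; lra.
have -> : cos (kap * x + - beta) - cos beta =
    2 * sin (kap * x / 2) * sin (kap * (u - x) / 2).
  have -> : kap * x + - beta = kap * x / 2 - kap * (u - x) / 2.
    by rewrite /beta; lra.
  have -> : beta = kap * x / 2 + kap * (u - x) / 2 by rewrite /beta; lra.
  suff h (A B : R) : cos (A - B) - cos (A + B) = 2 * sin A * sin B by [].
  by rewrite cosB cosD; lra.
have kx : kap * x < 2 * pi by rewrite mulrC -ltr_pdivlMr.
have ku : kap * u < 2 * pi by rewrite mulrC -ltr_pdivlMr.
have kx0 : 0 < kap * x by rewrite mulr_gt0.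
have ku0 : 0 < kap * u by rewrite mulr_gt0.
have sx : 0 < 2 * sin (kap * x / 2).
  by rewrite mulr_gt0 // sin_gt0_pi //; apply/andP; split; lra.
rewrite pmulr_rgt0 //.
have [xu|xu] := ltrP x u.
  apply: sin_gt0_pi; apply/andP; split; last lra.
  by rewrite divr_gt0 // mulr_gt0 // subr_gt0.
apply/negbTE; rewrite -leNgt -oppr_ge0 -sinN.
have kxu : 0 <= kap * (x - u) by rewrite mulr_ge0 ?subr_ge0 // ltW.
by apply: sin_ge0_pi; apply/andP; split; lra.
Qed.

Lemma trig_fst a b c : trig (fun z => a + b * cos (alpha * z.1 + c)).
Proof.
apply: (trig_ext _ (trigD (trig_cst a) (trig_mode b 1 0 c))) => z.
by rewrite /tmode /wave mul1r mul0r addr0.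
Qed.

Lemma trig_snd a b c : trig (fun z => a + b * cos (1 * z.2 + c)).
Proof.
apply: (trig_ext _ (trigD (trig_cst a) (trig_mode b 0 1 c))) => z.
by rewrite /tmode /wave !mul0r add0r.
Qed.

Definition cell : set (R * R) := `]0, 2 * pi / alpha[ `*` `]0, 2 * pi[.

Lemma ae_cell : {ae mu, forall z, cell z}.
Proof.
have p0 : 0 < 2 * pi :> R by rewrite mulr_gt0 ?pi_gt0.
have l0 : 0 < 2 * pi / alpha by rewrite divr_gt0.
have mC : measurable (cell : set T2).
  by apply: measurableX; exact: measurable_itv.
exists (~` cell); split => //; first exact: measurableC.
have mu1 : mu setT = mu cell.
  rewrite torus_setT // /torus /cell /= product_measure1E //=; try exact: measurable_itv.
  rewrite /circle /= /mfrestr /mrestr !setIid !lebesgue_measure_itv /=.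
  by rewrite !lte_fin l0 p0 -!EFinB !subr0 -EFinM.
rewrite -setTD.
apply: (etrans (@measureD _ T2 R mu setT cell measurableT mC (torus_finite alpha0))).
transitivity (mu setT - mu setT)%E.
  by congr (_ - _)%E; rewrite setTI; exact: esym mu1.
by rewrite subee // ge0_fin_numE ?torus_finite.
Qed.

Definition approx_set (A : set (R * R)) := trig_limit (\1_A).

Lemma approx_rays u v : approx_set (`]-oo, u[ `*` `]-oo, v[).
Proof.
have [a [b [c [h1 h2]]]] := ray_threshold u alpha0.
have [a' [b' [c' [h1' h2']]]] := ray_threshold v (ltr01 : 0 < 1 :> R).
have mA : measurable (`]-oo, u[ `*` `]-oo, v[ : set T2).
  by apply: measurableX; exact: measurable_itv.
apply: trig_limit_ae (trig_limit_step2 (trig_fst a b c) (trig_snd a' b' c') _ _) _.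
- apply: (sqint_bounded (M := 1)); first exact: torus_finite.
    exact: measurable_indic.
  by move=> z; rewrite indicE; case: (_ \in _); rewrite ?normr1 ?normr0.
- by move=> z; exact: h1.
- by move=> z; exact: h1'.
apply: ae_mono ae_cell => -[x y] [/= xl yl].
rewrite !in_itv /= in xl yl.
rewrite /half_step h2 // h2' ?divr1 // indicE.
have -> : ((x, y) \in `]-oo, u[ `*` `]-oo, v[) = (x < u) && (y < v).
  apply/idP/idP; first by rewrite inE => -[/=]; rewrite !in_itv /= => -> ->.
  by move=> /andP[xu yv]; rewrite inE; split; rewrite /= in_itv.
by case: (x < u); case: (y < v); rewrite /= ?mulr1 ?mulr0.
Qed.

End Completeness.

Section Density.
Context {R : realType} (alpha : R) (alpha0 : 0 < alpha).
Local Notation mu := (torus alpha).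
Local Notation T2 := (measurableTypeR R * measurableTypeR R)%type.
Local Notation approx_set := (approx_set alpha).

Lemma approx_setT : approx_set setT.
Proof.
rewrite /approx_set indicT; exact: trig_limit_trig (trig_cst alpha 1).
Qed.

Lemma approx_bigcup (F : nat -> set (R * R)) :
  (forall n, measurable (F n : set T2)) -> trivIset setT F ->
  (forall n, approx_set (F n)) -> approx_set (\bigcup_n F n).
Proof.
move=> mF tF FA.
have mU : measurable (\bigcup_n F n : set T2) by exact: bigcupT_measurable.
have sumE n z : \sum_(i < n) \1_(F i) z = \1_(\big[setU/set0]_(i < n) F i) z :> R.
  elim: n => [|n IH]; first by rewrite !big_ord0 indicE in_set0.
  rewrite !big_ord_recr /= IH !indicE in_setU.
  case: (boolP (z \in F n)) => zn; last by rewrite orbF addr0.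
  case: (boolP (z \in _)) => zU; rewrite ?add0r //.
  exfalso; move: zU; rewrite inE -bigcup_mkord => -[i /= li zi].
  have := tF i n I I (ex_intro _ z (conj zi (set_mem zn))).
  by move=> E; move: li; rewrite E ltnn.
apply: (trig_limit_bounded alpha0 (F := fun n z => \sum_(i < n) \1_(F i) z)).
- by move=> n; apply: trig_limit_sum => // i; exact: FA.
- exact: measurable_indic.
- move=> z; case: (pselect (exists n, F n z)) => [[n Fn]|nF].
    apply: cvg_near_cst; exists n.+1 => // k /= nk.
    rewrite sumE !indicE !mem_set //; first by exists n.
    by rewrite -bigcup_mkord; exists n.
  apply: cvg_near_cst; apply: nearW => k.
  rewrite sumE !indicE !memNset //; first by move=> [n _ Fn]; apply: nF; exists n.
  by rewrite -bigcup_mkord => -[n _ Fn]; apply: nF; exists n.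
- by move=> n z; rewrite sumE indicE; case: (_ \in _); rewrite ?lexx ?ler01.
- by move=> z; rewrite indicE; case: (_ \in _); rewrite ?lexx ?ler01.
Qed.

(** The sets A considered form a lambda-system. This is used for each coordinate
    in turn, starting from rays, then for the identity, starting from rectangles. *)
Lemma approx_set_dynkin d (T : measurableType d) (psi : T2 -> T) (C : set T2)
  (G : set (set T)) : measurable_fun setT psi -> measurable C ->
  @measurable d T = <<s G >> -> setI_closed G -> approx_set C ->
  (forall A, G A -> approx_set (psi @^-1` A `&` C)) ->
  forall A, measurable A -> approx_set (psi @^-1` A `&` C).
Proof.
move=> mpsi mC GE GI CA GA A mA.
have mp B : measurable B -> measurable (psi @^-1` B).
  by move=> mB; rewrite -[_ @^-1` _]setTI; exact: mpsi.
have := @dynkin_induction d T G (fun A => approx_set (psi @^-1` A `&` C)) GE GI.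
move=> /(_ _ _ _ _ A); apply.
- by rewrite preimage_setT setTI.
- exact: GA.
- move=> S mS SA; rewrite /approx_set.
  have -> : \1_(psi @^-1` (~` S) `&` C) =
      (fun z => \1_C z - \1_(psi @^-1` S `&` C) z : R).
    apply/funext => z; rewrite !indicE !in_setI preimage_setC in_setC.
    by case: (_ \in _); case: (_ \in C); rewrite /= ?subr0 ?subrr.
  exact: trig_limitB.
- move=> F mF tF FA; rewrite preimage_bigcup setI_bigcupl.
  apply: approx_bigcup => //.
    by move=> n; apply: measurableI => //; exact: mp.
  move=> i j _ _ [z [[Fi _] [Fj _]]].
  by apply: (tF i j I I); exists (psi z).
- by rewrite -GE.
Qed.

Lemma rays_setI : setI_closed (@RGenInftyO.G R).
Proof.
move=> _ _ [u ->] [v ->]; exists (Num.min u v).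
by apply/seteqP; split => x /=; rewrite !in_itv /= lt_min; [move=> [-> ->]|move=> /andP[]].
Qed.

(** Rays only agree with sublevel sets of periodic functions inside the period
    cell, whose complement is negligible. *)
Lemma approx_set_cell (A B : set T2) : measurable A ->
  (forall z, cell alpha z -> A z <-> B z) -> approx_set B -> approx_set A.
Proof.
move=> mA AB BA; apply: trig_limit_ae BA _ => //.
  apply: (sqint_bounded (M := 1)); first exact: torus_finite.
    exact: measurable_indic.
  by move=> z; rewrite indicE; case: (_ \in _); rewrite ?normr1 ?normr0.
apply: ae_mono (ae_cell alpha0) => z /AB zAB; rewrite !indicE.
by congr (_%:R); congr nat_of_bool; apply/idP/idP; rewrite !inE => /zAB.
Qed.

Lemma approx_set_measurable (A : set T2) : measurable A -> approx_set A.
Proof.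
have mI u : measurable (`]-oo, u[ : set (measurableTypeR R)) by exact: measurable_itv.
have mR : @measurable _ (measurableTypeR R) = <<s @RGenInftyO.G R >>.
  exact: RGenInftyO.measurableE.
have mfst (B : set (measurableTypeR R)) : measurable B ->
    measurable (fst @^-1` B : set T2).
  by move=> mB; rewrite -[_ @^-1` _]setTI; exact: measurable_fst.
have msnd (B : set (measurableTypeR R)) : measurable B ->
    measurable (snd @^-1` B : set T2).
  by move=> mB; rewrite -[_ @^-1` _]setTI; exact: measurable_snd.
have S1 B v : measurable B ->
    approx_set (fst @^-1` B `&` (snd @^-1` `]-oo, v[)).
  apply: (approx_set_dynkin (T := measurableTypeR R) (psi := fst)
     measurable_fst (msnd _ (mI v)) mR rays_setI).
    apply: (approx_set_cell _ _ (approx_rays alpha0 (2 * pi / alpha) v)).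
      exact: msnd.
    move=> [x y] [/= xl yl]; rewrite !in_itv /= in xl *.
    by split => [yv|[]//]; split => //; case/andP: xl.
  move=> _ [u ->]; exact: approx_rays.
have S2 B : measurable B -> approx_set (fst @^-1` B).
  move=> mB; apply: (approx_set_cell _ _ (S1 B (2 * pi) mB)); first exact: mfst.
  move=> [x y] [/= xl yl]; rewrite !in_itv /= in yl *.
  by split => [yv|[]//]; split => //; case/andP: yl.
have S3 B C : measurable B -> measurable C ->
    approx_set (snd @^-1` C `&` (fst @^-1` B)).
  move=> mB; move: C.
  apply: (approx_set_dynkin (T := measurableTypeR R) (psi := snd)
     measurable_snd (mfst _ mB) mR rays_setI (S2 B mB)).
  by move=> _ [v ->]; rewrite setIC; exact: S1.
move=> mA; rewrite -[A]setIT.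
apply: (approx_set_dynkin (T := T2) (psi := id) (C := setT)
  (@measurable_id _ _ _) measurableT (measurable_prod_measurableType _ _) _
  approx_setT _ mA).
  move=> _ _ [A1 mA1 [B1 mB1 <-]] [A2 mA2 [B2 mB2 <-]].
  exists (A1 `&` A2); first exact: measurableI.
  by exists (B1 `&` B2); [exact: measurableI|rewrite setXI].
move=> _ [A1 mA1 [B1 mB1 <-]]; rewrite preimage_id setIT.
rewrite (_ : A1 `*` B1 = snd @^-1` B1 `&` (fst @^-1` A1)); first exact: S3.
by rewrite setIC.
Qed.

Import HBNNSimple.

(** Simple functions are dense, and indicators of measurable sets are limits of
    trigonometric polynomials. *)
Lemma trig_dense f : sqint mu f -> trig_limit alpha f.
Proof.
have pos g : sqint mu g -> (forall z, 0 <= g z) -> trig_limit alpha g.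
  move=> g2 g0; apply: trig_limit_closed => // e e0.
  have [h h2 gh] := nrm_approx_ex g2 g0 e0; exists h => //.
  rewrite (funext (fimfunEord h)).
  apply: trig_limit_sum => // i; apply: trig_limitZ => //.
  by apply: approx_set_measurable; exact: measurable_sfunP.
move=> f2.
have fE : f = fun z => (fun z => Num.max (f z) 0) z - (fun z => Num.max (- f z) 0) z.
  apply/funext => z /=.
  by case: (lerP (f z) 0) => h; case: (lerP (- f z) 0) => h'; lra.
have max2 g : sqint mu g -> sqint mu (fun z => Num.max (g z) 0).
  move=> g2; have mg := sqint_measurable g2.
  have mm : measurable_fun setT (fun z : T2 => Num.max (g z) 0).
    by apply: measurable_maxr => //; exact: measurable_cst.
  apply: sqintP => //; have /integrableP[_ +] := Lfun2_integrable_sqr g2.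
  apply: le_lt_trans; apply: ge0_le_integral => //.
  - by move=> z _; rewrite lee_fin sqr_ge0.
  - by apply/measurable_EFinP; exact: measurable_funX.
  - apply: measurableT_comp => //; apply/measurable_EFinP.
    by apply: measurable_funX.
  - move=> z _ /=; rewrite lee_fin ger0_norm ?sqr_ge0 //.
    by case: (leP (g z) 0) => h; rewrite // expr0n /= sqr_ge0.
rewrite fE; apply: trig_limitB => //; apply: pos.
- exact: max2.
- by move=> z; rewrite le_max lexx orbT.
- by apply: max2; exact: sqintN.
- by move=> z; rewrite le_max lexx orbT.
Qed.

End Density.

(** * Bessel and Parseval *)

Section OrthogonalFamily.
Context d (T : measurableType d) (R : realType) (mu : {measure set T -> \bar R}).
Context (I : finType) (e : I -> T -> R) (c : R).
Hypothesis e2 : forall i, sqint mu (e i).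
Hypothesis c0 : 0 < c.
Hypothesis ort : forall i j, dot mu (e i) (e j) = (i == j)%:R * c.

Definition orth_proj (f : T -> R) : T -> R :=
  fun z => \sum_(i : I) (dot mu f (e i) / c) * e i z.

Lemma orth_proj_sqint f : sqint mu (orth_proj f).
Proof. by apply: sqint_sum => i; exact: sqintZ. Qed.

Lemma orth_proj_dot f i : sqint mu f ->
  dot mu (fun z => f z - orth_proj f z) (e i) = 0.
Proof.
move=> f2; rewrite dotBl //; last exact: orth_proj_sqint.
rewrite dot_suml //; last by move=> j; exact: sqintZ.
rewrite (bigD1 i) //= dotZl // ort eqxx mul1r divfK ?gt_eqF //.
rewrite big1 ?addr0 ?subrr // => j ji.
by rewrite dotZl // ort (negbTE ji) mul0r mulr0.
Qed.

Lemma orth_proj_pythagoras f : sqint mu f ->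
  dot mu (fun z => f z - orth_proj f z) (fun z => f z - orth_proj f z) =
  dot mu f f - c^-1 * \sum_(i : I) dot mu f (e i) ^+ 2.
Proof.
move=> f2; have p2 := orth_proj_sqint f; have r2 := sqintB f2 p2.
rewrite dotBr //.
have -> : dot mu (fun z => f z - orth_proj f z) (orth_proj f) = 0.
  rewrite dotC dot_suml //; last by move=> j; exact: sqintZ.
  by rewrite big1 // => i _; rewrite dotZl // [dot mu (e i) _]dotC orth_proj_dot // mulr0.
rewrite subr0 dotBl //; congr (_ - _).
rewrite dot_suml //; last by move=> j; exact: sqintZ.
rewrite mulr_sumr; apply: eq_bigr => i _.
by rewrite dotZl // (dotC _ (e i) f) mulrAC -expr2 mulrC.
Qed.

Lemma bessel f : sqint mu f ->
  \sum_(i : I) dot mu f (e i) ^+ 2 <= c * dot mu f f.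
Proof.
move=> f2; have := dot_ge0 mu (fun z => f z - orth_proj f z).
rewrite orth_proj_pythagoras // subr_ge0 => h.
by rewrite -ler_pdivrMl.
Qed.

End OrthogonalFamily.

Section Parseval.
Context {R : realType} (alpha : R) (alpha0 : 0 < alpha).
Local Notation mu := (torus alpha).
Local Notation tmode := (tmode alpha).

Lemma tmode_sqint k j s : sqint mu (tmode k j s).
Proof. exact: wave_sqint. Qed.

(** For k + k' <> 0 one of the two terms of the product formula integrates to 0,
    which is why only positive x-frequencies are used below. *)
Lemma dot_tmode k j s k' j' s' : k + k' != 0 ->
  dot mu (tmode k j s) (tmode k' j' s') =
  ((k == k') && (j == j'))%:R * (cos (s - s') * (area alpha / 2)).
Proof.
move=> kk.
have -> : dot mu (tmode k j s) (tmode k' j' s') =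
    2^-1 * \int[mu]_z tmode (k - k') (j - j') (s - s') z +
    2^-1 * \int[mu]_z tmode (k + k') (j + j') (s + s') z.
  rewrite -!RintegralZl //; try exact: wave_integrable.
  rewrite -RintegralD //.
  - apply: eq_Rintegral => z _; rewrite /tmode waveM !intrD !intrN.
    by rewrite !mulrBl !mulrDl.
  - apply/Lfun1_integrable.
    have := wave_sqint ((k - k')%:~R * alpha) (j - j')%:~R (s - s') alpha0.
    move=> /(sqintZ 2^-1); apply: Lfun_subset12.
    by rewrite ge0_fin_numE // torus_finite.
  - apply/Lfun1_integrable.
    have := wave_sqint ((k + k')%:~R * alpha) (j + j')%:~R (s + s') alpha0.
    move=> /(sqintZ 2^-1); apply: Lfun_subset12.
    by rewrite ge0_fin_numE // torus_finite.
rewrite (tmode_integral0 _ alpha0 (k := k + k')) ?kk // mulr0 addr0.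
case: (boolP (_ && _)) => [/andP[/eqP -> /eqP ->]|]; last first.
  rewrite negb_and => h; rewrite tmode_integral0 // ?mul0r ?mulr0 //.
  by rewrite !subr_eq0.
rewrite !subrr mul1r.
have -> : \int[mu]_z tmode 0 0 (s - s') z = \int[mu]_z (cos (s - s')).
  by apply: eq_Rintegral => z _; rewrite /tmode /wave !mul0r !add0r.
rewrite Rintegral_cst // torus_setT //= -/(area alpha).
by rewrite mulrC mulrA.
Qed.

Definition phase (b : bool) : R := if b then pi / 2 else 0.

(** The modes k > 0, j in Z with the phases 0 and pi / 2: a mode with k < 0 is
    one of these up to sign of the frequencies and of the phase. *)
Definition mode_fam (K L : nat) (i : 'I_K * 'I_(L.*2.+1) * bool) : R * R -> R :=
  tmode (i.1.1.+1%:Z) (i.1.2%:Z - L%:Z) (phase i.2).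

Lemma mode_fam_ort K L (i j : 'I_K * 'I_(L.*2.+1) * bool) :
  dot mu (mode_fam i) (mode_fam j) = (i == j)%:R * (area alpha / 2).
Proof.
case: i => [[i1 i2] b]; case: j => [[j1 j2] b'].
rewrite dot_tmode /=; last by [].
have -> : (i1.+1%:Z == j1.+1%:Z) && (i2%:Z - L%:Z == j2%:Z - L%:Z) =
    ((i1, i2) == (j1, j2)).
  rewrite xpair_eqE -!val_eqE /=; congr (_ && _).
  by apply/eqP/eqP; lia.
rewrite [RHS](_ : _ = ((i1, i2) == (j1, j2))%:R * ((b == b')%:R * (area alpha / 2))).
  congr (_ * (_ * _)); rewrite /phase; case: b; case: b';
    rewrite ?subrr ?cos0 // ?subr0 ?sub0r ?cosN ?cos_pihalf //.
by rewrite [RHS]mulrA -natrM mulnb.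
Qed.

Definition modes (K L : nat) (f : R * R -> R) : R :=
  \sum_(k < K) (sumZ L (fun j => dot mu f (tmode k.+1%:Z j 0) ^+ 2) +
                sumZ L (fun j => dot mu f (tmode k.+1%:Z j (pi / 2)) ^+ 2)).

Lemma modes_fam K L f :
  modes K L f = \sum_(i : 'I_K * 'I_(L.*2.+1) * bool) dot mu f (mode_fam i) ^+ 2.
Proof.
rewrite -(pair_bigA _ (fun p b => dot mu f (mode_fam (p, b)) ^+ 2)) /=.
rewrite -(pair_bigA _ (fun k j => \sum_b dot mu f (mode_fam (k, j, b)) ^+ 2)) /=.
apply: eq_bigr => k _; rewrite -big_split; apply: eq_bigr => j _ /=.
by rewrite big_bool addrC.
Qed.

Lemma area2_gt0 : 0 < area alpha / 2.
Proof. by rewrite divr_gt0 // area_gt0. Qed.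

Lemma modes_bessel K L f : sqint mu f ->
  modes K L f <= area alpha / 2 * dot mu f f.
Proof.
move=> f2; rewrite modes_fam; apply: bessel => //.
- by move=> i; exact: tmode_sqint.
- exact: area2_gt0.
- exact: mode_fam_ort.
Qed.

(** A trigonometric polynomial has finitely many modes; K and L bound them. *)
Lemma trig_degree p : trig alpha p -> exists K L : nat, forall r, sqint mu r ->
  (forall k j s, `|k| <= K%:Z -> `|j| <= L%:Z -> dot mu r (tmode k j s) = 0) ->
  dot mu r p = 0.
Proof.
elim=> [a k j s|f g tf [K1 [L1 h1]] tg [K2 [L2 h2]]].
  exists (absz k), (absz j) => r r2 h.
  have t2 := tmode_sqint k j s; by rewrite dotZr // h ?mulr0 //; lia.
exists (maxn K1 K2), (maxn L1 L2) => r r2 h.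
rewrite dotDr //; try exact: trig_sqint.
by rewrite h1 ?h2 ?addr0 // => k j s kK jL; apply: h; lia.
Qed.

(** The difference r between f and its projection is orthogonal both to the
    projection and to a trigonometric polynomial p close to f, whence
    |r|^2 = <r, f - p> <= |r| |f - p|. *)
Lemma parseval f : sqint mu f -> (forall j s, dot mu f (tmode 0 j s) = 0) ->
  forall eps, 0 < eps -> exists K L,
    area alpha / 2 * dot mu f f <= modes K L f + eps.
Proof.
move=> f2 f0 eps eps0; have A0 := area2_gt0.
pose e1 := Num.min 1 (eps / (area alpha / 2)).
have e10 : 0 < e1 by rewrite lt_min ltr01 divr_gt0.
have [_ /(_ e1 e10) [p tp fp]] := trig_dense alpha0 f2.
have [K [L hKL]] := trig_degree tp; exists K, L.
pose r z := f z - orth_proj mu (@mode_fam K L) (area alpha / 2) f z.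
have fam2 i : sqint mu (@mode_fam K L i) by exact: tmode_sqint.
have q2 := orth_proj_sqint (area alpha / 2) fam2 f.
have r2 : sqint mu r by exact: sqintB.
have rE i : dot mu r (@mode_fam K L i) = 0.
  by apply: orth_proj_dot => //; exact: mode_fam_ort.
have p2 := trig_sqint alpha0 tp.
(* r is orthogonal to every mode of p: for k > 0 by the choice of the family,
   for k < 0 by parity, for k = 0 by hypothesis. *)
have rpos k j s : (0 < k)%N -> (k <= K)%N -> `|j| <= L%:Z ->
    dot mu r (tmode k%:Z j s) = 0.
  move=> k0 kK jL.
  have ik : (k.-1 < K)%N by lia.
  have ij : (absz (j + L%:Z)%R < L.*2.+1)%N by lia.
  have tE b : tmode k%:Z j (phase b) =
      @mode_fam K L (Ordinal ik, Ordinal ij, b).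
    by rewrite /mode_fam /= prednK //; congr tmode; lia.
  have -> : tmode k%:Z j s = fun z => cos s * tmode k%:Z j (phase false) z
      + sin s * tmode k%:Z j (phase true) z.
    by apply/funext => z; rewrite /tmode wave_phase.
  rewrite dotDr //; try by apply: sqintZ; exact: tmode_sqint.
  by rewrite !dotZr //; try exact: tmode_sqint; rewrite !tE !rE !mulr0 addr0.
have rall k j s : `|k| <= K%:Z -> `|j| <= L%:Z -> dot mu r (tmode k j s) = 0.
  move=> kK jL; have [k0|k0|->] := ltrgt0P k.
  - have -> : k = (absz k)%:Z by lia.
    by apply: rpos => //; lia.
  - have -> : tmode k j s = tmode (absz k)%:Z (- j) (- s).
      apply/funext => z; rewrite /tmode -[LHS]waveN.
      rewrite -mulNr -!intrN; congr (wave (_ * _) _ _ _); congr (_%:~R); lia.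
    by apply: rpos => //; lia.
  - rewrite dotBl //; last exact: tmode_sqint.
    rewrite f0 dot_suml //; try exact: tmode_sqint; last first.
      by move=> i; apply: sqintZ.
    rewrite big1 ?subr0 // => i _; rewrite dotZl //; last exact: tmode_sqint.
    by rewrite dot_tmode ?addr0 // mul0r mulr0.
have rp := hKL r r2 rall.
have rr : dot mu r r = dot mu r (fun z => f z - p z).
  rewrite [RHS]dotBr // rp subr0 {2}/r dotBr //.
  suff -> : dot mu r (orth_proj mu (@mode_fam K L) (area alpha / 2) f) = 0.
    by rewrite subr0.
  rewrite dotC dot_suml //; last by move=> i; apply: sqintZ.
  by rewrite big1 // => i _; rewrite dotZl // [dot mu (mode_fam _) _]dotC rE mulr0.
have nr : nrm mu r <= e1.
  apply: le_trans fp; have := cauchy_schwarz r2 (sqintB f2 p2).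
  rewrite -rr -nrm_sqr // => /(le_trans (ler_norm _)).
  have [->|n0] := eqVneq (nrm mu r) 0; first by rewrite nrm_ge0.
  have n1 : 0 < nrm mu r by rewrite lt_def n0 nrm_ge0.
  by rewrite expr2 ler_pM2l.
have : dot mu r r <= e1.
  rewrite -nrm_sqr //; have n0 := nrm_ge0 mu r.
  have e11 : e1 <= 1 by rewrite /e1 ge_min lexx.
  by nra.
rewrite /r orth_proj_pythagoras //; last exact: mode_fam_ort.
rewrite -modes_fam => h.
have e12 : area alpha / 2 * e1 <= eps.
  rewrite mulrC -ler_pdivlMr //.
  by rewrite /e1 ge_min lexx orbT.
have := ler_wpM2l (ltW A0) h; rewrite mulrBr mulrA mulfV ?gt_eqF // mul1r.
by lra.
Qed.

End Parseval.

(** * Fourier modes of a solution *)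

Section SolutionModes.
Context {R : realType} (alpha : R) (alpha0 : 0 < alpha).
Local Notation mu := (torus alpha).
Local Notation tmode := (tmode alpha).

Lemma cos_period_int (k : int) (x : R) : cos (x + k%:~R * (2 * pi)) = cos x.
Proof.
rewrite -[x](subrK (pi / 2)) addrAC !cosDpihalf.
by rewrite sin_period_int.
Qed.

Lemma tmode_test k j s : test_function alpha (tmode k j s).
Proof.
split.
  have := wave_smooth 1 (k%:~R * alpha) j%:~R s.
  by rewrite (_ : (fun z => _) = tmode k j s) //; apply/funext => z; rewrite mul1r.
move=> x y; rewrite /tmode /wave /=; split.
  rewrite -[RHS](cos_period_int k); congr cos.
  by field; rewrite gt_eqF.
by rewrite -[RHS](cos_period_int j); congr cos; ring.
Qed.

Lemma dx_wave c a b s : dx (fun z : R * R => c * wave a b s z) =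
  fun z => c * a * wave a b (s + pi / 2) z.
Proof. by rewrite /dx derive_wave /= mulr1 mulr0 addr0. Qed.

Lemma dy_wave c a b s : dy (fun z : R * R => c * wave a b s z) =
  fun z => c * b * wave a b (s + pi / 2) z.
Proof. by rewrite /dy derive_wave /= mulr1 mulr0 add0r. Qed.

Lemma wave_shift2 (a b s : R) z : wave a b (s + pi / 2 + pi / 2) z = - wave a b s z.
Proof.
rewrite /wave addrA cosDpihalf addrA sinD cos_pihalf sin_pihalf.
by rewrite mulr0 mulr1 add0r.
Qed.

Lemma tmodeE k j s : tmode k j s = fun z => 1 * wave (k%:~R * alpha) j%:~R s z.
Proof. by apply/funext => z; rewrite mul1r. Qed.

Lemma laplacian_tmode k j s : laplacian (tmode k j s) =
  fun z => - dsq (k%:~R * alpha) j * tmode k j s z.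
Proof.
rewrite /laplacian tmodeE !dx_wave !dy_wave; apply/funext => z /=.
by rewrite !wave_shift2 /dsq; ring.
Qed.

(** Multiplication by sin y couples j to j + 1 and j - 1, with real coefficients
    and the same phase: this keeps the system for each phase real and closed. *)
Lemma transport_tmode k j s : (fun z : R * R => sin z.2 * dx (tmode k j s) z) =
  fun z => k%:~R * alpha / 2 * (tmode k (j + 1) s z - tmode k (j - 1) s z).
Proof.
rewrite tmodeE dx_wave; apply/funext => z /=.
rewrite wave_shift /tmode /wave intr_succ intr_pred.
set A := _ + s; set kz := k%:~R * alpha * z.1.
have -> : kz + (j%:~R + 1) * z.2 + s = A + z.2 by rewrite /A /kz; ring.
have -> : kz + (j%:~R - 1) * z.2 + s = A - z.2 by rewrite /A /kz; ring.
suff h (B y : R) : cos (B + y) - cos (B - y) = - (2 * sin B * sin y).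
  by rewrite h; lra.
by rewrite cosD cosB; lra.
Qed.

(** The equation for psi is tested against an eigenfunction of the Laplacian. *)
Lemma ip_psi k j s f psi : sqint mu f -> inv_laplacian alpha f psi ->
  dsq (k%:~R * alpha) j != 0 ->
  dot mu psi (tmode k j s) = - (dsq (k%:~R * alpha) j)^-1 * dot mu f (tmode k j s).
Proof.
move=> f2 [psi2 _ /(_ _ (tmode_test k j s)) h] d0.
have : dot mu psi (laplacian (tmode k j s)) = dot mu f (tmode k j s) := h.
rewrite laplacian_tmode dotZr //; last exact: tmode_sqint.
by move=> <-; rewrite mulrA mulrNN mulVf // mul1r.
Qed.

Lemma is_derive_mode (nu : R) omega (k j : int) (s t : R) : 1 <= k%:~R * alpha ->
  solution alpha nu omega -> 0 < t ->
  is_derive t (1 : R) (fun t => dot mu (omega t) (tmode k j s))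
    (mode_rhs (k%:~R * alpha) nu (expR (- (nu * t)) * (k%:~R * alpha / 2))
      (fun j => dot mu (omega t) (tmode k j s)) j).
Proof.
move=> m1 [om2 _ [psi [ipsi der]]] t0.
have t0' := ltW t0.
have w2 : sqint mu (omega t) := om2 t t0'.
have [psi2 _ _] := ipsi t t0'.
have ts j' := tmode_sqint alpha0 k j' s.
have := der _ (tmode_test k j s) t t0.
have E j' : dot mu (omega t \+ psi t) (tmode k j' s) =
    lam (k%:~R * alpha) j' * dot mu (omega t) (tmode k j' s).
  have d0 : dsq (k%:~R * alpha) j' != 0 by rewrite gt_eqF // dsq_gt0.
  rewrite dotDl // (@ip_psi k j' s (omega t) (psi t) w2 (ipsi t t0') d0).
  by rewrite /lam; ring.
rewrite transport_tmode.
have -> : ip alpha (omega t \+ psi t) (fun z => k%:~R * alpha / 2 *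
     (tmode k (j + 1) s z - tmode k (j - 1) s z)) =
   dot mu (omega t \+ psi t) (fun z => k%:~R * alpha / 2 *
     (tmode k (j + 1) s z - tmode k (j - 1) s z)) by [].
have wp2 : sqint mu (omega t \+ psi t) by exact: sqintD.
rewrite dotZr ?dotBr //; last by apply: sqintB.
rewrite !E laplacian_tmode.
have -> : ip alpha (omega t) (fun z => - dsq (k%:~R * alpha) j * tmode k j s z) =
  - dsq (k%:~R * alpha) j * dot mu (omega t) (tmode k j s) by rewrite -dotZr.
move=> h; apply: is_derive_eq h _.
by rewrite /mode_rhs; ring.
Qed.

Lemma is_derive_shear_mode (nu : R) omega (j : int) (s t : R) :
  solution alpha nu omega -> 0 < t ->
  is_derive t (1 : R) (fun t => dot mu (omega t) (tmode 0 j s))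
    (- (nu * dsq 0 j) * dot mu (omega t) (tmode 0 j s)).
Proof.
move=> [om2 _ [psi [ipsi der]]] t0.
have t0' := ltW t0.
have w2 : sqint mu (omega t) := om2 t t0'.
have ts := tmode_sqint alpha0 0 j s.
have := der _ (tmode_test 0 j s) t t0.
rewrite transport_tmode laplacian_tmode !mul0r.
have -> : ip alpha (omega t) (fun z => - dsq 0 j * tmode 0 j s z) =
  - dsq 0 j * dot mu (omega t) (tmode 0 j s) by rewrite -dotZr.
have -> : ip alpha (omega t \+ psi t) (fun z => 0 *
     (tmode 0 (j + 1) s z - tmode 0 (j - 1) s z)) = 0.
  rewrite /ip (_ : (fun z => _) = fun=> 0).
    by rewrite Rintegral_cst // mul0r.
  by apply/funext => z; rewrite mul0r mulr0.
move=> h; apply: is_derive_eq h _.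
by rewrite mulr0 addr0; ring.
Qed.

(** Quantities that are Lipschitz for the L^2 distance inherit the continuity of
    the solution. *)
Lemma continuous_lip (nu : R) omega (g : R -> R) (C T : R) : solution alpha nu omega ->
  (forall t t0, 0 <= t -> 0 <= t0 ->
     `|g t - g t0| <= C * nrm mu (fun z => omega t z - omega t0 z)) ->
  {within `[0, T], continuous g}.
Proof.
move=> [om2 omc _] gC; apply/subspace_continuousP => t0 /=.
rewrite in_itv /= => /andP[t00 _].
have h := omc t0 t00.
have hC : C * nrm mu (fun z => omega t z - omega t0 z)
    @[t --> within [set t : R | 0 <= t] (nbhs t0)] --> (0 : R).
  rewrite -[X in _ --> X](mulr0 C); apply: cvgM; first exact: cvg_cst.
  exact: h.
have lim : g t @[t --> within [set t : R | 0 <= t] (nbhs t0)] --> g t0.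
  apply/subr_cvg0; apply/norm_cvg0P.
  apply: (squeeze_cvgr _ (cvg_cst (0 : R)) hC).
  near=> t; rewrite normr_ge0 /=; apply: gC => //.
  by near: t; exact: withinT.
apply: cvg_trans lim; apply: cvg_fmap2; apply: within_subset => t /=.
by rewrite in_itv /= => /andP[].
Unshelve. all: by end_near. Qed.

Lemma continuous_mode (nu : R) omega (k j : int) (s T : R) : solution alpha nu omega ->
  {within `[0, T], continuous (fun t => dot mu (omega t) (tmode k j s))}.
Proof.
move=> sol; have [om2 _ _] := sol.
apply: (continuous_lip (C := nrm mu (tmode k j s)) sol) => t t0 tp t0p.
have ts := tmode_sqint alpha0 k j s.
rewrite -dotBl //; try exact: om2.
rewrite mulrC; apply: cauchy_schwarz => //; apply: sqintB; exact: om2.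
Qed.

Lemma bounded_solution (nu : R) omega (T : R) : 0 < T -> solution alpha nu omega ->
  exists B, forall t, 0 <= t <= T -> dot mu (omega t) (omega t) <= B.
Proof.
move=> T0 sol; have [om2 _ _] := sol.
have c : {within `[0, T], continuous (fun t => nrm mu (omega t))}.
  apply: (continuous_lip (C := 1) sol) => t t0 tp t0p; rewrite mul1r.
  have h1 : sqint mu (omega t) by exact: om2.
  have h2 : sqint mu (omega t0) by exact: om2.
  have a := nrm_le_sub h1 h2; have b := nrm_le_sub h2 h1.
  have E : nrm mu (fun z => omega t0 z - omega t z) =
      nrm mu (fun z => omega t z - omega t0 z).
    rewrite -(nrmN (sqintB h1 h2)); congr nrm.
    by apply/funext => z; rewrite opprB.
  by rewrite ler_norml; apply/andP; split; lra.
have [tm _ hm] := EVT_max (ltW T0) c.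
exists (nrm mu (omega tm) ^+ 2) => t tT.
rewrite -nrm_sqr; last by apply: om2; case/andP: tT.
have := hm t; rewrite in_itv /= => /(_ tT) h.
by rewrite ler_pXn2r ?nnegrE ?nrm_ge0.
Qed.

Lemma mode_solution_of (nu : R) omega (k : nat) (s T : R) : 1 <= k.+1%:Z%:~R * alpha ->
  0 < T -> solution alpha nu omega ->
  exists B, mode_solution (k.+1%:Z%:~R * alpha) nu T B
    (fun t j => dot mu (omega t) (tmode k.+1%:Z j s)).
Proof.
move=> m1 T0 sol; have [om2 _ _] := sol.
have [B hB] := bounded_solution T0 sol.
exists (area alpha * B); split.
- by move=> j; exact: continuous_mode sol.
- by move=> t j /andP[t0 _]; exact: is_derive_mode.
move=> t L tT; have w2 : sqint mu (omega t) by apply: om2; case/andP: tT.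
have ss (s' : R) : sumZ L (fun j => dot mu (omega t) (tmode k.+1%:Z j s') ^+ 2) >= 0.
  by apply: sumZ_ge0 => j; exact: sqr_ge0.
have mb : sumZ L (fun j => dot mu (omega t) (tmode k.+1%:Z j 0) ^+ 2) +
   sumZ L (fun j => dot mu (omega t) (tmode k.+1%:Z j (pi / 2)) ^+ 2) <=
   area alpha / 2 * B.
  apply: (le_trans (y := area alpha / 2 * dot mu (omega t) (omega t))); last first.
    by rewrite ler_wpM2l ?(ltW (area2_gt0 alpha0)) // hB.
  apply: le_trans (modes_bessel alpha0 k.+1 L w2).
  rewrite /modes big_ord_recr /= lerDr.
  by apply: sumr_ge0 => i _; rewrite addr_ge0 // sumZ_ge0 // => j; exact: sqr_ge0.
have wp j : dot mu (omega t) (tmode k.+1%:Z j s) ^+ 2 <=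
   2 * (dot mu (omega t) (tmode k.+1%:Z j 0) ^+ 2 +
        dot mu (omega t) (tmode k.+1%:Z j (pi / 2)) ^+ 2).
  have t1 := tmode_sqint alpha0 k.+1%:Z j 0.
  have t2 := tmode_sqint alpha0 k.+1%:Z j (pi / 2).
  have -> : tmode k.+1%:Z j s = fun z => cos s * tmode k.+1%:Z j 0 z
      + sin s * tmode k.+1%:Z j (pi / 2) z.
    by apply/funext => z; rewrite /tmode wave_phase.
  rewrite dotDr ?dotZr //; try exact: sqintZ.
  set a := dot _ _ _; set b := dot _ _ _.
  have := cos2Dsin2 s; set x := cos s; set y := sin s => xy.
  have := sqr_ge0 (x * b - y * a); have := sqr_ge0 a; have := sqr_ge0 b.
  have : (x * a + y * b) ^+ 2 + (x * b - y * a) ^+ 2 =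
     (x ^+ 2 + y ^+ 2) * (a ^+ 2 + b ^+ 2) by ring.
  rewrite xy mul1r => *; lra.
apply: (le_trans (sumZ_le (fun j _ => wp j))).
rewrite sumZZ sumZD; move: mb; lra.
Qed.

End SolutionModes.

(** * Shear modes *)

Section ShearModes.
Context {R : realType} (alpha : R) (alpha0 : 0 < alpha).
Local Notation mu := (torus alpha).
Local Notation tmode := (tmode alpha).
Local Notation T2 := (measurableTypeR R * measurableTypeR R)%type.

Lemma separated_sqint (a : R -> R) (kap s : R) :
  a \in Lfun (circle (2 * pi)) 2%:E ->
  sqint mu (fun z => a z.2 * cos (kap * z.1 + s)).
Proof.
move=> a2; have p0 : 0 < 2 * pi :> R by rewrite mulr_gt0 ?pi_gt0.
have l0 : 0 < 2 * pi / alpha by rewrite divr_gt0.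
have ma : measurable_fun setT (a : measurableTypeR R -> R) by exact: sqint_measurable a2.
have ma2 : measurable_fun setT (fun z : T2 => a z.2).
  by apply: (measurableT_comp ma); exact: measurable_snd.
have mc : measurable_fun setT (fun z : T2 => cos (kap * z.1 + s)).
  have := wave_measurable kap 0 s; rewrite /wave.
  by under eq_fun do rewrite mul0r addr0.
have mf : measurable_fun setT (fun z : T2 => a z.2 * cos (kap * z.1 + s)).
  exact: measurable_funM.
apply: sqintP => //.
have /integrableP[_ ai] := Lfun2_integrable_sqr a2.
apply: (@le_lt_trans _ _ (\int[mu]_z ((a z.2) ^+ 2)%:E)%E).
  apply: ge0_le_integral => //.
  - by move=> z _; rewrite lee_fin sqr_ge0.
  - by apply/measurable_EFinP; exact: measurable_funX.
  - by apply/measurable_EFinP; exact: measurable_funX.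
  - move=> z _; rewrite lee_fin exprMn ler_piMr ?sqr_ge0 //.
have ma22 : measurable_fun setT (fun z : T2 => ((a z.2) ^+ 2)%:E).
  by apply/measurable_EFinP; exact: measurable_funX.
have a22 (z : T2) : (0 <= ((a z.2) ^+ 2)%:E)%E by rewrite lee_fin sqr_ge0.
have := @fubini_tonelli1 _ _ _ _ R (circle (2 * pi / alpha)) (circle (2 * pi)) _ ma22 a22.
rewrite /torus => ->; rewrite /fubini_F /=.
rewrite integral_cst //= circle_setT //.
rewrite muleC; apply: lte_mul_pinfty => //; first by rewrite lee_fin ltW.
apply: le_lt_trans ai; rewrite le_eqVlt; apply/orP; left; apply/eqP.
by apply: eq_integral => y _ /=; rewrite ger0_norm ?sqr_ge0.
Qed.

Lemma separated_dot (a : R -> R) (k : nat) (s s' : R) j :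
  a \in Lfun (circle (2 * pi)) 2%:E -> (0 < k)%N ->
  dot mu (fun z => a z.2 * cos (k%:R * alpha * z.1 + s)) (tmode 0 j s') = 0.
Proof.
move=> a2 k0; have p0 : 0 < 2 * pi :> R by rewrite mulr_gt0 ?pi_gt0.
have l0 : 0 < 2 * pi / alpha by rewrite divr_gt0.
have fi := sqint_integrable (separated_sqint (k%:R * alpha) s a2)
  (tmode_sqint alpha0 0 j s').
rewrite /dot /Rintegral.
have := @integral21_prod_meas1 _ _ _ _ R (circle (2 * pi / alpha))
    (circle (2 * pi)) _ fi.
rewrite /torus /= => <-.
rewrite (_ : (\int[_]_x _)%E = 0%E) //.
rewrite (eq_integral (fun=> 0%E)) ?integral0 // => y _.
rewrite /fubini_G /= /tmode /wave /=.
transitivity (\int[circle (2 * pi / alpha)]_x ((a y * cos (j%:~R * y + s'))%:E *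
   (cos (k%:R * alpha * x + s))%:E))%E.
  apply: eq_integral => x _; rewrite -EFinM; congr EFin.
  by rewrite !mul0r add0r mulrAC.
rewrite integralZl //.
  rewrite circle_cos ?mule0 //.
    by rewrite mulf_neq0 ?gt_eqF // ltr0n.
  rewrite addrC (_ : k%:R * alpha * (2 * pi / alpha) = k%:Z%:~R * (2 * pi)).
    exact: sin_period_int.
  by rewrite -[k%:Z%:~R]/(k%:R); field; rewrite gt_eqF.
apply: (le_integrable measurableT _ _ (finite_measure_integrable_cst _ 1 measurableT)).
  apply/measurable_EFinP; apply: continuous_measurable_fun.
  exact: continuous_cos_affine.
by move=> x _ /=; rewrite lee_fin normr1 ler_norml cos_geN1 cos_le1.
Qed.

(** Each partial sum is orthogonal to the functions of y, and the remainder tends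
    to 0 in L^2. *)
Lemma nonshear_mode0 f j s : nonshear alpha f -> dot mu f (tmode 0 j s) = 0.
Proof.
move=> [f2 [a [b [ab lim]]]].
have {}f2 : sqint mu f := f2.
have ts := tmode_sqint alpha0 0 j s.
pose S N z : R := \sum_(1 <= k < N.+1) (a k z.2 * cos (k%:R * alpha * z.1) +
                            b k z.2 * sin (k%:R * alpha * z.1)).
have termE k : (fun z : R * R => a k z.2 * cos (k%:R * alpha * z.1) +
      b k z.2 * sin (k%:R * alpha * z.1)) =
    fun z => a k z.2 * cos (k%:R * alpha * z.1 + 0) +
      b k z.2 * cos (k%:R * alpha * z.1 + (- (pi / 2))).
  apply/funext => z; rewrite addr0; congr (_ + _ * _).
  by rewrite cosB cos_pihalf sin_pihalf mulr0 mulr1 add0r.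
have t2 k : sqint mu (fun z => a k z.2 * cos (k%:R * alpha * z.1) +
                            b k z.2 * sin (k%:R * alpha * z.1)).
  have [a2 b2] := ab k; rewrite termE.
  by apply: sqintD; exact: separated_sqint.
have S2 N : sqint mu (S N) by exact: sqint_sum.
have S0 N : dot mu (S N) (tmode 0 j s) = 0.
  rewrite dot_suml // big_nat big1 // => k /andP[k0 _].
  have [a2 b2] := ab k; rewrite termE dotDl //; try exact: separated_sqint.
  by rewrite !separated_dot // addr0.
have lim' : nrm mu (fun z => f z - S N z) @[N --> \oo] --> (0 : R) := lim.
apply/eqP; rewrite -normr_le0; apply/ler_addgt0Pr => e e0; rewrite add0r.
have C0 : 0 < nrm mu (tmode 0 j s) + 1 by rewrite ltr_wpDl // nrm_ge0.
have /cvgrPdist_lt /(_ _ (divr_gt0 e0 C0)) [N _ /(_ N (leqnn N))] := lim'.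
rewrite /= sub0r normrN ger0_norm ?nrm_ge0 // ltr_pdivlMr // => h.
have := cauchy_schwarz (sqintB f2 (S2 N)) ts.
rewrite dotBl // S0 subr0 => /le_trans; apply.
by apply: le_trans (ltW h); rewrite ler_wpM2l ?nrm_ge0 // lerDl.
Qed.

(** The transport term vanishes against functions of y, so that these modes solve
    the heat equation; their squares are nonincreasing and start from 0. *)
Lemma shear_mode_zero (nu : R) omega (j : int) (s T : R) : 0 < nu -> 0 < T ->
  solution alpha nu omega -> nonshear alpha (omega 0) ->
  dot mu (omega T) (tmode 0 j s) = 0.
Proof.
move=> nu0 T0 sol ns; pose c t := dot mu (omega t) (tmode 0 j s).
have cc : {within `[0, T], continuous c} by exact: continuous_mode sol.
have dc (t : R) : 0 < t -> is_derive t (1 : R) c (- (nu * dsq 0 j) * c t).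
  by move=> t0; exact: is_derive_shear_mode.
have c2 : {within `[0, T], continuous (c * c)}.
  by move=> x; exact: (cvgM (cc x) (cc x)).
have d2 (t : R) : 0 < t < T -> is_derive t (1 : R) (c * c)
   (2 * (- (nu * dsq 0 j)) * c t ^+ 2).
  move=> /andP[t0 _]; apply: is_derive_eq (is_deriveM (dc t t0) (dc t t0)) _.
  by rewrite /GRing.scale /=; ring.
have d0 : 0 <= dsq 0 j :> R by rewrite /dsq addr_ge0 ?sqr_ge0.
have dis (t : R) : 0 < t < T ->
    2 * (- (nu * dsq 0 j)) * c t ^+ 2 <= - 0 * (c * c) t + 0.
  move=> _; rewrite oppr0 mul0r addr0 mulrN mulNr oppr_le0.
  by apply: mulr_ge0; [rewrite mulr_ge0 // mulr_ge0 // ltW|exact: sqr_ge0].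
have := gronwall T0 (lexx 0) (lexx 0) c2 d2 dis.
rewrite !mul0r oppr0 expR0 mul1r addr0.
have -> : (c * c) 0 = 0 by rewrite /GRing.mul /= /c (nonshear_mode0 _ _ ns) mul0r.
have -> : (c * c) T = c T ^+ 2 by rewrite expr2.
move=> cT; apply/eqP; rewrite -sqrf_eq0 eq_le cT sqr_ge0 //.
Qed.

End ShearModes.

(** * Decay of all modes *)

Section Decay.
Context {R : realType} (alpha : R) (alpha1 : 1 <= alpha).
Local Notation mu := (torus alpha).
Local Notation tmode := (tmode alpha).
Let alpha0 : 0 < alpha := lt_le_trans ltr01 alpha1.

(** Indexed so that k ranges over the wave numbers k + 1 > 0. *)
Definition freq (k : nat) : R := k.+1%:Z%:~R * alpha.

Lemma freq_ge1 k : 1 <= freq k.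
Proof.
rewrite /freq -[leLHS]mulr1; apply: ler_pM => //.
by rewrite -[k.+1%:Z%:~R]/(k.+1%:R) ler1n.
Qed.

Definition mode_decays (tau delta nu : R) (k : nat) : Prop :=
  forall (c : R -> int -> R) B, mode_solution (freq k) nu (tau / nu) B c ->
  forall n eps, 0 < eps -> exists L0, forall L, (L0 <= L)%N ->
  sumZ n (fun j => lam (freq k) j * c (tau / nu) j ^+ 2) <=
   delta * sumZ L (fun j => lam (freq k) j * c 0 j ^+ 2) + eps.

(** The finitely many small k have their own bound on nu, from mode_decay; the
    others satisfy mode_decay_large, which holds for all nu. *)
Lemma all_modes_decay (lmin tau delta : R) : 0 < lmin ->
  (forall k j, lam (freq k) j = 0 \/ lmin <= lam (freq k) j) ->
  0 < tau -> 0 < delta -> exists2 nu0, 0 < nu0 &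
  forall nu, 0 < nu < nu0 -> forall k, mode_decays tau delta nu k.
Proof.
move=> lmin0 lamP tau0 de0.
have [K0 hK0] := ex_natge (1 / (tau * delta)).
have [nu0 nu00 hnu] : exists2 nu0, 0 < nu0 & forall nu, 0 < nu < nu0 ->
    forall k, (k < K0)%N -> mode_decays tau delta nu k.
  elim: (K0) => [|K [nu1 nu10 IH]]; first by exists 1.
  have [nu2 nu20 h2] := mode_decay (freq_ge1 K) lmin0 (lamP K) tau0 de0.
  exists (Num.min nu1 nu2); first by rewrite lt_min nu10.
  move=> nu /andP[n0]; rewrite lt_min => /andP[n1 n2] k.
  rewrite ltnS leq_eqVlt => /orP[/eqP ->|kK].
    by apply: h2; rewrite n0.
  by apply: IH; rewrite ?n0.
exists nu0 => // nu nun k; have [kK|Kk] := ltnP k K0; first exact: hnu.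
move=> c B sol; apply: mode_decay_large sol => //.
- exact: freq_ge1.
- by case/andP: nun.
have f1 := freq_ge1 k.
have kf : K0%:R <= freq k.
  rewrite /freq -[K0%:R]mulr1; apply: ler_pM => //.
  by rewrite -[k.+1%:Z%:~R]/(k.+1%:R) ler_nat; apply: leq_trans Kk _.
have td : 0 < tau * delta by rewrite mulr_gt0.
move: hK0; rewrite ler_pdivrMr // => h.
have : K0%:R * (tau * delta) <= freq k ^+ 2 * (tau * delta).
  rewrite ler_wpM2r ?(ltW td) //; apply: (le_trans kf).
  by rewrite expr2 ler_peMl // (le_trans _ f1).
by move=> h2; rewrite -mulrA; exact: (le_trans h h2).
Qed.

(** The window at time 0 is taken common to finitely many k, so that Bessel
    applies to all of them at once. *)
Lemma finitely_many_modes (tau delta nu : R) omega : 0 < tau -> 0 < nu ->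
  solution alpha nu omega -> (forall k, mode_decays tau delta nu k) ->
  0 < delta ->
  forall (K L : nat) eps, 0 < eps -> exists L', forall k b, (k < K)%N ->
  sumZ L (fun j => lam (freq k) j *
     dot mu (omega (tau / nu)) (tmode k.+1%:Z j (phase b)) ^+ 2) <=
  delta * sumZ L' (fun j => lam (freq k) j *
     dot mu (omega 0) (tmode k.+1%:Z j (phase b)) ^+ 2) + eps.
Proof.
move=> tau0 nu0 sol dec de0 K L eps eps0.
have T0 : 0 < tau / nu by rewrite divr_gt0.
have pos k b j : 0 <= lam (freq k) j *
    dot mu (omega 0) (tmode k.+1%:Z j (phase b)) ^+ 2.
  by rewrite mulr_ge0 ?sqr_ge0 // lam_ge0 // freq_ge1.
elim: K => [|K [L' IH]]; first by exists 0%N.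
have ex b : exists L0, forall l, (L0 <= l)%N ->
  sumZ L (fun j => lam (freq K) j *
     dot mu (omega (tau / nu)) (tmode K.+1%:Z j (phase b)) ^+ 2) <=
  delta * sumZ l (fun j => lam (freq K) j *
     dot mu (omega 0) (tmode K.+1%:Z j (phase b)) ^+ 2) + eps.
  have [B hB] := mode_solution_of alpha0 (phase b) (freq_ge1 K) T0 sol.
  exact: dec K _ B hB L eps eps0.
have [L1 h1] := ex true; have [L2 h2] := ex false.
exists (maxn L' (maxn L1 L2)) => k b; rewrite ltnS leq_eqVlt => /orP[/eqP ->|kK].
  by case: b; [apply: h1|apply: h2]; lia.
apply: (le_trans (IH k b kK)); rewrite lerD2r ler_wpM2l ?(ltW de0) //.
by apply: sumZ_mono => //; lia.
Qed.

(** g is f without the modes on which the symbol vanishes. *)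
Definition reduced (f g : R * R -> R) : Prop :=
  forall (k : nat) (j : int) (s : R),
   dot mu g (tmode k.+1%:Z j s) =
   if lam (freq k) j == 0 then 0 else dot mu f (tmode k.+1%:Z j s).

(** Parseval at the final time and Bessel at the initial one turn the decay of
    the energies, which weigh the modes by lam in [lmin, 1], into that of the norm. *)
Lemma reduced_decay (lmin tau delta nu : R) omega g0 gT : 0 < lmin ->
  (forall k j, lam (freq k) j = 0 \/ lmin <= lam (freq k) j) ->
  0 < tau -> 0 < delta -> 0 < nu ->
  (forall k, mode_decays tau (lmin * delta) nu k) ->
  solution alpha nu omega ->
  sqint mu g0 -> sqint mu gT ->
  reduced (omega 0) g0 -> reduced (omega (tau / nu)) gT ->
  (forall j s, dot mu gT (tmode 0 j s) = 0) ->
  dot mu gT gT <= delta * dot mu g0 g0.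
Proof.
move=> lmin0 lamP tau0 de0 nu0 dec sol g02 gT2 r0 rT s0.
have A0 := area2_gt0 alpha0.
rewrite -(ler_pM2l A0); apply/ler_addgt0Pr => e e0.
have e20 : 0 < e / 2 by rewrite divr_gt0.
have [K [L hKL]] := parseval alpha0 gT2 s0 e20.
pose e1 := e / 2 * lmin / (2 * K.+1%:R).
have e10 : 0 < e1.
  by rewrite divr_gt0 ?mulr_gt0 // ltr0n.
have ld0 : 0 < lmin * delta by rewrite mulr_gt0.
have [L' hL'] := finitely_many_modes tau0 nu0 sol dec ld0 K L e10.
have one k b : (k < K)%N ->
   lmin * sumZ L (fun j => dot mu gT (tmode k.+1%:Z j (phase b)) ^+ 2) <=
   lmin * delta * sumZ L' (fun j => dot mu g0 (tmode k.+1%:Z j (phase b)) ^+ 2) + e1.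
  move=> kK; apply: le_trans (le_trans (hL' k b kK) _).
    rewrite -sumZZ; apply: sumZ_le => j _; rewrite rT.
    case: (lamP k j) => [->|ll]; first by rewrite eqxx expr0n /= mulr0 mul0r.
    by rewrite gt_eqF ?(lt_le_trans lmin0 ll) // ler_wpM2r ?sqr_ge0.
  rewrite lerD2r ler_wpM2l ?(ltW ld0) //; apply: sumZ_le => j _; rewrite r0.
  case: eqP => [->|_]; first by rewrite mul0r sqr_ge0.
  by rewrite ler_piMl ?sqr_ge0 // lam_le1 // freq_ge1.
have sum : lmin * modes alpha K L gT <=
    lmin * delta * modes alpha K L' g0 + K%:R * (2 * e1).
  have -> : K%:R * (2 * e1) = \sum_(k < K) 2 * e1.
    by rewrite sumr_const card_ord mulr_natl.
  rewrite /modes !mulr_sumr -big_split /=; apply: ler_sum => k _.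
  have := one k true (ltn_ord k); have := one k false (ltn_ord k).
  by rewrite /phase; lra.
have bes := modes_bessel alpha0 K L' g02.
have h1 : lmin * (area alpha / 2 * dot mu gT gT) <=
   lmin * (delta * (area alpha / 2 * dot mu g0 g0) + e).
  have h2 : K%:R * (2 * e1) <= lmin * (e / 2).
    rewrite /e1 (_ : K%:R * _ = lmin * (e / 2) * (K%:R / K.+1%:R)); last first.
      by field; rewrite ?natr1 ?nat1r ?pnatr_eq0 // ?gt_eqF // ?ltr_wpDr ?ltr_wpDl.
    rewrite ler_piMr //; first by rewrite mulr_ge0 // ltW.
    by rewrite ler_pdivrMr ?ltr0n // mul1r ler_nat.
  have := ler_wpM2l (ltW lmin0) hKL; have := ler_wpM2l (ltW ld0) bes.
  by lra.
by move: h1; rewrite ler_pM2l // => h1; apply: le_trans h1 _; lra.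
Qed.

End Decay.

Section Projection.
Context {R : realType}.

Lemma W1_tmode (a b : R) : (fun z : R * R => a * cos z.1 + b * sin z.1) =
  fun z => a * tmode 1 1 0 0 z + (- b) * tmode 1 1 0 (pi / 2) z.
Proof.
apply/funext => z; rewrite /tmode /wave mulr1 mul1r mul0r !addr0 cosDpihalf.
by rewrite mulrNN.
Qed.

(** P1 is a choice among the projections; existence gives access to its defining
    property. *)
Lemma P1_orth (f : R * R -> R) : sqint (torus 1) f ->
  is_orth_proj 1 W1 f (P1 1 f).
Proof.
move=> f2; have A0 := area2_gt0 (@ltr01 R).
have t1 := tmode_sqint (@ltr01 R) 1 0 0.
have t2 := tmode_sqint (@ltr01 R) 1 0 (pi / 2).
pose a := dot (torus 1) f (tmode 1 1 0 0) / (area 1 / 2).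
pose b := - (dot (torus 1) f (tmode 1 1 0 (pi / 2)) / (area 1 / 2)).
apply: (@getPex _ (is_orth_proj 1 W1 f)).
exists (fun z => a * cos z.1 + b * sin z.1); split; first by exists a, b.
move=> _ [a' [b' ->]]; rewrite !W1_tmode.
have -> : ip 1 (f \- (fun z => a * tmode 1 1 0 0 z + - b * tmode 1 1 0 (pi / 2) z))
    (fun z => a' * tmode 1 1 0 0 z + - b' * tmode 1 1 0 (pi / 2) z) =
  dot (torus 1) (fun z => f z - (a * tmode 1 1 0 0 z + - b * tmode 1 1 0 (pi / 2) z))
    (fun z => a' * tmode 1 1 0 0 z + - b' * tmode 1 1 0 (pi / 2) z) by [].
have z1 (u : R) := sqintZ u t1; have z2 (u : R) := sqintZ u t2.
have p2 := sqintD (z1 a) (z2 (- b)).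
have r2 := sqintB f2 p2.
rewrite dotDr // !dotZr // !dotBl // !dotDl // !dotZl //.
rewrite !(dot_tmode ltr01) //= !mulr1n !mul1r !subrr cos0 subr0 sub0r cosN.
rewrite cos_pihalf !mul0r !mulr0 !mul1r addr0 add0r.
by rewrite /a /b opprK !divfK ?gt_eqF // !subrr !mulr0 addr0.
Qed.

Lemma P1_sqint (f : R * R -> R) : sqint (torus 1) f -> sqint (torus 1) (P1 1 f).
Proof.
move=> f2; have [[a [b ->]] _] := P1_orth f2; rewrite W1_tmode.
by apply: sqintD; apply: sqintZ; exact: tmode_sqint ltr01 _ _ _.
Qed.

(** W1 is spanned by the modes k = 1, j = 0, which are orthogonal to the others. *)
Lemma P1_mode (f : R * R -> R) (k j : int) (s : R) : sqint (torus 1) f -> 0 <= k ->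
  dot (torus 1) (fun z => f z - P1 1 f z) (tmode 1 k j s) =
  if (k == 1) && (j == 0) then 0 else dot (torus 1) f (tmode 1 k j s).
Proof.
move=> f2 k0; have p2 := P1_sqint f2.
have [[a [b pE]] ort] := P1_orth f2.
have t s' := tmode_sqint (@ltr01 R) 1 0 s'.
have tk := tmode_sqint (@ltr01 R) k j s.
case: ifP => [/andP[/eqP -> /eqP ->]|kj]; last first.
  rewrite dotBl // pE W1_tmode dotDl //; try exact: sqintZ.
  rewrite !dotZl //.
  have nz : (1 == k) && (0 == j) = false by rewrite eq_sym (eq_sym 0).
  have n1 : 1 + k != 0 by lia.
  by rewrite !(dot_tmode ltr01) // nz !mul0r !mulr0 addr0 subr0.
have h := ort (fun z => cos s * cos z.1 + (- sin s) * sin z.1).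
have /h : W1 (fun z : R * R => cos s * cos z.1 + (- sin s) * sin z.1).
  by exists (cos s), (- sin s).
have -> : (fun z : R * R => cos s * cos z.1 + (- sin s) * sin z.1) =
    tmode 1 1 0 s; last by [].
apply/funext => z; rewrite /tmode /wave mulr1 mul1r mul0r addr0 cosD.
by rewrite mulNr (mulrC (cos s)) (mulrC (sin s)).
Qed.

End Projection.

Section FrequencyGap.
Context {R : realType}.

Lemma lam_gap (alpha : R) : 1 < alpha -> forall k j,
  1 - (alpha ^+ 2)^-1 <= lam (freq alpha k) j.
Proof.
move=> a1 k j; have a0 : 0 < alpha by apply: lt_trans a1.
rewrite /lam lerD2l lerN2 lef_pV2 ?posrE ?exprn_gt0 //; last first.
  by apply: dsq_gt0; exact: freq_ge1 (ltW a1) _.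
rewrite /dsq; apply: ler_wpDr; first exact: sqr_ge0.
have fa : alpha <= freq alpha k.
  rewrite /freq ler_peMl ?(ltW a0) //.
  by rewrite -[k.+1%:Z%:~R]/(k.+1%:R) ler1n.
by rewrite ler_pXn2r ?nnegrE ?(ltW a0) // (le_trans (ltW a0)).
Qed.

Lemma lam_neq0 (alpha : R) : 1 < alpha -> forall k j, lam (freq alpha k) j != 0.
Proof.
move=> a1 k j; have a0 : 0 < alpha by apply: lt_trans a1.
have g0 : 0 < 1 - (alpha ^+ 2)^-1.
  by rewrite subr_gt0 invf_lt1 ?exprn_gt0 // exprn_egt1.
by rewrite gt_eqF // (lt_le_trans g0 (lam_gap a1 k j)).
Qed.

(** For alpha = 1 the symbol 1 - 1/d vanishes where d = 1, and d >= 2 elsewhere. *)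
Lemma lam_gap_square (k : nat) (j : int) :
  if (k == 0%N) && (j == 0) then lam (freq (1 : R) k) j = 0
  else 2^-1 <= lam (freq (1 : R) k) j.
Proof.
rewrite /lam /dsq /freq mulr1 -[k.+1%:Z%:~R]/(k.+1%:R).
case: ifP => [/andP[/eqP -> /eqP ->]|kj].
  by rewrite expr1n expr0n addr0 invr1 subrr.
suff : (k.+1%:R ^+ 2 + j%:~R ^+ 2)^-1 <= 2^-1 :> R by lra.
have h : 2 <= k.+1%:R ^+ 2 + j%:~R ^+ 2 :> R.
  rewrite -[k.+1%:R]/(k.+1%:Z%:~R) -[2]/(2%:Z%:~R) !expr2 -!intrM -intrD ler_int.
  have : (1 <= k)%N \/ 1 <= j \/ j <= -1 by lia.
  by move=> {kj} [h|[h|h]]; nia.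
by rewrite lef_pV2 ?posrE // (lt_le_trans _ h).
Qed.

End FrequencyGap.

Theorem theorem1p1 (R : realType) (alpha : R) (halpha : 1 <= alpha) :
  (1 < alpha ->
   forall tau delta : R, 0 < tau -> 0 < delta ->
   exists2 nu0 : R, 0 < nu0 &
   forall nu : R, 0 < nu < nu0 ->
   forall omega : R -> R * R -> R,
     solution alpha nu omega ->
     nonshear alpha (omega 0) ->
     ~ is_zero alpha (omega 0) ->
     L2norm alpha (omega (tau / nu)) < delta * L2norm alpha (omega 0))
  /\
  (alpha = 1 ->
   forall tau delta : R, 0 < tau -> 0 < delta ->
   exists2 nu0 : R, 0 < nu0 &
   forall nu : R, 0 < nu < nu0 ->
   forall omega : R -> R * R -> R,
     solution alpha nu omega ->
     nonshear alpha (omega 0) ->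
     ~ is_zero alpha (omega 0 \- P1 alpha (omega 0)) ->
     L2norm alpha (omega (tau / nu) \- P1 alpha (omega (tau / nu)))
       < delta * L2norm alpha (omega 0 \- P1 alpha (omega 0))).
Proof.
(* A squared factor delta^2 / 4 leaves room for the strict inequality. *)
have finish (g0 gT : R * R -> R) (delta : R) : 0 < delta ->
    sqint (torus alpha) g0 -> sqint (torus alpha) gT ->
    ~ is_zero alpha g0 ->
    dot (torus alpha) gT gT <= delta ^+ 2 / 4 * dot (torus alpha) g0 g0 ->
    L2norm alpha gT < delta * L2norm alpha g0.
  move=> de0 g02 gT2 nz h.
  have n0 : 0 < nrm (torus alpha) g0.
    rewrite lt_def nrm_ge0 andbT; apply/eqP => n0; apply: nz.
    exact: nrm_eq0 n0.
  have nT := nrm_ge0 (torus alpha) gT.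
  change (nrm (torus alpha) gT < delta * nrm (torus alpha) g0).
  have dn : 0 < delta * nrm (torus alpha) g0 by rewrite mulr_gt0.
  apply: (@le_lt_trans _ _ (delta * nrm (torus alpha) g0 / 2)); last lra.
  rewrite -(@ler_pXn2r _ 2) ?nnegrE //; last by rewrite divr_ge0 // ltW.
  rewrite nrm_sqr //; apply: (le_trans h).
  by rewrite -nrm_sqr //; lra.
split => [a1 tau delta tau0 de0|aE tau delta tau0 de0].
  have a0 : 0 < alpha by apply: lt_trans a1.
  have l0 : 0 < 1 - (alpha ^+ 2)^-1.
    by rewrite subr_gt0 invf_lt1 ?exprn_gt0 // exprn_egt1.
  have d40 : 0 < delta ^+ 2 / 4 by rewrite divr_gt0 // exprn_gt0.
  have gap k j := or_intror (lam (freq alpha k) j = 0) (lam_gap a1 k j).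
  have [nu0 nu00 dec] := all_modes_decay halpha l0 gap tau0 (mulr_gt0 l0 d40).
  exists nu0 => // nu nun omega sol ns nz.
  have nu_0 : 0 < nu by case/andP: nun.
  have T0 : 0 < tau / nu by rewrite divr_gt0.
  have [om2 _ _] := sol.
  apply: finish => //; try exact: om2.
    by apply: om2; exact: ltW.
  apply: (reduced_decay halpha l0 gap tau0 d40 nu_0 (dec nu nun) sol).
  - exact: om2.
  - by apply: om2; exact: ltW.
  - by move=> k j s; rewrite (negbTE (lam_neq0 a1 k j)).
  - by move=> k j s; rewrite (negbTE (lam_neq0 a1 k j)).
  - by move=> j s; exact: shear_mode_zero sol ns.
subst alpha.
have d40 : 0 < delta ^+ 2 / 4 by rewrite divr_gt0 // exprn_gt0.
have l0 : 0 < (2 : R)^-1 by rewrite invr_gt0.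
have gap k j : lam (freq (1 : R) k) j = 0 \/ 2^-1 <= lam (freq (1 : R) k) j.
  by have := lam_gap_square k j; case: (_ && _) => h; [left|right].
have [nu0 nu00 dec] := all_modes_decay halpha l0 gap tau0 (mulr_gt0 l0 d40).
exists nu0 => // nu nun omega sol ns nz.
have nu_0 : 0 < nu by case/andP: nun.
have T0 : 0 < tau / nu by rewrite divr_gt0.
have [om2 _ _] := sol.
have w0 : sqint (torus 1) (omega 0) by exact: om2.
have wT : sqint (torus 1) (omega (tau / nu)) by apply: om2; exact: ltW.
have red (f : R * R -> R) : sqint (torus 1) f -> reduced 1 f (fun z => f z - P1 1 f z).
  move=> f2 k j s; rewrite P1_mode //.
  have := @lam_gap_square R k j.
  rewrite (_ : (k.+1%:Z == 1) = (k == 0%N)); last by lia.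
  case: ifP => _; first by move=> ->; rewrite eqxx.
  by move=> h; rewrite gt_eqF // (lt_le_trans l0 h).
apply: finish => //.
- by apply: sqintB => //; exact: P1_sqint.
- by apply: sqintB => //; exact: P1_sqint.
apply: (reduced_decay halpha l0 gap tau0 d40 nu_0 (dec nu nun) sol).
- by apply: sqintB => //; exact: P1_sqint.
- by apply: sqintB => //; exact: P1_sqint.
- exact: red.
- exact: red.
move=> j s; rewrite P1_mode //=.
exact: shear_mode_zero sol ns.
Qed.
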